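(* There exist positive constants $c_1, c_2, c_3, c_4$ such that the following hold. (a) Let $G$ be an $n$-vertex graph with minimum degree $\delta(G) \geq \delta n$ for some $\delta := \delta(n) \geq c_1 n^{-1/3}$. If $\alpha(G) \leq c_2 \delta^2 n$ and $p := p(n) \geq \max\left\{\omega(n^{-2}), \frac{c_3 \log(1/\delta)}{\delta n^2}\right\}$, then $G \cup \mathbb{G}(n,p)$ is a.a.s. pancyclic. (b) There exists an $n$-vertex graph $H$ with minimum degree $\lfloor n/2 \rfloor - 1$ and independence number $\alpha(H) = 2$ such that if $H \cup \mathbb{G}(n,p)$ is a.a.s. Hamiltonian, then $p := p(n) = \omega(n^{-2})$. (c) For every $\delta := \delta(n)$ with $\delta = \Omega(n^{-1/3})$ and $\delta = o(1)$, there exists an $n$-vertex graph $H$ with minimum degree at least $\delta n$ satisfying $\alpha(H) = O(\delta^2 n)$ such that a.a.s. $H \cup \mathbb{G}(n,p)$ is not Hamiltonian whenever $p := p(n) \leq \frac{c_4 \log(1/\delta)}{\delta n^2}$.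
   Context: For an $n$-vertex graph $G$, $G \cup \mathbb{G}(n,p)$ denotes the union $G \cup R$ where $R$ is the binomial random graph on the vertex set $V(G)$ in which each pair of vertices is an edge independently with probability $p$. ''A.a.s.'' (asymptotically almost surely) means with probability tending to $1$ as $n \to \infty$. $\alpha(G)$ is the independence number and $\delta(G)$ the minimum degree. A graph on $n$ vertices is Hamiltonian if it has a cycle through all vertices, and pancyclic if it contains a cycle of length $\ell$ for every $3 \leq \ell \leq n$. Asymptotic notation ($\omega$, $o$, $O$, $\Omega$) is with respect to $n \to \infty$; e.g. $p = \omega(n^{-2})$ means $p n^2 \to \infty$. *)

(* Defs.v *)
From HB Require Import structures.
From mathcomp Require Import all_boot all_order all_algebra.
From mathcomp Require Import all_classical all_reals all_analysis.
Set Implicit Arguments. Unset Strict Implicit. Unset Printing Implicit Defensive.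
Import Order.TTheory GRing.Theory Num.Theory.
Local Open Scope ring_scope.

Definition pairs (n : nat) : {set {set 'I_n}} := [set e : {set 'I_n} | #|e| == 2%N].
Definition is_graph (n : nat) (E : {set {set 'I_n}}) : bool := E \subset pairs n.

Definition adj (n : nat) (E : {set {set 'I_n}}) (u v : 'I_n) : bool :=
  [set u; v] \in E.

Definition deg (n : nat) (E : {set {set 'I_n}}) (v : 'I_n) : nat :=
  #|[set u : 'I_n | adj E v u]|.

(* minimum degree (for n > 0 the default value n is never attained) *)
Definition mindeg (n : nat) (E : {set {set 'I_n}}) : nat :=
  \big[minn/n]_(v : 'I_n) deg E v.

Definition independent (n : nat) (E : {set {set 'I_n}}) (S : {set 'I_n}) : bool :=
  [forall u in S, forall v in S, ~~ adj E u v].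

Definition alpha (n : nat) (E : {set {set 'I_n}}) : nat :=
  \max_(S : {set 'I_n} | independent E S) #|S|.

(* E contains a cycle of length l (meaningful for l >= 3): an injective
   cyclic sequence of l vertices with consecutive ones adjacent. *)
Definition has_cycle (n : nat) (E : {set {set 'I_n}}) (l : nat) : bool :=
  [exists f : {ffun 'I_l -> 'I_n},
     injectiveb f && [forall i : 'I_l, adj E (f i) (f (ordS i))]].

Definition hamiltonian (n : nat) (E : {set {set 'I_n}}) : bool :=
  (3 <= n)%N && has_cycle E n.

Definition pancyclic (n : nat) (E : {set {set 'I_n}}) : bool :=
  [forall l : 'I_n.+1, (3 <= l)%N ==> has_cycle E l].

(* Probability that (G ∪ G(n,p)) has property P, where G(n,p) includes each
   pair independently with probability p. *)
Definition prob_union (R : realType) (n : nat) (G : {set {set 'I_n}}) (p : R)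
    (P : {set {set 'I_n}} -> bool) : R :=
  \sum_(E : {set {set 'I_n}} | E \subset pairs n)
     p ^+ #|E| * (1 - p) ^+ (#|pairs n| - #|E|) * (P (G :|: E))%:R.

(* Main.v *)
(** For part (a), let [G] have [n] vertices, minimum degree [d >= delta n] and
    [alpha(G) <= c2 delta^2 n], and put [s := c delta^2 n], which is much larger than both
    [alpha(G)] and [1 / delta].

    - Robust pieces.  [V(G)] splits into [O(1/delta)] pieces that stay connected after the
      deletion of any [s] vertices: repeatedly cut along small separators to find such a subset
      of minimum degree about [d / 4], take disjoint ones greedily, and attach each leftover
      vertex to a piece in which it has more than [s] neighbours.
    - Hubs.  Double counting paths of length two gives a vertex [v] such that nearly all pairs of
      neighbours of [v] have more than [s] common neighbours.  After pruning, any two of these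
      neighbours are joined by a path with three interior vertices that avoids any prescribed set
      of size [s].  Disjoint hubs of size [Omega(d)] cover half of [V(G)], with one inside every
      piece.
    - Random edges.  With high probability the random edges, thinned so as to form a matching,
      cross every bipartition of the hubs, inside each of two disjoint zones.  The first zone
      yields a spanning tree on the hubs, the second one a set of edges correcting its degree
      parities, and an Euler tour of their union passes through every hub.  Its passages through
      the hubs are completed by hub links.
    - Ladder.  One passage also contains a chain of [2 alpha + 2] triangles, which can be
      traversed with any number of vertices in an interval of length [2 alpha + 2].
    - Rotation.  A longest cycle through the ladder that meets every piece more than
      [alpha + 1] times is Hamiltonian, by the crossing argument of Chvatal and Erdos.
      A chord between vertices at even positions shortens it by at most [2 alpha], and the
      ladder fills in the missing lengths; closed ladders give the short cycles.

    For (b) and (c), take the disjoint cliques on the residue classes modulo [k], with [k = 2] and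
    [k ~ 1 / delta]: a clique without random edges leaving it excludes a Hamilton cycle.  In (c)
    such a clique exists by the second moment method. *)
Require Import Defs.
From mathcomp Require Import all_boot all_order all_algebra.
From mathcomp Require Import all_classical all_reals all_analysis.
From mathcomp Require Import zify ring lra.
From mathcomp Require Import fintype finset.
Set Implicit Arguments. Unset Strict Implicit. Unset Printing Implicit Defensive.
Import Order.TTheory GRing.Theory Num.Theory numFieldNormedType.Exports.


(** * Extremal choices and finite sets *)

Section Extremal.

Lemma exists_maximizer (X : Type) (ok : X -> Prop) (f : X -> nat) (bound : nat) :
  (forall x, ok x -> f x <= bound) -> (exists x, ok x) ->
  exists2 x, ok x & forall y, ok y -> f y <= f x.
Proof.
move=> f_bounded [x0 okx0].
pose attained m := `[< exists2 x, ok x & f x = m >].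
have ex_attained : exists m, attained m by exists (f x0); apply/asboolP; exists x0.
have attained_bounded m : attained m -> m <= bound.
  by case/asboolP=> x okx <-; exact: f_bounded.
case: (ex_maxnP ex_attained attained_bounded) => m /asboolP[x okx <-] fmax.
by exists x => // y oky; apply: fmax; apply/asboolP; exists y.
Qed.

Lemma exists_minimizer (X : Type) (ok : X -> Prop) (f : X -> nat) :
  (exists x, ok x) -> exists2 x, ok x & forall y, ok y -> f x <= f y.
Proof.
move=> [x0 okx0].
pose attained m := `[< exists2 x, ok x & f x = m >].
have ex_attained : exists m, attained m by exists (f x0); apply/asboolP; exists x0.
case: (ex_minnP ex_attained) => m /asboolP[x okx <-] fmin.
by exists x => // y oky; apply: fmin; apply/asboolP; exists y.
Qed.

End Extremal.

Section FiniteSets.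
Variable T : finType.
Implicit Types (x y : T) (A B F : {set T}) (P : {set {set T}}).

Lemma card_lt_exists F A : #|F| < #|A| -> exists2 x, x \in A & x \notin F.
Proof.
move=> ltFA; apply/subsetPn; apply: contraL ltFA => /subset_leq_card.
by rewrite -leqNgt.
Qed.

Lemma disjoint_neq A B x y : [disjoint A & B] -> x \in A -> y \in B -> x != y.
Proof. by move=> disjAB xA; apply: contraTneq => <-; rewrite (disjointFr disjAB xA). Qed.

Lemma card_setI_cover P A : trivIset P ->
  #|A :&: cover P| = \sum_(Q in P) #|A :&: Q|.
Proof.
move=> tP; rewrite -sum1_card (partition_big (pblock P) (mem P)) /=; last first.
  by move=> x /setIP[_ xP]; exact: pblock_mem.
apply: eq_bigr => Q QP; rewrite -sum1_card; apply: eq_bigl => x.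
rewrite !inE -andbA; congr (_ && _); apply/andP/idP => [[xP /eqP <-]|xQ].
  by rewrite mem_pblock.
by rewrite (def_pblock tP QP xQ); split=> //; apply/bigcupP; exists Q.
Qed.

Lemma cover_setU1 P A : cover (A |: P) = A :|: cover P.
Proof. by rewrite /cover bigcup_setU big_set1. Qed.

Lemma trivIset_setU1 P A : trivIset P -> [disjoint A & cover P] -> trivIset (A |: P).
Proof. by move=> tP AP; apply: trivIsetU; rewrite ?cover1 ?trivIset1. Qed.

Lemma card_cover_setU1 P A : A != set0 -> [disjoint A & cover P] ->
  #|cover P| < #|cover (A |: P)|.
Proof.
move=> A0 AP; rewrite cover_setU1 cardsU disjoint_setI0 // cards0 subn0.
by rewrite -[X in X < _]add0n ltn_add2r card_gt0.
Qed.

End FiniteSets.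

(** * Robustly connected pieces *)

Section RobustPieces.
Variables (T : finType) (g : rel T).
Hypotheses (gsym : symmetric g) (girr : irreflexive g).
Implicit Types (x y u v : T) (A B F U W Q : {set T}) (P : {set {set T}}) (e s : nat).

Definition nbr x : {set T} := [set y | g x y].

Definition within W : rel T := [rel x y | [&& x \in W, y \in W & g x y]].

Definition component W x : {set T} := [set y | connect (within W) x y].

Definition path_in W x y (p : seq T) : Prop :=
  [/\ path g x p, last x p = y, uniq (x :: p) & {subset x :: p <= W}].

Definition robust s W : Prop :=
  forall F, #|F| <= s -> {in W :\: F &, forall x y, y \in component (W :\: F) x}.

Lemma in_nbr x y : (y \in nbr x) = g x y.
Proof. by rewrite inE. Qed.

Lemma adj_neq x y : g x y -> x != y.
Proof. by apply: contraTneq => ->; rewrite girr. Qed.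

Lemma within_sym W : symmetric (within W).
Proof. by move=> x y; rewrite /within /= gsym andbCA. Qed.

Lemma component_refl W x : x \in component W x.
Proof. by rewrite inE connect0. Qed.

Lemma component_sym W x y : (x \in component W y) = (y \in component W x).
Proof. by rewrite !inE (sym_connect_sym (within_sym W)). Qed.

Lemma component_trans W x y z :
  y \in component W x -> z \in component W y -> z \in component W x.
Proof. by rewrite !inE; exact: connect_trans. Qed.

Lemma component_least W A x : x \in A ->
  (forall u v, u \in A -> v \in W -> g u v -> v \in A) -> component W x \subset A.
Proof.
move=> xA closedA; apply/subsetP=> y; rewrite inE => /connectP[p].
elim: p x xA => [|z p IHp] x xA /=; first by move=> _ ->.
by case/andP=> /and3P[_ zW xz]; apply: IHp; exact: closedA xz.
Qed.

Lemma component_sub W x : x \in W -> component W x \subset W.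
Proof. by move=> xW; exact: component_least. Qed.

Lemma component_step W x u v :
  x \in W -> u \in component W x -> v \in W -> g u v -> v \in component W x.
Proof.
move=> xW ux vW uv; apply: component_trans (ux) _; rewrite inE; apply: connect1.
by rewrite /within /= vW uv (subsetP (component_sub xW)).
Qed.

Lemma component_path W x y :
  x \in W -> y \in component W x -> exists p, path_in W x y p.
Proof.
move=> xW; rewrite inE => /connectP[p0 p0P ->].
case/shortenP: p0P => p pP pU _; exists p; split=> //.
  by apply: sub_path pP => u v /and3P[].
elim: p x xW pP {pU} => [|z p IHp] x xW /=; first by move=> _ u; rewrite inE => /eqP->.
case/andP=> /and3P[_ zW _] /(IHp _ zW) sub u.
by rewrite inE => /predU1P[->//|]; exact: sub.
Qed.

Lemma component_monotone W W' x : W \subset W' -> component W x \subset component W' x.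
Proof.
move=> WW'; apply/subsetP=> y; rewrite !inE; apply: connect_sub => u v.
by case/and3P=> uW vW uv; apply: connect1; rewrite /within /= !(subsetP WW').
Qed.

Lemma component_degree U F x u :
  x \in U :\: F -> u \in component (U :\: F) x ->
  #|nbr u :&: U| <= #|nbr u :&: component (U :\: F) x| + #|F|.
Proof.
move=> xUF ux; apply: leq_trans (leq_card_setU _ _); apply: subset_leq_card.
apply/subsetP=> v /setIP[uv vU]; rewrite inE; have [|vF] := boolP (v \in F).
  by rewrite orbT.
rewrite in_setI uv orbF /=; apply: component_step (ux) _ _ => //.
  by rewrite in_setD vF.
by rewrite -in_nbr.
Qed.

Lemma card_component_add_degree U F x y :
  x \in U :\: F -> y \in U :\: F -> y \notin component (U :\: F) x ->
  #|component (U :\: F) x| + #|nbr y :&: U| <= #|U|.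
Proof.
move=> xUF yUF yx; set A := component _ x.
have AU : A \subset U := subset_trans (component_sub xUF) (subsetDl _ _).
have disjA : [disjoint A & nbr y :&: U].
  rewrite -setI_eq0; apply/eqP/setP=> z; rewrite in_set0; apply/negbTE/negP.
  case/setIP=> zA /setIP[yz _]; case/negP: yx.
  by apply: component_step zA yUF _; rewrite // gsym -in_nbr.
have : A :|: (nbr y :&: U) \subset U by rewrite subUset AU subsetIr.
by move/subset_leq_card; rewrite cardsU (disjoint_setI0 disjA) cards0 subn0.
Qed.

(* The weight [s * #|U|] is what makes the condition pass to components: deleting a separator
   of size [s] costs at most [s] in degree, but also at least [e] vertices. *)
Definition dense e s U : Prop :=
  {in U, forall u, e * e + s * #|U| <= e * #|nbr u :&: U|}.

Lemma dense_degree e s U u : 0 < e -> dense e s U -> u \in U -> e <= #|nbr u :&: U|.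
Proof.
move=> e0 dU /dU; apply: contraTT; rewrite -!ltnNge => lt_e.
by apply: leq_trans (leq_addr _ _); rewrite ltn_pmul2l.
Qed.

Lemma dense_component e s U F x y : 0 < e -> dense e s U -> #|F| <= s ->
  x \in U :\: F -> y \in U :\: F -> y \notin component (U :\: F) x ->
  dense e s (component (U :\: F) x).
Proof.
move=> e0 dU Fs xUF yUF yx u uA; have /setDP[yU _] := yUF.
have uU : u \in U by have := subsetP (component_sub xUF) _ uA; case/setDP.
have degU := dU u uU; have degy := dense_degree e0 dU yU.
have degA := component_degree xUF uA.
have cardA := card_component_add_degree xUF yUF yx.
set cA := #|component _ _| in cardA *; set dA := #|nbr u :&: component _ _| in degA *.
have vertex_loss : s * (cA + e) <= s * #|U|.
  by rewrite leq_mul2l (leq_trans _ cardA) ?orbT // leq_add2l.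
have degree_loss : e * #|nbr u :&: U| <= e * (dA + s).
  by rewrite leq_mul2l (leq_trans degA) ?orbT // leq_add2l.
by rewrite !mulnDr in vertex_loss degree_loss; lia.
Qed.

Definition has_core e Q : Prop :=
  exists U, [/\ U \subset Q, U != set0 & {in U, forall u, e <= #|nbr u :&: U|}].

Lemma has_core_sub e Q Q' : Q \subset Q' -> has_core e Q -> has_core e Q'.
Proof. by move=> QQ' [U [UQ U0 dU]]; exists U; split=> //; exact: subset_trans QQ'. Qed.

Lemma has_core_card e Q : has_core e Q -> e <= #|Q|.
Proof.
case=> U [UQ /set0Pn[u uU] dU]; apply: leq_trans (dU u uU) (subset_leq_card _).
exact: subset_trans (subsetIr _ _) UQ.
Qed.

Lemma exists_robust_core B e s :
  0 < e -> s * #|T| <= e * e -> B != set0 ->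
  {in B, forall u, 2 * e <= #|nbr u :&: B|} ->
  exists2 U : {set T}, U \subset B & [/\ U != set0, robust s U & has_core e U].
Proof.
move=> e0 sT B0 degB.
have denseB : dense e s B.
  move=> u /degB degu; apply: leq_trans (_ : e * (2 * e) <= _); last first.
    by rewrite leq_mul2l degu orbT.
  by rewrite mulnCA mul2n -addnn leq_add2l (leq_trans _ sT) // leq_mul2l max_card orbT.
pose ok (U : {set T}) := [/\ U \subset B, U != set0 & dense e s U].
have [|U [UB U0 dU] Umin] := @exists_minimizer _ ok (fun U : {set T} => #|U|).
  by exists B.
exists U => //; split=> //; last by exists U; split=> // u; exact: dense_degree dU.
move=> F Fs x y xUF yUF; apply: contraT => yx.
have := card_component_add_degree xUF yUF yx.
have /(dense_degree e0 dU) : y \in U by case/setDP: yUF.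
suff /Umin : ok (component (U :\: F) x) by lia.
split; last exact: dense_component yx.
  apply: subset_trans (component_sub xUF) _.
  exact: subset_trans (subsetDl _ _) UB.
by apply/set0Pn; exists x; exact: component_refl.
Qed.

Lemma robust_setU1 s Q u : robust s Q -> s < #|nbr u :&: Q| -> robust s (u |: Q).
Proof.
move=> robQ degu F Fs.
have reaches x : x \in (u |: Q) :\: F ->
    exists2 z, z \in Q :\: F & z \in component ((u |: Q) :\: F) x.
  move=> xW; have /setDP[/setU1P[xu|xQ] xF] := xW; last first.
    by exists x; rewrite ?component_refl // in_setD xF.
  have [z /setIP[uz zQ] zF] := card_lt_exists (leq_ltn_trans Fs degu).
  exists z; first by rewrite in_setD zF.
  apply: component_step (component_refl _ _) _ _ => //; last by rewrite xu -in_nbr.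
  by rewrite in_setD zF setU1r.
move=> x y /reaches[x' x'W xx'] /reaches[y' y'W yy'].
apply: component_trans xx' _; apply: (@component_trans _ _ y'); last by rewrite component_sym.
by apply: subsetP (robQ _ Fs _ _ x'W y'W); apply/component_monotone/setSD/subsetUr.
Qed.

Lemma robust_degree s Q u : robust s Q -> s.+1 < #|Q| -> u \in Q -> s < #|nbr u :&: Q|.
Proof.
move=> robQ cardQ uQ; rewrite ltnNge; apply/negP=> Fs.
set F := nbr u :&: Q in Fs; have uF : u \notin F by rewrite !inE girr.
have [y yQ] : exists2 y, y \in Q & y \notin u |: F.
  by apply: card_lt_exists; rewrite cardsU1 uF; lia.
rewrite in_setU1 negb_or => /andP[yu yF].
have uW : u \in Q :\: F by rewrite in_setD uF.
have yW : y \in Q :\: F by rewrite in_setD yF.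
have : component (Q :\: F) u \subset [set u].
  apply: component_least => [|_ w /set1P-> /setDP[wQ wF] uw]; first exact: set11.
  by case/negP: wF; rewrite in_setI in_nbr uw.
by move/subsetP/(_ y (robQ _ Fs _ _ uW yW)); rewrite inE (negPf yu).
Qed.

Definition robust_family e s P : Prop :=
  trivIset P /\ {in P, forall Q, robust s Q /\ has_core e Q}.

Lemma card_cored_family e P :
  trivIset P -> {in P, forall Q, has_core e Q} -> #|P| * e <= #|T|.
Proof.
move=> tP coreP; apply: leq_trans (max_card (cover P)).
by rewrite -(eqP tP) -sum_nat_const; apply: leq_sum => Q /coreP; exact: has_core_card.
Qed.

Lemma exists_high_degree_piece e s P u : 0 < e -> s * #|T| <= e * e ->
  trivIset P -> {in P, forall Q, has_core e Q} ->
  2 * e < #|nbr u :&: cover P| -> exists2 Q, Q \in P & s < #|nbr u :&: Q|.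
Proof.
move=> e0 sT tP coreP; rewrite card_setI_cover // => deg_cover.
apply/exists_inP; apply: contraLR deg_cover.
rewrite negb_exists_in -leqNgt => /forall_inP low_deg.
have : \sum_(Q in P) #|nbr u :&: Q| <= #|P| * s.
  by rewrite -sum_nat_const; apply: leq_sum => Q /low_deg; rewrite -leqNgt.
move/leq_trans; apply; rewrite -(leq_pmul2r e0) mulnAC.
apply: leq_trans (_ : #|T| * s <= _); first by rewrite leq_mul2r card_cored_family ?orbT.
by rewrite mulnC (leq_trans sT) // -mulnA leq_pmull.
Qed.

Lemma robust_family_setU1 e s P U : robust_family e s P ->
  [disjoint U & cover P] -> robust s U -> has_core e U -> robust_family e s (U |: P).
Proof.
move=> [tP robP] UP robU coreU; split; first exact: trivIset_setU1.
by move=> Q /setU1P[->|/robP].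
Qed.

Lemma robust_family_attach e s P Q u : robust_family e s P ->
  Q \in P -> u \notin cover P -> s < #|nbr u :&: Q| ->
  robust_family e s ((u |: Q) |: (P :\ Q)) /\
  cover ((u |: Q) |: (P :\ Q)) = u |: cover P.
Proof.
move=> [tP robP] QP uP degu; have [robQ coreQ] := robP Q QP.
have QcP : Q \subset cover P by exact: bigcup_sup.
split; last by rewrite cover_setU1 coverD1 // -setUA -{1}(setIidPr QcP) setID.
apply: robust_family_setU1.
- by split=> [|Q' /setD1P[_ /robP]]; first exact: trivIsetD.
- rewrite coverD1 // -setI_eq0 setIUl setU_eq0 !setI_eq0 disjoints1 in_setD.
  by rewrite (negPf uP) andbF disjoints_subset setDE setCI setCK subsetUr.
- exact: robust_setU1.
- exact: has_core_sub (subsetUr _ _) coreQ.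
Qed.

Lemma robust_partition e s :
  0 < e -> s * #|T| <= e * e -> (forall u, 4 * e <= #|nbr u|) ->
  exists2 P, robust_family e s P & cover P = [set: T].
Proof.
move=> e0 sT degT.
have [||P famP Pmax] := @exists_maximizer _ (robust_family e s) (fun P => #|cover P|) #|T|.
- by move=> P _; exact: max_card.
- by exists set0; split=> [|Q]; rewrite ?inE //; apply/trivIsetP => A B; rewrite inE.
exists P => //; have [tP robP] := famP; apply/eqP/contraT => ncov.
set B := ~: cover P.
have B0 : B != set0 by rewrite -subset0 subCset setC0 subTset.
have disjB : [disjoint B & cover P] by rewrite disjoint_sym -subsets_disjoint.
have [degB|/forall_inPn[u]] := boolP [forall u in B, 2 * e <= #|nbr u :&: B|].
  have [U UB [U0 robU coreU]] := exists_robust_core e0 sT B0 (forall_inP degB).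
  have disjU := disjointWl UB disjB.
  have := Pmax _ (robust_family_setU1 famP disjU robU coreU).
  by rewrite leqNgt card_cover_setU1.
rewrite inE -ltnNge => uP degu.
have coreP Q (QP : Q \in P) : has_core e Q := proj2 (robP Q QP).
have [|Q QP degQ] := exists_high_degree_piece (u := u) e0 sT tP coreP.
  by have := degT u; rewrite -(cardsID (cover P) (nbr u)) setDE -/B; lia.
have [famP' covP'] := robust_family_attach famP QP uP degQ.
by have := Pmax _ famP'; rewrite covP' cardsU1 uP ltnn.
Qed.

End RobustPieces.

(** * Hubs *)

Section SumInequalities.
Variable I : finType.
Implicit Types (A : {set I}) (a b : I -> nat).

Lemma sum_lt_exists A a b : \sum_(i in A) a i < \sum_(i in A) b i ->
  exists2 i, i \in A & a i < b i.
Proof.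
move=> lt_sum; apply/exists_inP; apply: contraLR lt_sum.
rewrite negb_exists_in -leqNgt => /forall_inP le_ba.
by apply: leq_sum => i /le_ba; rewrite -leqNgt.
Qed.

Lemma sqr_sum_le A a : (\sum_(i in A) a i) ^ 2 <= #|A| * \sum_(i in A) a i ^ 2.
Proof.
rewrite -(leq_pmul2l (ltn0Sn 1)) -mulnn big_distrlr /= big_distrr /=.
have -> : 2 * (#|A| * \sum_(i in A) a i ^ 2) = \sum_(i in A) \sum_(j in A) (a i ^ 2 + a j ^ 2).
  under [RHS]eq_bigr do rewrite big_split sum_nat_const /=.
  by rewrite big_split -big_distrr sum_nat_const /= addnn mul2n.
apply: leq_sum => i _; rewrite big_distrr; apply: leq_sum => j _.
exact: nat_Cauchy.
Qed.

End SumInequalities.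

Lemma factor_le_of_mul_le_sqr (k m e : nat) : 0 < m -> e <= m -> k * m <= e * e -> k <= e.
Proof.
move=> m0 em kmee; rewrite -(leq_pmul2r m0); apply: leq_trans kmee _.
by rewrite leq_mul2l em orbT.
Qed.

Section Hubs.
Variables (T : finType) (g : rel T).
Hypotheses (gsym : symmetric g) (girr : irreflexive g).
Implicit Types (z m w u v : T) (A F U Z R Q : {set T}) (P H : {set {set T}}) (e s : nat).
Local Notation nbr := (nbr g).

Definition link W z z' : Prop :=
  exists w m w', [/\ uniq [:: w; m; w'], {subset [:: w; m; w'] <= (W : {set T})} &
    path g z [:: w; m; w'; z']].

Definition hub s U Z : Prop :=
  Z \subset U /\ forall F, #|F| <= s -> {in Z &, forall z z', link (U :\: F) z z'}.

Lemma hub_sub s U U' Z : U \subset U' -> hub s U Z -> hub s U' Z.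
Proof.
move=> UU' [ZU linkZ]; split; first exact: subset_trans ZU UU'.
move=> F Fs z z' zZ z'Z; have [w [m [w' [uq sub pth]]]] := linkZ F Fs z z' zZ z'Z.
by exists w, m, w'; split=> // x /sub; apply: subsetP; exact: setSD.
Qed.

Lemma card_nbrI A v : #|nbr v :&: A| = \sum_(u in A) g v u.
Proof.
rewrite -sum1_card big_mkcond [RHS]big_mkcond; apply: eq_bigr => u _.
by rewrite !inE; case: (g v u); case: (u \in A).
Qed.

Lemma sum_card_nbrI A B : \sum_(v in A) #|nbr v :&: B| = \sum_(u in B) #|nbr u :&: A|.
Proof.
under eq_bigr do rewrite card_nbrI; rewrite exchange_big /=.
by apply: eq_bigr => u _; rewrite card_nbrI; apply: eq_bigr => v _; rewrite gsym.
Qed.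

Definition codegree U z z' : nat := #|nbr z :&: nbr z' :&: U|.

Lemma codegreeE U z z' : codegree U z z' = \sum_(v in U) (g z v && g z' v).
Proof.
rewrite /codegree -sum1_card big_mkcond [RHS]big_mkcond; apply: eq_bigr => v _.
by rewrite !inE; case: (g z v && g z' v); case: (v \in U).
Qed.

Definition bad_partners s U A z : {set T} := [set z' in A | codegree U z z' <= s.+1].

Definition bad_pairs s U A : nat := \sum_(z in A) #|bad_partners s U A z|.

Lemma sum_bad_pairs s U R :
  \sum_(v in U) bad_pairs s U (nbr v :&: R) <= s.+1 * (#|R| * #|R|).
Proof.
have bad_pairsE v : bad_pairs s U (nbr v :&: R) =
    \sum_(z in R) \sum_(z' in R | codegree U z z' <= s.+1) (g v z && g v z').
  rewrite /bad_pairs big_mkcond [RHS]big_mkcond; apply: eq_bigr => z _.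
  rewrite in_setI in_nbr andbC; case: (z \in R) => //=; case: (g v z); last by rewrite big1.
  rewrite -sum1_card big_mkcond [RHS]big_mkcond /=; apply: eq_bigr => z' _.
  by rewrite !inE; case: (g v z'); case: (z' \in R); case: (_ <= _).
under eq_bigr do rewrite bad_pairsE; rewrite exchange_big /=.
rewrite mulnCA -sum_nat_const; apply: leq_sum => z _.
rewrite exchange_big mulnC -sum_nat_const big_mkcondr /=; apply: leq_sum => z' _.
by under eq_bigr do rewrite (gsym _ z) (gsym _ z'); rewrite -codegreeE; case: ifP.
Qed.

Lemma exists_rich_neighborhood s e U R :
  U != set0 -> R \subset U -> #|U| <= 2 * #|R| ->
  {in U, forall u, e <= #|nbr u :&: U|} -> 32 * s.+1 * #|U| <= e * e -> 0 < e ->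
  exists2 v, v \in U & let A := nbr v :&: R in
    16 * bad_pairs s U A <= #|A| ^ 2 /\ e ^ 2 <= 16 * #|A| ^ 2.
Proof.
move=> U0 RU UR degU sU e0; set m := #|U| in UR sU; set r := #|R| in UR.
have m0 : 0 < m by rewrite card_gt0.
pose cost v := 256 * bad_pairs s U (nbr v :&: R) + e ^ 2.
have [|v vU] := @sum_lt_exists _ U cost (fun v => 16 * #|nbr v :&: R| ^ 2).
  have degR : (e * r) ^ 2 <= m * \sum_(v in U) #|nbr v :&: R| ^ 2.
    apply: leq_trans (sqr_sum_le _ _); rewrite leq_sqr sum_card_nbrI mulnC -sum_nat_const.
    by apply: leq_sum => u /(subsetP RU); exact: degU.
  have few_bad := sum_bad_pairs s U R.
  rewrite big_split -!big_distrr sum_nat_const /= -/m -/r in few_bad *.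
  set bad := \sum_(v in U) bad_pairs _ _ _ in few_bad *.
  set sqr := \sum_(v in U) _ in degR *.
  have bad_cost : 256 * (m * bad) <= 8 * (e * e * (r * r)).
    apply: leq_trans (_ : 256 * (m * (s.+1 * (r * r))) <= _).
      by rewrite !leq_mul2l few_bad !orbT.
    by have := leq_mul sU (leqnn (r * r)); lia.
  have size_cost : m * (m * (e * e)) <= 4 * (e * e * (r * r)).
    by have := leq_mul (leq_mul UR UR) (leqnn (e * e)); lia.
  by rewrite -(ltn_pmul2l m0); lia.
by rewrite /cost /= => lt_cost; exists v => //=; split; lia.
Qed.

Definition light s U A : {set T} := [set z in A | 4 * #|bad_partners s U A z| <= #|A|].

Lemma light_sub s U A : light s U A \subset A.
Proof. by apply/subsetP=> z; rewrite inE => /andP[]. Qed.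

Lemma card_light s U A : 16 * bad_pairs s U A <= #|A| ^ 2 -> 3 * #|A| <= 4 * #|light s U A|.
Proof.
move=> few_bad; set N := A :\: light s U A.
have heavy : #|N| * #|A| <= 4 * bad_pairs s U A.
  have NA : N \subset A := subsetDl _ _.
  rewrite /bad_pairs big_distrr (big_setID N) /= (setIidPr NA) -sum_nat_const.
  apply: leq_trans (leq_addr _ _); apply: leq_sum => z /setDP[zA].
  by rewrite inE zA /= -ltnNge => /ltnW.
have [->|A0] := posnP #|A|; first by rewrite muln0.
have := cardsID (light s U A) A; rewrite (setIidPr (light_sub _ _ _)) -/N.
suff : 4 * #|N| <= #|A| by lia.
by rewrite -(leq_pmul2r A0); lia.
Qed.

Lemma link_light s U A F z z' :
  A \subset U -> 2 * s < #|A| -> #|F| <= s -> z \in light s U A -> z' \in light s U A ->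
  link (U :\: F) z z'.
Proof.
rewrite ![_ \in light _ _ _]inE => AU sA Fs /andP[_ few_z] /andP[_ few_z'].
have [m mA] : exists2 m, m \in A &
    m \notin F :|: (bad_partners s U A z :|: bad_partners s U A z').
  by apply: card_lt_exists; rewrite !cardsU; lia.
rewrite !in_setU !negb_or ![m \in bad_partners _ _ _ _]inE mA -!ltnNge /=.
case/and3P=> mF good_z good_z'.
have [|w /setIP[/setIP[zw mw] wU] wF] := @card_lt_exists _ F (nbr z :&: nbr m :&: U).
  by apply: leq_ltn_trans Fs (ltnW _).
have [|w' /setIP[/setIP[zw' mw'] w'U]] := @card_lt_exists _ (w |: F) (nbr z' :&: nbr m :&: U).
  by apply: leq_ltn_trans good_z'; rewrite cardsU1 addnC -addn1 leq_add // leq_b1.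
rewrite in_setU1 negb_or => /andP[w'w w'F]; rewrite !in_nbr in zw mw zw' mw'.
exists w, m, w'; split.
- by rewrite /= !inE !negb_or eq_sym (adj_neq girr mw) (adj_neq girr mw') eq_sym w'w.
- by move=> x; rewrite !inE => /or3P[] /eqP->; rewrite ?wF ?mF ?w'F //= (subsetP AU).
- by rewrite /= zw (gsym w) mw mw' gsym zw'.
Qed.

(* The hub is taken inside the neighbourhood of a vertex [v] for which few pairs of neighbours
   have small codegree; averaging over [v] works because such a pair has few common neighbours. *)
Lemma exists_hub U R e s :
  U != set0 -> R \subset U -> #|U| <= 2 * #|R| ->
  {in U, forall u, e <= #|nbr u :&: U|} -> 32 * s.+1 * #|U| <= e * e ->
  exists2 Z : {set T}, Z \subset R & hub s U Z /\ e <= 8 * #|Z|.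
Proof.
move=> U0 RU UR degU sU; have m0 : 0 < #|U| by rewrite card_gt0.
have e_le : e <= #|U|.
  case/set0Pn: U0 => u /degU degu; apply: leq_trans degu (subset_leq_card _).
  exact: subsetIr.
have se : 32 * s.+1 <= e := factor_le_of_mul_le_sqr m0 e_le sU.
have e0 : 0 < e by apply: leq_trans se.
have [v _] := exists_rich_neighborhood U0 RU UR degU sU e0.
set A := nbr v :&: R => -[few_bad large_A].
have eA : e <= 4 * #|A| by rewrite -leq_sqr expnMn.
have cardZ := card_light few_bad.
have AR : A \subset R := subsetIr _ _.
exists (light s U A); first exact: subset_trans (light_sub _ _ _) AR.
split; last by lia.
split=> [|F Fs z z' zA z'A].
  by rewrite (subset_trans (light_sub _ _ _)) ?(subset_trans AR).
apply: link_light zA z'A => //; first exact: subset_trans AR RU.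
by lia.
Qed.

Definition hub_family e s P H : Prop :=
  [/\ trivIset H, {in H, forall Z, hub s setT Z /\ e <= 8 * #|Z|} &
      {in P, forall Q, exists2 Z, Z \in H & hub s Q Z}].

Lemma hub_family_setU1 e s P H Z : hub_family e s P H ->
  [disjoint Z & cover H] -> hub s setT Z -> e <= 8 * #|Z| -> hub_family e s P (Z |: H).
Proof.
move=> [tH hubH PH] ZH hubZ cardZ; split; first exact: trivIset_setU1.
  by move=> X /setU1P[->|/hubH].
by move=> Q /PH[X XH hubX]; exists X => //; exact: setU1r.
Qed.

Lemma hub_family_in_pieces e s P :
  32 * s.+1 * #|T| <= e * e -> trivIset P -> {in P, forall Q, has_core g e Q} ->
  exists H, hub_family e s P H.
Proof.
move=> sT tP coreP.
have /choice[f fP] Q : exists Z, Q \in P -> hub s Q Z /\ e <= 8 * #|Z|.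
  have [/coreP[U [UQ U0 degU]]|_] := boolP (Q \in P); last by exists set0.
  have [||Z _ [hubZ cardZ]] := exists_hub (s := s) U0 (subxx U) _ degU.
  - by lia.
  - by apply: leq_trans sT; rewrite leq_mul2l max_card orbT.
  by exists Z => _; split=> //; exact: hub_sub UQ hubZ.
exists (f @: P); split.
- apply/trivIsetP => _ _ /imsetP[Q QP ->] /imsetP[Q' Q'P ->] ff'.
  have [[fQ _] _] := fP Q QP; have [[fQ' _] _] := fP Q' Q'P.
  apply: disjointWl fQ (disjointWr fQ' _); apply: (trivIsetP tP) => //.
  by apply: contra_neq ff' => ->.
- move=> _ /imsetP[Q QP ->]; have [hubQ cardQ] := fP Q QP.
  by split=> //; exact: hub_sub (subsetT _) hubQ.
- by move=> Q QP; exists (f Q); [exact: imset_f | case: (fP Q QP)].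
Qed.

Lemma exists_hub_family e s P :
  0 < e -> 32 * s.+1 * #|T| <= e * e -> (forall u, e <= #|nbr u|) ->
  trivIset P -> {in P, forall Q, has_core g e Q} ->
  exists2 H, hub_family e s P H & #|T| <= 2 * #|cover H|.
Proof.
move=> e0 sT degT tP coreP.
have [||H famH Hmax] := @exists_maximizer _ (hub_family e s P) (fun H => #|cover H|) #|T|.
- by move=> H _; exact: max_card.
- exact: hub_family_in_pieces.
exists H => //; rewrite leqNgt; apply/negP => small_cover.
have cardR := cardsC (cover H).
have T0 : [set: T] != set0 by rewrite -card_gt0 cardsT; lia.
have [|||Z ZR [hubZ cardZ]] := exists_hub (s := s) (e := e) T0 (subsetT (~: cover H)).
- by rewrite cardsT; lia.
- by move=> u _; rewrite setIT.
- by rewrite cardsT.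
have ZH : [disjoint Z & cover H] by rewrite disjoints_subset.
have Z0 : Z != set0 by rewrite -card_gt0; lia.
have := Hmax _ (hub_family_setU1 famH ZH hubZ cardZ).
by rewrite leqNgt card_cover_setU1.
Qed.

End Hubs.

(** * Ladders and short cycles *)

Section PathsAndIndependence.
Variables (T : finType) (g : rel T).
Hypotheses (gsym : symmetric g) (girr : irreflexive g).
Implicit Types (x y z v : T) (S D W I : {set T}) (a k l m lo hi : nat).
Local Notation nbr := (nbr g).
Local Notation path_in := (path_in g).

Definition alpha_le a : Prop :=
  forall S, a < #|S| -> exists x y, [/\ x \in S, y \in S & g x y].

Definition cycle_of_length (h : rel T) l : Prop :=
  exists c : seq T, [/\ cycle h c, uniq c & size c = l].

Definition ladder_on D x y lo hi : Prop :=
  forall m, lo <= m <= hi -> exists2 q, path_in D x y q & size (x :: q) = m.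

Lemma alpha_le_ord a n (A : {set 'I_n}) (f : 'I_n -> T) :
  alpha_le a -> {in A &, injective f} -> a < #|A| ->
  exists i j, [/\ i \in A, j \in A, i < j & g (f i) (f j)].
Proof.
move=> alphaT f_inj aA.
have [|_ [_ [/imsetP[i iA ->] /imsetP[j jA ->] fij]]] := alphaT (f @: A).
  by rewrite card_in_imset.
have [ij|ji|/val_inj ij] := ltngtP i j; first by exists i, j.
  by exists j, i; rewrite gsym.
by rewrite ij girr in fij.
Qed.

Lemma path_in_cat W W' x y z p q :
  path_in W x y p -> path g y q -> last y q = z -> uniq q ->
  {subset q <= W'} -> [disjoint W & W'] -> path_in (W :|: W') x z (p ++ q).
Proof.
move=> [pth_p last_p uniq_p subW] pth_q last_q uniq_q subW' disjW.
split; first by rewrite cat_path pth_p last_p.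
- by rewrite last_cat last_p.
- rewrite -cat_cons cat_uniq uniq_p uniq_q andbT /=.
  apply/hasPn=> u /subW' uW'; apply/negP => /subW uW.
  by rewrite (disjointFr disjW uW) in uW'.
- by move=> u; rewrite -cat_cons mem_cat in_setU => /orP[/subW->|/subW'->]; rewrite ?orbT.
Qed.

Lemma cycle_of_path_link D x y p : path_in D x y p -> link g (~: D) y x ->
  cycle_of_length g (size (x :: p) + 3).
Proof.
move=> pathD [w [m [w' [uniq_link sub_link path_link]]]].
have [pth last_p uniq_p subD] := pathD.
exists (x :: p ++ [:: w; m; w']); split; last by rewrite /= size_cat /=; lia.
  by rewrite /cycle rcons_cat cat_path pth last_p.
rewrite -cat_cons cat_uniq uniq_p uniq_link andbT; apply/hasPn=> z /sub_link.
by rewrite in_setC; apply: contra => /subD.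
Qed.

Lemma exists_maximal_path S x : x \in S ->
  exists y p, path_in S y (last y p) p /\ {subset nbr y :&: S <= p}.
Proof.
move=> xS; pose ok (c : T * seq T) := path_in S c.1 (last c.1 c.2) c.2.
have [||[y p] okp pmax] := @exists_maximizer _ ok (fun c => size c.2) #|T|.
- by move=> [y p] [_ _ /andP[_ /card_uniqP <-] _]; exact: max_card.
- by exists (x, [::]); split=> // z; rewrite inE => /eqP->.
exists y, p; split=> // z /setIP[yz zS]; apply: contraT => zp; rewrite in_nbr in yz.
have [pth _ uniq_p subS] := okp.
have /pmax : ok (z, y :: p); last by rewrite ltnn.
split=> //=; first by rewrite gsym yz.
  by rewrite inE negb_or zp eq_sym (adj_neq girr yz).
by move=> u /predU1P[->|/subS].
Qed.

Lemma exists_path_or_independent k S :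
  (exists x y p, path_in S x y p /\ size p = k) \/
  exists I, [/\ I \subset S, {in I &, forall x y, ~~ g x y} & #|S| <= k * #|I|].
Proof.
have [n] := ubnP #|S|; elim: n S => // n IHn S Sn.
have [->|[x xS]] := set_0Vmem S.
  by right; exists set0; rewrite sub0set cards0; split=> // x y; rewrite inE.
have [y [p [[pth _ uniq_p subS] nbr_y]]] := exists_maximal_path xS.
have [kp|pk] := leqP k (size p).
  left; exists y, (last y (take k p)), (take k p); split; last exact: size_takel.
  split=> //; first exact: take_path.
    exact: (take_uniq k.+1 uniq_p).
  by move=> z zp; apply: subS; exact: (@mem_take k.+1 _ (y :: p)).
set C := [set z in y :: p].
have CS : C \subset S by apply/subsetP=> z; rewrite inE; exact: subS.
have cardC : #|C| = (size p).+1 by rewrite cardsE; exact/card_uniqP.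
have cardSC := cardsD S C; rewrite (setIidPr CS) cardC in cardSC.
have CleS := subset_leq_card CS; rewrite cardC in CleS.
have [|[u [v [q [[pth_q last_q uniq_q subSC] sz_q]]]]|[I [ISC indepI cardI]]] := IHn (S :\: C).
- by lia.
- by left; exists u, v, q; split=> //; split=> // z /subSC /setDP[].
have [IS IC] : I \subset S /\ [disjoint I & C].
  by split; [apply: subset_trans ISC (subsetDl _ _) | move: ISC; rewrite subsetD => /andP[]].
have yI : y \notin I by rewrite (disjointFl IC) // inE mem_head.
have nadj_y z : z \in I -> ~~ g y z.
  move=> zI; apply: contraFN (disjointFr IC zI) => yz.
  by rewrite !inE nbr_y ?orbT // in_setI in_nbr yz (subsetP IS).
right; exists (y |: I); split.
- by rewrite subUset sub1set IS subS // mem_head.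
- move=> u v /setU1P[->|uI] /setU1P[->|vI]; first by rewrite girr.
  + exact: nadj_y.
  + by rewrite gsym nadj_y.
  + exact: indepI.
- by rewrite cardsU1 yI mulnDr muln1; lia.
Qed.

Lemma long_path a k S : alpha_le a -> k * a < #|S| ->
  exists x y p, path_in S x y p /\ size p = k.
Proof.
move=> alphaT kaS; have [//|[I [_ indepI cardI]]] := exists_path_or_independent k S.
have [/alphaT[x [y [xI yI]]]|Ia] := ltnP a #|I|; first by rewrite (negPf (indepI x y xI yI)).
have : k * #|I| <= k * a by rewrite leq_mul2l Ia orbT.
by lia.
Qed.

Lemma fan_cycle a l v : alpha_le a -> l * a < #|nbr v| -> cycle_of_length g l.+2.
Proof.
move=> alphaT /(long_path alphaT)[x [y [p [[pth last_p uniq_p sub_nbr] <-]]]].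
have vx : g v x by rewrite -in_nbr; apply: sub_nbr; exact: mem_head.
have vy : g v y by rewrite -in_nbr; apply: sub_nbr; rewrite -last_p mem_last.
exists (v :: x :: p); split=> //.
  by rewrite /cycle rcons_path /= pth last_p vx gsym vy.
by rewrite cons_uniq uniq_p andbT; apply/negP => /sub_nbr; rewrite in_nbr girr.
Qed.

End PathsAndIndependence.

Section Ladders.
Variables (T : finType) (g : rel T) (a e s : nat) (Z : {set T}).
Hypotheses (gsym : symmetric g) (girr : irreflexive g).
Hypotheses (alphaT : alpha_le g a) (e0 : 0 < e) (a_le_s : a <= s).
Hypothesis sT : 32 * s.+1 * #|T| <= e * e.
Hypothesis degT : forall u, 4 * e <= #|nbr g u|.
Hypotheses (hubZ : hub g s setT Z) (cardZ : e <= 8 * #|Z|).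
Implicit Types (x y z w b c : T) (F D : {set T}) (l r lo hi : nat).
Local Notation nbr := (nbr g).

Lemma triangle_in_hub F : #|F| <= s ->
  exists w x y, [/\ w \notin F, x \in Z :\: F, y \in Z :\: F & [&& g w x, g w y & g x y]].
Proof.
move=> Fs; have /card_gt0P[z0 _] : 0 < #|Z| by lia.
have eT : e <= #|T| by apply: leq_trans (max_card (nbr z0)); have := degT z0; lia.
have T0 : 0 < #|T| by lia.
have se : 32 * s.+1 <= e := factor_le_of_mul_le_sqr T0 eT sT.
have [|w wF degw] := @sum_lt_exists _ (~: F) (fun=> a + s) (fun w => #|nbr w :&: Z|).
  rewrite sum_nat_const sum_card_nbrI // (@leq_trans (#|Z| * (3 * e))) //.
    have : e * (3 * e) <= 8 * #|Z| * (3 * e) by rewrite leq_mul2r cardZ orbT.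
    have : #|~: F| * (a + s) <= #|T| * (2 * s) by apply: leq_mul; [exact: max_card | lia].
    by lia.
  rewrite -sum_nat_const; apply: leq_sum => z _; rewrite -setDE.
  have := cardsID F (nbr z); have := degT z.
  by have := subset_leq_card (subsetIr (nbr z) F); lia.
have [|x [y [xS yS xy]]] := alphaT (S := (nbr w :&: Z) :\: F).
  have := cardsID F (nbr w :&: Z).
  by have := subset_leq_card (subsetIr (nbr w :&: Z) F); lia.
exists w, x, y; move: wF xS yS; rewrite !inE => -> /and3P[-> -> ->] /and3P[-> -> ->].
by rewrite xy.
Qed.

Lemma ladder_base F : #|F| <= s ->
  exists x y D, [/\ x \in Z, y \in Z, [disjoint D & F], #|D| = 3 & ladder_on g D x y 2 3].
Proof.
move=> /triangle_in_hub[w [x [y [wF /setDP[xZ xF] /setDP[yZ yF] /and3P[wx wy xy]]]]].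
have xwy_uniq : uniq [:: x; w; y].
  by rewrite /= !inE negb_or eq_sym !(adj_neq girr wx, adj_neq girr wy, adj_neq girr xy).
exists x, y, [set z in [:: x; w; y]]; split=> //.
- by rewrite disjoint_subset; apply/subsetP=> z; rewrite !inE => /or3P[] /eqP->.
- by rewrite cardsE; exact/card_uniqP.
move=> [|[|[|[|//]]]] // _.
  exists [:: y] => //; split; rewrite //= ?xy ?inE ?(adj_neq girr xy) //.
  by move=> z; rewrite !inE => /orP[] /eqP->; rewrite eqxx ?orbT.
exists [:: w; y] => //; split; rewrite //= ?wy ?andbT 1?gsym //.
by move=> z; rewrite !inE.
Qed.

Lemma exists_rung F y : y \in Z -> #|F| + 3 <= s ->
  exists p1 p2 p3 b w c, let rung := [:: p1; p2; p3; b; w; c] in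
    [/\ c \in Z, uniq rung, {subset rung <= ~: F}, path g y rung & g b c].
Proof.
move=> yZ Fs; have [|w [b [c [wF bZ cZ /and3P[wb wc bc]]]]] := @triangle_in_hub F; first by lia.
move: bZ cZ => /setDP[bZ bF] /setDP[cZ cF].
have triangle_uniq : uniq [:: b; w; c].
  by rewrite /= !inE negb_or eq_sym !(adj_neq girr wb, adj_neq girr wc, adj_neq girr bc).
pose avoided := F :|: [set z in [:: b; w; c]].
have avoided_small : #|avoided| <= s.
  apply: leq_trans (leq_card_setU _ _) (leq_trans _ Fs).
  by rewrite leq_add2l cardsE card_size.
have [p1 [p2 [p3 [link_uniq sub_link path_link]]]] := (proj2 hubZ) _ avoided_small y b yZ bZ.
exists p1, p2, p3, b, w, c => rung.
have rungE : rung = [:: p1; p2; p3] ++ [:: b; w; c] by [].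
split=> //; last first.
- by move: path_link; rewrite /= (gsym b) wb wc !andbT.
- move=> z; rewrite rungE mem_cat in_setC => /orP[/sub_link/setDP[_]|].
    by apply: contra; rewrite [z \in avoided]in_setU => ->.
  by rewrite !inE => /or3P[] /eqP->.
- rewrite rungE cat_uniq link_uniq triangle_uniq andbT.
  apply/hasPn=> z z_tri; apply/negP => /sub_link/setDP[_].
  by rewrite !inE /= in z_tri *; rewrite z_tri orbT.
Qed.

Lemma ladder_step F D x y lo hi : y \in Z -> #|F| + #|D| + 3 <= s ->
  [disjoint D & F] -> lo <= hi -> ladder_on g D x y lo hi ->
  exists c D', [/\ c \in Z, [disjoint D' & F], #|D'| = #|D| + 6 &
    ladder_on g D' x c (lo + 5) (hi + 6)].
Proof.
move=> yZ FDs DF lo_hi ladD.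
have [|p1 [p2 [p3 [b [w [c]]]]]] := @exists_rung (F :|: D) y yZ; first by rewrite cardsU; lia.
set rung := [:: _; _; _; _; _; _] => -[cZ rung_uniq rungFD path_rung bc].
have disjD : [disjoint D & [set z in rung]].
  rewrite disjoint_sym disjoint_subset; apply/subsetP=> z; rewrite inE => /rungFD.
  by rewrite !inE negb_or => /andP[].
exists c, (D :|: [set z in rung]); split=> //.
- rewrite disjoints_subset subUset -disjoints_subset DF.
  by apply/subsetP=> z; rewrite inE => /rungFD; rewrite !in_setC in_setU negb_or => /andP[].
- by rewrite cardsU disjoint_setI0 // cards0 cardsE (card_uniqP rung_uniq) subn0.
have extend q ext : path_in g D x y q -> path g y ext -> last y ext = c -> subseq ext rung ->
    path_in g (D :|: [set z in rung]) x c (q ++ ext).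
  move=> pathD pth last_c sub; apply: path_in_cat pathD pth last_c _ _ disjD.
    exact: subseq_uniq sub rung_uniq.
  by move=> z /(mem_subseq sub) z_rung; rewrite in_set.
move=> m /andP[lom mhi]; have [m_small|m_large] := leqP m (hi + 5).
  have [|q pathD sz_q] := ladD (m - 5); first by clear -lom m_small; lia.
  have sz_ext : size (x :: q ++ [:: p1; p2; p3; b; c]) = m.
    by move: sz_q lom; rewrite /= size_cat /=; clear; lia.
  exists (q ++ [:: p1; p2; p3; b; c]) => //; apply: extend => //.
    by move: path_rung => /and5P[yp1 p12 p23 p3b _]; rewrite /= yp1 p12 p23 p3b bc.
  exact: (cat_subseq (subseq_refl [:: p1; p2; p3; b]) (subseq_cons [:: c] w)).
have [|q pathD sz_q] := ladD hi; first by rewrite lo_hi leqnn.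
have sz_ext : size (x :: q ++ rung) = m.
  by move: sz_q mhi m_large; rewrite /= size_cat /=; clear; lia.
by exists (q ++ rung) => //; exact: extend.
Qed.

Lemma ladder r F : #|F| + 6 * r <= s ->
  exists x y D, [/\ x \in Z, y \in Z, [disjoint D & F], #|D| = 6 * r + 3 &
    ladder_on g D x y (5 * r + 2) (6 * r + 3)].
Proof.
elim: r => [|r IHr] Frs; first by apply: ladder_base; lia.
have [|x [y [D [xZ yZ DF cardD ladD]]]] := IHr; first by lia.
have [||c [D' [cZ D'F cardD' ladD']]] := ladder_step yZ _ DF _ ladD.
- by rewrite cardD; clear -Frs; lia.
- by clear; lia.
exists x, c, D'; split=> //; first by rewrite cardD' cardD; clear; lia.
by move=> m m_range; apply: ladD'; move: m_range; clear; lia.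
Qed.

Lemma closed_ladder_cycle l : 25 <= l -> l + 3 <= s -> cycle_of_length g l.
Proof.
move=> l25 ls; pose r := (l + 5) %/ 6 - 1.
have [|x [y [D [xZ yZ _ cardD ladD]]]] := @ladder r set0; first by rewrite cards0 /r; lia.
have [|q pathD sz_q] := ladD (l - 3); first by rewrite /r; lia.
have -> : l = size (x :: q) + 3 by lia.
apply: cycle_of_path_link pathD _; rewrite -setTD.
by apply: (proj2 hubZ) => //; rewrite cardD /r; lia.
Qed.

End Ladders.

(** * Extending and shortening cycles through a ladder *)

Section ConsecutivePairs.
Variable T : finType.
Implicit Types (Q : {set T}) (c : seq T).

Definition has_edge_in Q c : bool :=
  ~~ sorted [rel u v | ~~ ((u \in Q) && (v \in Q))] c.

Lemma has_edge_inP Q c :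
  reflect (exists c1 u v c2, [/\ c = c1 ++ u :: v :: c2, u \in Q & v \in Q])
    (has_edge_in Q c).
Proof.
apply: (iffP idP) => [|[c1 [u [v [c2 [-> uQ vQ]]]]]]; last first.
  rewrite /has_edge_in; apply/negP => /cat_sorted2[_] /=.
  by rewrite uQ vQ.
elim: c => [|u [|v c] IHc] //; rewrite /has_edge_in /= negb_and negbK.
case/orP=> [/andP[uQ vQ]|/IHc[c1 [u' [v' [c2 [-> uQ vQ]]]]]].
  by exists [::], u, v, c.
by exists (u :: c1), u', v', c2.
Qed.

Lemma has_edge_in_cat Q p c : has_edge_in Q p || has_edge_in Q c -> has_edge_in Q (p ++ c).
Proof. by rewrite /has_edge_in -negb_and; apply: contra => /cat_sorted2[-> ->]. Qed.

Lemma has_edge_in_insert Q c1 u v c2 p : u \notin Q ->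
  has_edge_in Q (c1 ++ u :: v :: c2) -> has_edge_in Q (c1 ++ u :: p ++ v :: c2).
Proof.
move=> uQ; apply: contra; rewrite -!(cat_rcons u) => sorted_ins.
have [sorted1 /cat_sorted2[_ sorted2]] := cat_sorted2 sorted_ins.
case: c1 sorted1 {sorted_ins} => [|y c1] /=; first by rewrite (negPf uQ).
by rewrite cat_path last_rcons => -> /=; rewrite (negPf uQ).
Qed.

Lemma split_at_successors (x0 : T) c i j : i < j -> j.+1 < size c ->
  exists c1 M c2,
    c = c1 ++ nth x0 c i :: (nth x0 c i.+1 :: M) ++ nth x0 c j.+1 :: c2 /\
    last (nth x0 c i.+1) M = nth x0 c j.
Proof.
move=> ij jc; have ic : i.+1 < size c := leq_ltn_trans ij (ltnW jc).
pose M := take (j - i.+1) (drop i.+2 c).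
have middleE : nth x0 c i.+1 :: M = take (j - i) (drop i.+1 c).
  by rewrite [in RHS](drop_nth x0 ic) -(subnSK ij).
exists (take i c), M, (drop j.+2 c); split.
  rewrite middleE -(drop_nth x0 jc) -(subnK (leqW ij)).
  by rewrite subSS -drop_drop cat_take_drop -(drop_nth x0 (ltnW ic)) cat_take_drop.
have := congr1 (last x0) middleE; rewrite /= -(subnSK ij) (take_nth x0) ?size_drop; last lia.
by rewrite last_rcons nth_drop => ->; congr nth; lia.
Qed.

End ConsecutivePairs.

Section Routes.
Variables (T : finType) (g h : rel T).
Hypotheses (gsym : symmetric g) (girr : irreflexive g).
Hypotheses (hsym : symmetric h) (gh : subrel g h).
Variables (D : {set T}) (b d : T).
Implicit Types (u v w x y z : T) (c p : seq T) (Q : {set T}) (P : {set {set T}}).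
Local Notation nbr := (nbr g).

(* Together with any path from [d] to [b] inside [D], a route closes up to a cycle. *)
Definition route c : Prop :=
  [/\ path h b (rcons c d), uniq c & {in c, forall z, z \notin D}].

Definition blocked c : {set T} := D :|: [set z in c].

Lemma notin_blocked c z : (z \notin blocked c) = (z \notin D) && (z \notin c).
Proof. by rewrite in_setU negb_or inE. Qed.

Lemma route_perm c p c' : route c -> uniq p -> {in p, forall z, z \notin blocked c} ->
  perm_eq c' (c ++ p) -> path h b (rcons c' d) -> route c'.
Proof.
move=> [_ uniq_c disjD] uniq_p free_p cc' pth; split=> //.
  rewrite (perm_uniq cc') cat_uniq uniq_c uniq_p andbT.
  by apply/hasPn=> z /free_p; rewrite notin_blocked => /andP[].
move=> z; rewrite (perm_mem cc') mem_cat => /orP[/disjD//|/free_p].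
by rewrite notin_blocked => /andP[].
Qed.

Lemma route_insert c c1 u v c2 w w' p Q : c = c1 ++ u :: v :: c2 -> route c ->
  path_in g (Q :\: blocked c) w w' p -> g u w -> g w' v ->
  route (c1 ++ u :: (w :: p) ++ v :: c2).
Proof.
move=> cE rc [pth last_p uniq_p subQ] uw wv; apply: (route_perm rc uniq_p).
- by move=> z /subQ/setDP[].
- by rewrite cE -catA perm_cat2l /= perm_cons; exact: permEl (perm_catC (w :: p) (v :: c2)).
have [+ _ _] := rc; rewrite cE !rcons_cat /= !cat_path /= rcons_cat cat_path /=.
by case/and3P=> -> -> /andP[_ ->]; rewrite last_p !gh // (sub_path gh pth).
Qed.

Lemma route_rotate c c1 x x1 M y1 c2 w w' p Q :
  c = c1 ++ x :: (x1 :: M) ++ y1 :: c2 -> route c ->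
  path_in g (Q :\: blocked c) w w' p ->
  g x w -> g w' (last x1 M) -> g x1 y1 ->
  route (c1 ++ x :: (w :: p) ++ rev (x1 :: M) ++ y1 :: c2).
Proof.
move=> cE rc [pth last_p uniq_p subQ] xw wy xy1; apply: (route_perm rc uniq_p).
- by move=> z /subQ/setDP[].
- rewrite cE -catA perm_cat2l /= perm_cons.
  apply: perm_trans (permEl (perm_catC (w :: p) _)) _.
  by rewrite -[X in perm_eq _ X]/(((x1 :: M) ++ y1 :: c2) ++ w :: p) !perm_cat2r perm_rev.
have rev_M : path h w' (rev (x1 :: M)).
  have pth_M : path h x1 M.
    have [+ _ _] := rc; rewrite cE rcons_cat /= cat_path /= rcons_cat cat_path.
    by case/and4P=> _ _ _ /andP[].
  have : path h x1 (rcons M w') by rewrite rcons_path pth_M hsym gh.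
  rewrite -rev_path (eq_path (e' := h)); last by move=> ? ? /=; rewrite hsym.
  by rewrite last_rcons belast_rcons.
have [+ _ _] := rc; rewrite cE !rcons_cat /= !cat_path /= !rcons_cat !cat_path /=.
case/and5P=> -> -> _ _ /andP[_ ->]; rewrite last_p rev_M (sub_path gh pth) gh //.
by rewrite rev_cons last_rcons gh.
Qed.

Lemma route_shortcut c i j : route c -> i < j < size c -> h (nth b c i) (nth b c j) ->
  route (take i.+1 c ++ drop j c).
Proof.
move=> [pth uniq_c disjD] /andP[ij jc] hij.
have sub : subseq (take i.+1 c ++ drop j c) c.
  rewrite -[X in subseq _ X](cat_take_drop i.+1); apply: cat_subseq (subseq_refl _) _.
  by rewrite -(subnK ij) -drop_drop drop_subseq.
split; last by move=> z /(mem_subseq sub); exact: disjD.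
  have pth_head : path h b (take i.+1 c).
    by move: pth; rewrite -{1}(cat_take_drop i.+1 c) rcons_cat cat_path => /andP[].
  have pth_tail : path h (nth b c j) (rcons (drop j.+1 c) d).
    move: pth; rewrite -{1}(cat_take_drop j c) (drop_nth b jc) rcons_cat cat_path /=.
    by case/and3P.
  rewrite rcons_cat cat_path pth_head (take_nth b) ?(ltn_trans ij) // last_rcons.
  by rewrite (drop_nth b jc) /= hij.
exact: subseq_uniq sub uniq_c.
Qed.

Lemma shorten_route a c : alpha_le g a -> route c -> 2 * a < size c ->
  exists c', [/\ route c', size c' < size c & size c <= size c' + 2 * a].
Proof.
move=> alphaT rc ac; have [_ uniq_c _] := rc.
have in_c (i : 'I_a.+1) : 2 * i < size c by have := ltn_ord i; lia.
have inj : {in [set: 'I_a.+1] &, injective (fun i : 'I_a.+1 => nth b c (2 * i))}.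
  by move=> i j _ _ /eqP; rewrite nth_uniq // eqn_mul2l => /eqP/val_inj.
have [|i [j [_ _ ij chord]]] := alpha_le_ord gsym girr alphaT inj.
  by rewrite cardsT card_ord.
have ja := ltn_ord j; have jc := in_c j.
exists (take (2 * i).+1 c ++ drop (2 * j) c); split.
- by apply: route_shortcut => //; [rewrite jc andbT; lia | exact: gh].
- by rewrite size_cat size_takel ?size_drop; lia.
- by rewrite size_cat size_takel ?size_drop; lia.
Qed.

Section Pieces.
Variables (a s : nat).

Lemma extend_route_in_piece c Q :
  robust g s Q -> {in Q, forall u, s < #|nbr u :&: Q|} ->
  route c -> has_edge_in Q c -> #|D :|: ([set z in c] :&: Q)| <= s ->
  exists c', [/\ route c', size c < size c', has_edge_in Q c' &
    forall Q', [disjoint Q & Q'] -> has_edge_in Q' c -> has_edge_in Q' c'].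
Proof.
move=> robQ degQ rc /has_edge_inP[c1 [u [v [c2 [cE uQ vQ]]]]] Fs.
set F := D :|: _ in Fs.
have QF : Q :\: F = Q :\: blocked c.
  by apply/setP=> z; rewrite !in_setD !in_setU in_setI; case: (z \in Q); rewrite ?andbT ?andbF.
have free_nbr x : x \in Q -> exists2 w, w \in Q :\: blocked c & g x w.
  move=> xQ; have [w /setIP[xw wQ] wF] := card_lt_exists (leq_ltn_trans Fs (degQ x xQ)).
  by exists w; rewrite -?in_nbr // -QF in_setD wF.
have [w wQ uw] := free_nbr u uQ; have [w' w'Q vw'] := free_nbr v vQ.
have ww' : w' \in component g (Q :\: blocked c) w by rewrite -QF (robQ F) ?QF.
have [p pathQ] := component_path wQ ww'.
exists (c1 ++ u :: (w :: p) ++ v :: c2); split.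
- by apply: (route_insert cE rc pathQ uw); rewrite gsym.
- by rewrite cE !size_cat /= size_cat /=; clear; lia.
- by apply/has_edge_inP; exists c1, u, w, (p ++ v :: c2); split=> //; case/setDP: wQ.
- move=> Q' QQ'; rewrite cE; apply: has_edge_in_insert.
  by rewrite (disjointFr QQ' uQ).
Qed.

Variable P : {set {set T}}.
Hypotheses (tP : trivIset P) (robP : {in P, forall Q, robust g s Q}).
Hypothesis Das : #|D| + a + 2 <= s.+1.

Lemma thicken_route c0 :
  {in P, forall Q : {set T}, {in Q, forall u, s < #|nbr u :&: Q|}} ->
  route c0 -> {in P, forall Q, has_edge_in Q c0} ->
  exists2 c, route c & {in P, forall Q, a + 2 <= #|[set z in c] :&: Q|}.
Proof.
move=> degP rc0 edge0.
pose ok c := route c /\ {in P, forall Q, has_edge_in Q c}.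
have [||c [rc edge_c] cmax] := @exists_maximizer _ ok (@size T) #|T|.
- by move=> c [[_ /card_uniqP <- _] _]; exact: max_card.
- by exists c0.
exists c => // Q QP; rewrite leqNgt; apply/negP => few.
have [|c' [rc' longer edgeQ edge_c']] :=
  extend_route_in_piece (robP QP) (degP Q QP) rc (edge_c Q QP).
  by apply: leq_trans (leq_card_setU _ _) _; clear -few Das; lia.
suff /cmax : ok c' by rewrite leqNgt longer.
split=> // Q' Q'P; have [->//|QQ'] := eqVneq Q' Q.
by apply: edge_c'; rewrite ?edge_c //; apply: (trivIsetP tP); rewrite // eq_sym.
Qed.

Definition attachments c Q v : {set T} :=
  [set x in [set z in c] :&: Q | [exists y in component g (Q :\: blocked c) v, g y x]].

Lemma card_attachments c Q v k : robust g s Q -> v \in Q -> v \notin blocked c ->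
  {in c, forall z, z \notin D} -> #|D| + k <= s.+1 -> k <= #|[set z in c] :&: Q| ->
  k <= #|attachments c Q v|.
Proof.
move=> robQ vQ vDc disjD Dks kc; rewrite leqNgt; apply/negP => few.
set X := attachments c Q v in few; set C := component g (Q :\: blocked c) v.
have [y /setIP[yc yQ] yX] := card_lt_exists (leq_trans few kc).
have Fs : #|D :|: X| <= s by apply: leq_trans (leq_card_setU _ _) _; clear -few Dks; lia.
have vW : v \in Q :\: blocked c by rewrite in_setD vDc.
have vF : v \in Q :\: (D :|: X).
  rewrite in_setD in_setU negb_or vQ andbT; move: vDc; rewrite notin_blocked => /andP[-> vc].
  by rewrite !inE (negPf vc).
have yF : y \in Q :\: (D :|: X).
  by rewrite in_setD in_setU negb_or yX yQ disjD //; rewrite inE in yc.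
have /subsetP/(_ y (robQ _ Fs _ _ vF yF)) : component g (Q :\: (D :|: X)) v \subset C.
  apply: component_least; first exact: component_refl.
  move=> u z uC /setDP[zQ]; rewrite in_setU negb_or => /andP[zD zX] uz.
  apply: (component_step vW uC _ uz); rewrite in_setD zQ notin_blocked zD andbT.
  by apply: contra zX => zc; rewrite !inE zc zQ; apply/exists_inP; exists u.
move/(subsetP (component_sub g vW)); rewrite in_setD notin_blocked.
by rewrite inE in yc; rewrite yc !andbF.
Qed.

Hypothesis alphaT : alpha_le g a.

Lemma exists_successor_edge c (X : {set T}) : uniq c -> X \subset [set z in c] ->
  a + 2 <= #|X| -> exists i j, [/\ i < j, j.+1 < size c, nth b c i \in X,
    nth b c j \in X & g (nth b c i.+1) (nth b c j.+1)].
Proof.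
move=> uniq_c Xc aX; pose J := [set i : 'I_(size c) | nth b c i \in X].
pose I := [set i in J | i.+1 < size c].
have XJ : #|X| <= #|J|.
  apply: leq_trans (leq_imset_card (fun i : 'I_(size c) => nth b c i) J).
  apply/subset_leq_card/subsetP=> x xX; have := subsetP Xc x xX; rewrite inE => xc.
  have xi : index x c < size c by rewrite index_mem.
  by apply/imsetP; exists (Ordinal xi); rewrite ?inE /= nth_index.
have JI : #|J :\: I| <= 1.
  apply/card_le1_eqP => i j; rewrite !inE => /andP[+ iX] /andP[+ jX].
  rewrite iX jX /= -!leqNgt => last_i last_j; apply: val_inj.
  by have := ltn_ord i; have := ltn_ord j; clear -last_i last_j; rewrite /=; lia.
have aI : a < #|I|.
  have := cardsID I J; have := subset_leq_card (subsetIr J I).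
  by clear -aX XJ JI; lia.
have inj : {in I &, injective (fun i : 'I_(size c) => nth b c i.+1)}.
  move=> i j; rewrite !inE => /andP[_ ic] /andP[_ jc] /eqP.
  by rewrite nth_uniq // => /eqP[/val_inj].
have [i [j [iI jI ij chord]]] := alpha_le_ord gsym girr alphaT inj aI.
move: iI jI; rewrite !inE => /andP[iX _] /andP[jX jc].
by exists i, j.
Qed.

(* Chvatal-Erdos: the successors on [c] of the attachment points of a component avoiding [c]
   contain an edge, along which [c] is rerouted through the component. *)
Lemma reroute_through c Q v : route c -> robust g s Q -> v \in Q -> v \notin blocked c ->
  a + 2 <= #|[set z in c] :&: Q| ->
  exists c', [/\ route c', size c < size c' & {subset c <= c'}].
Proof.
move=> rc robQ vQ vDc aQ; have [_ uniq_c disjD] := rc.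
have vW : v \in Q :\: blocked c by rewrite in_setD vDc.
have Xc : attachments c Q v \subset [set z in c].
  by apply/subsetP=> x /setIdP[/setIP[]].
have aX : a + 2 <= #|attachments c Q v|.
  by apply: card_attachments => //; clear -Das; lia.
have [i [j [ij jc]]] := exists_successor_edge uniq_c Xc aX.
move=> /setIdP[_ /exists_inP[w wC wx]] /setIdP[_ /exists_inP[w' w'C w'y]] chord.
have [c1 [M [c2 [cE lastM]]]] := split_at_successors b ij jc.
have wW := subsetP (component_sub g vW) w wC.
have ww' : w' \in component g (Q :\: blocked c) w.
  by apply: component_trans w'C; rewrite component_sym.
have [p pathQ] := component_path wW ww'.
exists (c1 ++ nth b c i :: (w :: p) ++ rev (nth b c i.+1 :: M) ++ nth b c j.+1 :: c2).
split.
- by apply: (route_rotate cE rc pathQ _ _ chord); rewrite ?lastM // gsym.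
- by rewrite [in X in X < _]cE !size_cat /= !size_cat size_rev /=; clear; lia.
- move=> z; rewrite [X in z \in X -> _]cE !(mem_cat, mem_rev, inE).
  by case/orP=> [->|/orP[->|/orP[/orP[->|->]|/orP[->|->]]]]; rewrite ?orbT.
Qed.

Lemma spanning_route c0 : cover P = [set: T] -> route c0 ->
  {in P, forall Q, a + 2 <= #|[set z in c0] :&: Q|} ->
  exists2 c, route c & forall z, z \notin D -> z \in c.
Proof.
move=> covP rc0 a0.
pose ok c := route c /\ {in P, forall Q, a + 2 <= #|[set z in c] :&: Q|}.
have [||c [rc ac] cmax] := @exists_maximizer _ ok (@size T) #|T|.
- by move=> c [[_ /card_uniqP <- _] _]; exact: max_card.
- by exists c0.
exists c => // v vD; apply: contraT => vc.
have /bigcupP[Q QP vQ] : v \in cover P by rewrite covP inE.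
have vDc : v \notin blocked c by rewrite notin_blocked vD.
have [c' [rc' longer sub]] := reroute_through rc (robP QP) vQ vDc (ac Q QP).
suff /cmax : ok c' by rewrite leqNgt longer.
split=> // Q' Q'P; apply: leq_trans (ac Q' Q'P) _; apply/subset_leq_card/setSI.
by apply/subsetP=> z; rewrite !inE; exact: sub.
Qed.

End Pieces.

End Routes.

(** * Euler tours along a matching *)

Section Tours.
Variables (T I : finType) (mu : T -> T) (phi : T -> I).
Hypothesis muK : involutive mu.
Implicit Types (u v z : T) (k m root : I) (s L : seq T) (A B J : {set T}) (W Hs : {set I}).

Definition mu_closed A : Prop := {in A, forall z, mu z \in A}.

Definition mu_free A : Prop := {in A, forall z, mu z != z}.

Definition fiber A k : {set T} := [set z in A | phi z == k].

Definition crossing A Hs : Prop :=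
  forall W, W \subset Hs -> W != set0 -> W != Hs ->
  exists u, [/\ u \in A, mu u \in A, phi u \in Hs :\: W & phi (mu u) \in W].

Lemma crossing_sub A B Hs : A \subset B -> crossing A Hs -> crossing B Hs.
Proof.
move=> AB crA W WH W0 WHs; have [u [uA muA uW muW]] := crA W WH W0 WHs.
by exists u; rewrite !(subsetP AB).
Qed.

Lemma mu_free_sub A B : A \subset B -> mu_free B -> mu_free A.
Proof. by move=> AB freeB z /(subsetP AB); exact: freeB. Qed.

Lemma fiber_eq0 A k : {in A, forall z, phi z != k} -> fiber A k = set0.
Proof.
move=> avoidk; apply/setP=> z; rewrite !inE.
by have [/avoidk/negPf//|//] := boolP (z \in A).
Qed.

Lemma odd_card_mu_closed A : mu_closed A -> mu_free A -> odd #|A| = false.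
Proof.
have [n] := ubnP #|A|; elim: n A => // n IHn A An closedA freeA.
have [->|[z zA]] := set_0Vmem A; first by rewrite cards0.
have mzA : mu z \in A :\ z by rewrite !inE freeA // closedA.
have cardA : #|A| = #|A :\ z :\ mu z|.+2 by rewrite (cardsD1 z) zA (cardsD1 (mu z)) mzA.
rewrite cardA /= negbK; apply: IHn.
- by move: An; rewrite cardA; clear; lia.
- move=> x; rewrite !inE => /and3P[xmz xz xA]; rewrite closedA // andbT.
  by rewrite (can_eq muK) xz (inv_eq muK) xmz.
- by move=> x; rewrite !inE => /and3P[_ _]; exact: freeA.
Qed.

Lemma odd_count (t : pred I) (l : seq I) (n : I -> nat) :
  (forall k, t k = odd (n k)) -> odd (count t l) = odd (\sum_(k <- l) n k).
Proof.
move=> tn; elim: l => [|k l IHl]; first by rewrite big_nil.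
by rewrite big_cons /= !oddD oddb tn IHl.
Qed.

Lemma handshake A (l : seq I) : uniq l -> mu_closed A -> mu_free A ->
  {in A, forall z, phi z \in l} -> odd (count (fun k => odd #|fiber A k|) l) = false.
Proof.
move=> uniq_l closedA freeA phiA; rewrite (@odd_count _ _ (fun k => #|fiber A k|)) //.
rewrite -(odd_card_mu_closed closedA freeA); congr odd.
rewrite (big_uniq _ uniq_l) /= -[RHS]sum1_card (partition_big phi (mem l)) //=.
by apply: eq_bigr => k _; rewrite -sum1dep_card.
Qed.

Section SpanningTrees.

(* The most recently attached port comes first; each one attaches a new hub to an older one. *)
Fixpoint tree root L : bool :=
  if L is u :: L' then
    [&& phi u \notin root :: map phi L', phi (mu u) \in root :: map phi L' & tree root L']
  else true.

Definition ports L : {set T} := [set z | (z \in L) || (mu z \in L)].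

Lemma ports_cons u L : ports (u :: L) = u |: (mu u |: ports L).
Proof.
by apply/setP=> z; rewrite !inE (inv_eq muK z); do 2!case: (z == _); rewrite ?orbT.
Qed.

Lemma ports_closed L : mu_closed (ports L).
Proof. by move=> z; rewrite !inE muK orbC. Qed.

Lemma card_ports L : #|ports L| <= 2 * size L.
Proof.
elim: L => [|u L IHL]; first by rewrite leqn0 cards_eq0; apply/eqP/setP => z; rewrite !inE.
by rewrite ports_cons !cardsU1 /=; move: IHL; do 2!case: (_ \notin _); clear; lia.
Qed.

Lemma tree_uniq root L : tree root L -> uniq (root :: map phi L).
Proof.
elim: L => //= u L IHL /and3P[uL _ /IHL /andP[rL ->]].
by move: uL; rewrite !inE !negb_or eq_sym => /andP[-> ->]; rewrite rL.
Qed.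

Lemma tree_ports root L : tree root L -> {in ports L, forall z, phi z \in root :: map phi L}.
Proof.
elim: L => [|u L IHL] /=; first by move=> _ z; rewrite inE.
case/and3P=> _ muL treeL z; rewrite ports_cons !in_setU1 -cat1s => /or3P[/eqP->|/eqP->|zL].
- by rewrite !inE eqxx orbT.
- by move: muL; rewrite !inE => /orP[->|->]; rewrite ?orbT.
- by move: (IHL treeL z zL); rewrite !inE => /orP[->|->]; rewrite ?orbT.
Qed.

Lemma exists_spanning_tree A Hs root : root \in Hs -> crossing A Hs ->
  exists L, [/\ tree root L, ports L \subset A, [set k in root :: map phi L] = Hs &
    size L < #|Hs|].
Proof.
move=> rootH crA.
pose nodes L : {set I} := [set k in root :: map phi L].
pose ok L := [/\ tree root L, ports L \subset A & nodes L \subset Hs].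
have card_nodes L : tree root L -> #|nodes L| = (size L).+1.
  by move=> /tree_uniq/card_uniqP; rewrite cardsE => ->; rewrite /= size_map.
have [||L [treeL LA LH] Lmax] := @exists_maximizer _ ok (@size T) #|Hs|.
- by move=> L [treeL _ /subset_leq_card]; rewrite card_nodes //; exact: ltnW.
- exists [::]; split=> //; apply/subsetP=> z; rewrite !inE //.
  by move/eqP->.
have [nodesE|nodesH] := eqVneq (nodes L) Hs; first by exists L; rewrite -nodesE card_nodes.
have nodes0 : nodes L != set0 by apply/set0Pn; exists root; rewrite inE mem_head.
have [u [uA muA /setDP[uH uL] muL]] := crA _ LH nodes0 nodesH.
suff /Lmax : ok (u :: L) by rewrite ltnn.
rewrite /nodes !inE in uL muL; split; first by rewrite /= !inE uL muL.
  by rewrite ports_cons !subUset !sub1set uA muA.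
apply/subsetP=> k; rewrite !inE => /or3P[/eqP->|/eqP->|kL] //.
by rewrite (subsetP LH) // !inE kL orbT.
Qed.

Lemma tree_constant (f : I -> bool) root L : tree root L ->
  {in ports L, forall z, f (phi z) = f (phi (mu z))} ->
  {in root :: map phi L, forall k, f k = f root}.
Proof.
elim: L => [|u L IHL] /=; first by move=> _ _ k; rewrite inE => /eqP->.
case/and3P=> _ muL treeL constL.
have {}IHL : {in root :: map phi L, forall k, f k = f root}.
  by apply: IHL => // z zL; apply: constL; rewrite ports_cons !in_setU1 zL !orbT.
move=> k; rewrite inE => /predU1P[->//|]; rewrite inE => /predU1P[->|kL].
  by rewrite constL ?IHL // ports_cons setU11.
by rewrite IHL // inE kL orbT.
Qed.

Lemma tree_crossing root L : tree root L -> crossing (ports L) [set k in root :: map phi L].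
Proof.
move=> treeL W WH W0 WnH; set Hs := [set _ in _] in WH WnH *.
have [/exists_inP[u uL /andP[uW muW]]|] :=
    boolP [exists u in ports L, (phi u \notin W) && (phi (mu u) \in W)].
  exists u; split=> //; first exact: ports_closed.
  by rewrite in_setD uW inE tree_ports.
rewrite negb_exists_in => /forall_inP noncrossing.
have constW : {in ports L, forall z, (phi z \in W) = (phi (mu z) \in W)}.
  move=> z zL; have := noncrossing _ (ports_closed zL); have := noncrossing z zL.
  by rewrite muK; case: (phi z \in W); case: (phi (mu z) \in W).
have sameW := tree_constant (f := mem W) treeL constW.
case/set0Pn: W0 => k kW; case/negP: WnH; rewrite eqEsubset WH; apply/subsetP=> k'.
have := subsetP WH k kW; rewrite !inE -!topredE /= => kH k'H.
by have := sameW k' k'H; rewrite -(sameW k kH) /= kW.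
Qed.

Lemma card_fiber_add_pair J u k : u \notin J -> mu u \notin J -> mu u != u ->
  #|fiber (u |: (mu u |: J)) k| = (phi u == k) + (phi (mu u) == k) + #|fiber J k|.
Proof.
have card_fiberU1 x A : x \notin A -> #|fiber (x |: A) k| = (phi x == k) + #|fiber A k|.
  move=> xA; have [xk|xk] := eqVneq (phi x) k.
    have -> : fiber (x |: A) k = x |: fiber A k.
      by apply/setP=> z; rewrite !inE andb_orl; case: eqP => // ->; rewrite xk eqxx.
    by rewrite cardsU1 inE (negPf xA).
  congr #|pred_of_set _|; apply/setP=> z; rewrite !inE andb_orl.
  by case: eqP => // ->; rewrite (negPf xk) andbF.
move=> uJ muJ mu_u; rewrite !card_fiberU1 ?addnA // !inE negb_or uJ andbT.
by rewrite eq_sym.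
Qed.

Lemma odd_count_addb (t t' : pred I) (l : seq I) :
  odd (count (fun k => t k (+) t' k) l) = odd (count t l) (+) odd (count t' l).
Proof. by elim: l => //= k l IHl; rewrite !oddD !oddb IHl addbACA. Qed.

(* Working from the leaves, an edge of the tree is used when its upper end has the wrong parity;
   this toggles the parity required at the other end. *)
Lemma parity_join root L (t : I -> bool) : mu_free (ports L) -> tree root L ->
  odd (count t (root :: map phi L)) = false ->
  exists J, [/\ mu_closed J, J \subset ports L &
    {in root :: map phi L, forall k, odd #|fiber J k| = t k}].
Proof.
elim: L t => [|u L IHL] t freeL treeL even_t.
  exists set0; split=> [z||k]; rewrite ?inE ?sub0set //= => /eqP->.
  rewrite fiber_eq0 ?cards0 => [|z]; last by rewrite inE.
  by move: even_t; rewrite /= addn0 oddb.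
have /= /and3P[uL muL treeL'] := treeL.
have subL : ports L \subset ports (u :: L) by rewrite ports_cons !subsetU ?subxx ?orbT.
pose t' k := t k (+) (t (phi u) && (k == phi (mu u))).
have [|J [closedJ JL oddJ]] := IHL t' (mu_free_sub subL freeL) treeL'.
  rewrite odd_count_addb; have -> : odd (count (fun k => t (phi u) && (k == phi (mu u)))
      (root :: map phi L)) = t (phi u).
    case: (t (phi u)) => /=; last by rewrite count_pred0.
    by rewrite -/(count_mem _ (root :: _)) count_uniq_mem ?tree_uniq // muL.
  by move: even_t; rewrite /= !oddD !oddb addbCA addbC => ->.
have fiberJ k : k \notin root :: map phi L -> fiber J k = set0.
  move=> kL; apply: fiber_eq0 => z /(subsetP JL) /(tree_ports treeL').
  by apply: contraTneq => ->.
have uJ : u \notin J.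
  by apply/negP => uJ; have := fiberJ _ uL; move/setP/(_ u); rewrite !inE uJ eqxx.
have muJ : mu u \notin J by apply: contra uJ => /closedJ; rewrite muK.
have u_port : u \in ports (u :: L) by rewrite ports_cons setU11.
have [J' [closedJ' J'L oddJ']] : exists J', [/\ mu_closed J', J' \subset ports (u :: L) &
    forall k, odd #|fiber J' k| =
      (t (phi u) && ((phi u == k) (+) (phi (mu u) == k))) (+) odd #|fiber J k|].
  case: (t (phi u)) => /=; last by exists J; split=> //; exact: subset_trans subL.
  exists (u |: (mu u |: J)); split=> [z||k].
  - by rewrite !inE => /or3P[/eqP->|/eqP->|/closedJ->]; rewrite ?muK ?eqxx ?orbT.
  - by rewrite ports_cons !setUS.
  - by rewrite card_fiber_add_pair ?freeL // !oddD !oddb.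
exists J'; split=> // k; rewrite oddJ' !inE => k_node.
have [->|ku] := eqVneq k (phi u).
  have mu_u : phi (mu u) != phi u by apply: contraNneq uL => <-.
  by rewrite fiberJ // cards0 (negPf mu_u) andbT addbF.
have kL : k \in root :: map phi L by move: k_node; rewrite (negPf ku) inE.
by rewrite oddJ // /t' (eq_sym k) addbCA addbb addbF.
Qed.

End SpanningTrees.

Section EulerTours.

Fixpoint walk k s : bool :=
  if s is u :: s' then (phi u == k) && walk (phi (mu u)) s' else true.

Definition walk_end k s : I := last k (map (phi \o mu) s).

Lemma walk_cat k s1 s2 : walk k (s1 ++ s2) = walk k s1 && walk (walk_end k s1) s2.
Proof. by elim: s1 k => //= u s1 IHs k; rewrite IHs andbA. Qed.

Lemma walk_end_cat k s1 s2 : walk_end k (s1 ++ s2) = walk_end (walk_end k s1) s2.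
Proof. by rewrite /walk_end map_cat last_cat. Qed.

Lemma walk_count m k s : walk k s ->
  count (fun z => phi z == m) s + (walk_end k s == m) =
  (k == m) + count (fun z => phi z == m) (map mu s).
Proof.
elim: s k => [|u s IHs] k /=; first by rewrite addn0.
by case/andP=> /eqP-> /IHs; rewrite /walk_end /=; clear; lia.
Qed.

Lemma closed_walk_rot k s m : walk k s -> walk_end k s = k -> m \in k :: map phi s ->
  exists s', [/\ perm_eq s' s, walk m s' & walk_end m s' = m].
Proof.
move=> walk_s closed_s; rewrite inE => /predU1P[->|/mapP[u us ->]]; first by exists s.
case/splitPr: us walk_s closed_s => s1 s2; rewrite walk_cat walk_end_cat /=.
case/and3P=> walk1 /eqP u_end walk2 closed_s.
have end2 : walk_end (phi (mu u)) s2 = k by exact: closed_s.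
exists (u :: s2 ++ s1); split.
- by rewrite -cat_cons perm_catC.
- by rewrite /= eqxx walk_cat walk2 end2.
- by rewrite -cat_cons walk_end_cat [walk_end _ (u :: s2)]end2.
Qed.

Definition trail A k s : Prop := [/\ walk k s, uniq (s ++ map mu s) & {subset s <= A}].

Lemma mem_mu_cat s z : (mu z \in s ++ map mu s) = (z \in s ++ map mu s).
Proof.
have mem_mu y : (mu y \in map mu s) = (y \in s) by apply: mem_map; exact: inv_inj.
by rewrite !mem_cat mem_mu orbC -(mem_mu (mu z)) muK.
Qed.

Lemma perm_mu_cat_cons u s :
  perm_eq ((u :: s) ++ map mu (u :: s)) ([:: u; mu u] ++ s ++ map mu s).
Proof. by rewrite /= perm_cons; exact: permEl (perm_catCA s [:: mu u] (map mu s)). Qed.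

Lemma trail_rcons A k s z : trail A k s -> z \in A -> mu z != z ->
  z \notin s ++ map mu s -> phi z = walk_end k s -> trail A k (rcons s z).
Proof.
move=> [walk_s uniq_s sA] zA muz zs z_end; split.
- by rewrite -cats1 walk_cat walk_s /= z_end eqxx.
- have perm_z : perm_eq (rcons s z) (z :: s) by rewrite perm_rcons.
  rewrite (perm_uniq (perm_cat perm_z (perm_map mu perm_z))) (perm_uniq (perm_mu_cat_cons z s)).
  by rewrite /= inE negb_or eq_sym muz zs mem_mu_cat zs.
- by move=> y; rewrite mem_rcons inE => /predU1P[->//|/sA].
Qed.

(* A trail that does not close up leaves its last hub by an odd number of ports. *)
Lemma longest_trail_closed A k s : mu_closed A -> mu_free A ->
  (forall m, odd #|fiber A m| = false) -> trail A k s ->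
  (forall s', trail A k s' -> size s' <= size s) -> walk_end k s = k.
Proof.
move=> closedA freeA evenA trail_s s_max; have [walk_s uniq_s sA] := trail_s.
apply/eqP; apply: contraT => open_s; set m := walk_end k s in open_s *.
have odd_visits : odd (count (fun z => phi z == m) (s ++ map mu s)).
  have := walk_count m walk_s; rewrite count_cat -/m eqxx eq_sym (negPf open_s).
  by clear; lia.
have [z /setIdP[zA /eqP zm] zs] : exists2 z, z \in fiber A m & z \notin s ++ map mu s.
  apply/exists_inP; apply: contraT; rewrite negb_exists_in => /forall_inP visited.
  suff cardE : #|fiber A m| = count (fun z => phi z == m) (s ++ map mu s).
    by rewrite -cardE evenA in odd_visits.
  rewrite -size_filter -(card_uniqP (filter_uniq _ uniq_s)); apply: eq_card => z.
  rewrite mem_filter !inE andbC; have [zm|//] := eqVneq (phi z) m.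
  rewrite /=; apply/idP/idP => [zA|].
    by rewrite -[_ \in _]negbK visited // inE zA zm eqxx.
  by rewrite mem_cat => /orP[/sA|/mapP[y /sA /closedA yA ->]].
have := s_max _ (trail_rcons trail_s zA (freeA z zA) zs zm).
by rewrite size_rcons ltnn.
Qed.

Lemma closed_walk_node k s z : walk k s -> walk_end k s = k -> z \in s ++ map mu s ->
  phi z \in k :: map phi s.
Proof.
move=> walk_s closed_s; rewrite mem_cat => /orP[zs|/mapP[u us ->]].
  by rewrite inE map_f ?orbT.
case/splitPr: us walk_s closed_s => s1 s2; rewrite walk_cat walk_end_cat /=.
case/and3P=> _ _; case: s2 => [|v s2] /=; first by rewrite /walk_end /= => _ ->; rewrite mem_head.
by case/andP=> /eqP <- _ _; rewrite inE map_cat mem_cat !inE eqxx !orbT.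
Qed.

Lemma longest_trail_spanning A Hs k s : mu_free A -> crossing A Hs ->
  {in A, forall z, phi z \in Hs} -> k \in Hs -> trail A k s -> walk_end k s = k ->
  (forall k' s', k' \in Hs -> trail A k' s' -> size s' <= size s) ->
  {subset Hs <= k :: map phi s}.
Proof.
move=> freeA crA phiA kH [walk_s uniq_s sA] closed_s s_max.
set W := [set m in k :: map phi s].
have WH : W \subset Hs.
  apply/subsetP=> m; rewrite inE => /predU1P[->//|/mapP[z /sA zA ->]]; exact: phiA.
suff <- : W = Hs by move=> m; rewrite inE.
apply/eqP; apply: contraT => WnH.
have W0 : W != set0 by apply/set0Pn; exists k; rewrite inE mem_head.
have [u [uA muA /setDP[_ uW] muW]] := crA W WH W0 WnH; rewrite !inE -in_cons in uW muW.
have us : u \notin s ++ map mu s by apply: contra uW; exact: closed_walk_node.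
have [s' [s's walk_s' closed_s']] := closed_walk_rot walk_s closed_s muW.
have trail_s' : trail A (phi (mu u)) s'.
  split=> //; last by move=> z; rewrite (perm_mem s's); exact: sA.
  by rewrite (perm_uniq (perm_cat s's (perm_map mu s's))).
have mus : mu u \notin s' ++ map mu s'.
  by rewrite (perm_mem (perm_cat s's (perm_map mu s's))) mem_mu_cat.
have := s_max _ _ (phiA _ muA) (trail_rcons trail_s' muA _ mus (esym closed_s')).
by rewrite size_rcons (perm_size s's) muK eq_sym freeA // ltnn => /(_ isT).
Qed.

Lemma euler_tour A Hs root : root \in Hs -> mu_closed A -> mu_free A ->
  (forall k, odd #|fiber A k| = false) -> {in A, forall z, phi z \in Hs} -> crossing A Hs ->
  exists s, [/\ trail A root s, walk_end root s = root & {subset Hs <= root :: map phi s}].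
Proof.
move=> rootH closedA freeA evenA phiA crA.
pose ok (ks : I * seq T) := ks.1 \in Hs /\ trail A ks.1 ks.2.
have [||[k s] [/= kH trail_s] s_max] := @exists_maximizer _ ok (fun ks => size ks.2) #|T|.
- move=> [k s] [_ [_ + _]]; rewrite cat_uniq => /and3P[/card_uniqP <- _ _].
  exact: max_card.
- by exists (root, [::]).
have {}s_max k' s' : k' \in Hs -> trail A k' s' -> size s' <= size s.
  by move=> k'H trail_s'; apply: (s_max (k', s')).
have closed_s := longest_trail_closed closedA freeA evenA trail_s (fun s' => s_max k s' kH).
have spanning := longest_trail_spanning freeA crA phiA kH trail_s closed_s s_max.
have [walk_s uniq_s sA] := trail_s.
have [s' [s's walk_s' closed_s']] := closed_walk_rot walk_s closed_s (spanning root rootH).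
have trail_s' : trail A root s'.
  split=> //; last by move=> z; rewrite (perm_mem s's); exact: sA.
  by rewrite (perm_uniq (perm_cat s's (perm_map mu s's))).
exists s'; split=> //.
apply: (longest_trail_spanning freeA crA phiA rootH trail_s' closed_s').
by move=> k' t k'H /(s_max k' t k'H); rewrite (perm_size s's).
Qed.

End EulerTours.

Lemma fiberU A B k : fiber (A :|: B) k = fiber A k :|: fiber B k.
Proof. by apply/setP=> z; rewrite !inE andb_orl. Qed.

(* The second tree serves to correct the parities of the first one. *)
Lemma exists_even_crossing A1 A2 Hs root : root \in Hs -> [disjoint A1 & A2] ->
  mu_free (A1 :|: A2) -> {in A1 :|: A2, forall z, phi z \in Hs} ->
  crossing A1 Hs -> crossing A2 Hs ->
  exists A, [/\ A \subset A1 :|: A2, mu_closed A, forall k, odd #|fiber A k| = false,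
    crossing A Hs & #|A| <= 4 * #|Hs|].
Proof.
move=> rootH disjA freeA phiA crA1 crA2.
have [L1 [tree1 L1A nodes1 size1]] := exists_spanning_tree rootH crA1.
have [L2 [tree2 L2A nodes2 size2]] := exists_spanning_tree rootH crA2.
have free1 : mu_free (ports L1) := mu_free_sub (subset_trans L1A (subsetUl _ _)) freeA.
have free2 : mu_free (ports L2) := mu_free_sub (subset_trans L2A (subsetUr _ _)) freeA.
have in_nodes2 k : k \in Hs -> k \in root :: map phi L2 by rewrite -nodes2 inE.
pose odd1 k := odd #|fiber (ports L1) k|.
have [|J [closedJ JL oddJ]] := @parity_join root L2 odd1 free2 tree2.
  apply: handshake (tree_uniq tree2) _ free1 _; first exact: ports_closed.
  by move=> z /(tree_ports tree1) zL1; rewrite in_nodes2 // -nodes1 inE.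
have disjJ : [disjoint ports L1 & J].
  exact: disjointWl L1A (disjointWr (subset_trans JL L2A) disjA).
have subA : ports L1 :|: J \subset A1 :|: A2 := setUSS L1A (subset_trans JL L2A).
exists (ports L1 :|: J); split=> //.
- by move=> z; rewrite !in_setU => /orP[/ports_closed->//|/closedJ->]; rewrite orbT.
- move=> k; have [kH|kH] := boolP (k \in Hs); last first.
    rewrite fiber_eq0 ?cards0 // => z /(subsetP subA) /phiA.
    by apply: contraTneq => ->.
  rewrite fiberU cardsU disjoint_setI0; last first.
    by apply: disjointWl (disjointWr _ disjJ); apply/subsetP=> z /setIdP[].
  by rewrite cards0 subn0 oddD oddJ ?in_nodes2 // /odd1 addbb.
- by apply: crossing_sub (subsetUl _ _) _; rewrite -nodes1; exact: tree_crossing.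
- apply: leq_trans (leq_card_setU _ _) _; have := subset_leq_card JL.
  by have := card_ports L1; have := card_ports L2; move: size1 size2; clear; lia.
Qed.

Lemma exists_spanning_tour A1 A2 Hs root : root \in Hs -> [disjoint A1 & A2] ->
  mu_free (A1 :|: A2) -> {in A1 :|: A2, forall z, phi z \in Hs} ->
  crossing A1 Hs -> crossing A2 Hs ->
  exists s, [/\ trail (A1 :|: A2) root s, walk_end root s = root,
    {subset Hs <= root :: map phi s} & size s <= 2 * #|Hs|].
Proof.
move=> rootH disjA freeA phiA crA1 crA2.
have [A [subA closedA evenA crA cardA]] :=
  exists_even_crossing rootH disjA freeA phiA crA1 crA2.
have phiA' : {in A, forall z, phi z \in Hs} by move=> z /(subsetP subA) /phiA.
have [s [[walk_s uniq_s sA] closed_s spanning]] :=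
  euler_tour rootH closedA (mu_free_sub subA freeA) evenA phiA' crA.
exists s; split=> //; first by split=> // z /sA /(subsetP subA).
have /card_uniqP := uniq_s; rewrite size_cat size_map => card_s.
suff : #|s ++ map mu s| <= #|A| by move: cardA; rewrite card_s; clear; lia.
apply/subset_leq_card/subsetP=> z; rewrite mem_cat => /orP[/sA//|/mapP[y /sA /closedA yA ->]].
exact: yA.
Qed.

End Tours.

(** * Pancyclicity from crossing edges *)

Section Matchings.
Variables (T : finType) (g r : rel T).
Hypotheses (gsym : symmetric g) (rsym : symmetric r).
Hypothesis rmatch : forall x y z, r x y -> r x z -> y = z.
Implicit Types (x y z : T) (Y : {set T}).

Definition partner x : T := odflt x [pick y | r x y].

Definition union_rel : rel T := [rel x y | g x y || r x y].

Lemma partnerE x y : r x y -> partner x = y.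
Proof.
rewrite /partner => xy; case: pickP => [z xz|]; first exact: rmatch xz xy.
by move/(_ y); rewrite xy.
Qed.

Lemma partner_rel x : partner x != x -> r x (partner x).
Proof. by rewrite /partner; case: pickP => //= _; rewrite eqxx. Qed.

Lemma partnerK : involutive partner.
Proof.
move=> x; have [xE|/partner_rel xy] := eqVneq (partner x) x; first by rewrite !xE.
by apply: partnerE; rewrite rsym.
Qed.

Lemma union_rel_sym : symmetric union_rel.
Proof. by move=> x y; rewrite /union_rel /= gsym rsym. Qed.

Lemma sub_union_rel : subrel g union_rel.
Proof. by move=> x y xy; rewrite /union_rel /= xy. Qed.

Definition ports_in Y : {set T} := [set z in Y | (partner z \in Y) && (partner z != z)].

Lemma ports_in_sub Y : ports_in Y \subset Y.
Proof. by apply/subsetP=> z; rewrite inE => /andP[]. Qed.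

Lemma ports_in_closed Y : mu_closed partner (ports_in Y).
Proof. by move=> z; rewrite !inE partnerK eq_sym => /and3P[-> -> ->]. Qed.

Lemma ports_in_free Y : mu_free partner (ports_in Y).
Proof. by move=> z; rewrite inE => /and3P[]. Qed.

End Matchings.

Lemma sub_cycle_of_length (T : finType) (g h : rel T) l :
  subrel g h -> cycle_of_length g l -> cycle_of_length h l.
Proof. by move=> gh [c [cyc_c uniq_c sz_c]]; exists c; split=> //; exact: sub_cycle cyc_c. Qed.

Section HubSystems.
Variables (T : finType) (g : rel T).
Hypotheses (gsym : symmetric g) (girr : irreflexive g).
Implicit Types (Z Q W : {set T}) (P H : {set {set T}}) (e s : nat).

Record hub_system e s P H : Prop := HubSystem {
  hub_system_pieces : robust_family g e s P;
  hub_system_cover : cover P = [set: T];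
  hub_system_hubs : hub_family g e s P H;
  hub_system_large : #|T| <= 2 * #|cover H| }.

Lemma exists_hub_system e s :
  0 < e -> 32 * s.+1 * #|T| <= e * e -> (forall u, 4 * e <= #|nbr g u|) ->
  exists P H, hub_system e s P H.
Proof.
move=> e0 sT degT.
have sT' : s * #|T| <= e * e.
  by apply: leq_trans sT; rewrite leq_mul2r; apply/orP; right; clear; lia.
have [P famP covP] := robust_partition gsym e0 sT' degT.
have [tP robP] := famP.
have [|Q /robP[]//|H famH largeH] := exists_hub_family gsym girr e0 sT _ tP.
  by move=> u; apply: leq_trans (degT u); rewrite leq_pmull.
by exists P, H.
Qed.

Lemma exists_regions e s P H : 0 < e -> trivIset P -> hub_family g e s P H ->
  exists reg : {set T} -> {set T}, {in H, forall Z, hub g s (reg Z) Z} /\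
    {in P, forall Q, exists2 Z, Z \in H & reg Z = Q}.
Proof.
move=> e0 tP [_ hubH hubP].
have /choice[reg regP] Z : exists W, Z \in H ->
    hub g s W Z /\ {in P, forall Q, hub g s Q Z -> W = Q}.
  have [ZH|_] := boolP (Z \in H); last by exists set0.
  have [[Q [QP hubQ]]|noQ] := EM (exists Q, Q \in P /\ hub g s Q Z); last first.
    exists setT => _; split=> [|Q QP hubQ]; first by have [] := hubH Z ZH.
    by case: noQ; exists Q.
  exists Q => _; split=> // Q' Q'P hubQ'; apply/eqP; apply: contraT => QQ'.
  have /card_gt0P[z zZ] : 0 < #|Z| by have [_] := hubH Z ZH; move: e0; clear; lia.
  have := trivIsetP tP Q Q' QP Q'P QQ' => /disjointFr /(_ (subsetP (proj1 hubQ) z zZ)).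
  by rewrite (subsetP (proj1 hubQ') z zZ).
exists reg; split=> [Z /regP[]//|Q QP].
have [Z ZH hubQ] := hubP Q QP; exists Z => //.
by have [_] := regP Z ZH; exact.
Qed.

End HubSystems.

Section LinkingHubs.
Variables (T : finType) (g r : rel T) (H : {set {set T}}) (reg : {set T} -> {set T}) (s : nat).
Hypotheses (tH : trivIset H) (hub_reg : {in H, forall Z, hub g s (reg Z) Z}).
Implicit Types (x z u v : T) (F : {set T}) (ss c : seq T).
Local Notation phi := (pblock H).
Local Notation mu := (partner r).
Local Notation visited ss := (ss ++ map mu ss).

Lemma hub_link F z u : #|F| <= s -> z \in cover H -> u \in cover H -> phi u = phi z ->
  exists w m w', [/\ uniq [:: w; m; w'], {in [:: w; m; w'], forall v, v \notin F},
    path g z [:: w; m; w'; u] & has_edge_in (reg (phi z)) [:: w; m]].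
Proof.
move=> Fs zH uH uz; have [||w [m [w' [uniq_link sub_link path_link]]]] :=
    proj2 (hub_reg (pblock_mem zH)) F Fs z u.
- by rewrite mem_pblock.
- by rewrite -uz mem_pblock.
exists w, m, w'; split=> // [v /sub_link/setDP[]//|].
rewrite /has_edge_in /= andbT negbK.
by have /setDP[-> _] := sub_link w (mem_head _ _); have /setDP[-> _] : m \in reg (phi z) :\: F
  by apply: sub_link; rewrite !inE eqxx orbT.
Qed.

Lemma mem_visited_cons u ss v :
  (v \in visited (u :: ss)) = (v \in [:: u; mu u]) || (v \in visited ss).
Proof. by rewrite (perm_mem (perm_mu_cat_cons mu u ss)) mem_cat. Qed.

(* [c] follows the walk [ss] from [z] to [x]; a link completes its passage through every hub. *)
Definition linked_walk F z ss x c : Prop :=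
  [/\ path (union_rel g r) z (rcons c x), uniq c, {in c, forall v, v \in F -> v \in visited ss},
    {in ss, forall u, has_edge_in (reg (phi u)) c} & has_edge_in (reg (phi x)) c].

Lemma linked_walk_cons F z u ss x c w m w' : let L := [:: w; m; w'] in
  uniq L -> {in L, forall v, v \notin F} -> path g z (rcons L u) ->
  has_edge_in (reg (phi u)) [:: w; m] ->
  uniq (visited (u :: ss)) -> {subset visited (u :: ss) <= F} -> mu u != u ->
  linked_walk (F :|: [set v in L]) (mu u) ss x c ->
  linked_walk F z (u :: ss) x (L ++ [:: u; mu u] ++ c).
Proof.
move=> L uniq_L avoidL path_L edge_L + ssF mu_u [path_c uniq_c cF edge_c edge_cx].
rewrite (perm_uniq (perm_mu_cat_cons mu u ss)) cat_uniq => /and3P[uniq_u /hasPn fresh _].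
have uF v : v \in [:: u; mu u] -> v \in F.
  by move=> v_u; apply: ssF; rewrite mem_visited_cons v_u.
have cssF v : v \in c -> v \in F :|: [set v in L] -> v \in F.
  by move=> vc /(cF v vc) v_ss; apply: ssF; rewrite mem_visited_cons v_ss orbT.
split.
- have /= := sub_path (@sub_union_rel _ g r) path_L; rewrite andbT => /and4P[-> -> -> ->].
  by rewrite path_c andbT; apply/orP; right; exact: partner_rel.
- rewrite cat_uniq uniq_L cat_uniq uniq_u uniq_c !andbT !andTb; apply/andP; split.
    apply/hasPn=> v v_uc; apply/negP=> vL; have /negP := avoidL v vL; apply.
    move: v_uc; rewrite mem_cat => /orP[/uF//|/cssF]; apply.
    by rewrite in_setU [v \in [set _ in _]]inE vL orbT.
  apply/hasPn=> v vc; apply/negP=> v_u.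
  by have /negP := fresh v (cF v vc (subsetP (subsetUl _ _) v (uF v v_u))).
- move=> v; rewrite mem_visited_cons !mem_cat => /orP[/avoidL/negPf->//|/orP[->//|vc] vF].
  by rewrite -mem_cat (cF v vc) ?orbT // in_setU vF.
- move=> v; rewrite inE => /predU1P[->|/edge_c edge_v]; apply: has_edge_in_cat.
    by rewrite (@has_edge_in_cat _ _ [:: w; m] [:: w']) ?edge_L.
  by apply/orP; right; apply: has_edge_in_cat; rewrite edge_v orbT.
- by apply: has_edge_in_cat; rewrite (@has_edge_in_cat _ _ [:: u; mu u]) ?edge_cx ?orbT.
Qed.

Lemma linked_walk_nil F z x : #|F| + 3 <= s -> x \in cover H -> z \in cover H ->
  phi x = phi z -> exists c, linked_walk F z [::] x c.
Proof.
move=> F_small xH zH xz.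
have [|w [m [w' [uniq_link linkF path_link edge_link]]]] := hub_link _ zH xH xz (F := F).
  by move: F_small; clear; lia.
exists [:: w; m; w']; split=> // [|v /linkF/negPf->//|].
  exact: sub_path (@sub_union_rel _ _ _) _ _ path_link.
by rewrite xz; apply: (@has_edge_in_cat _ _ [:: w; m]); rewrite edge_link.
Qed.

Lemma exists_linked_walk x ss z F :
  #|F| + 3 * (size ss).+1 <= s -> uniq (visited ss) -> {subset visited ss <= F} ->
  {in ss, forall u, mu u != u} -> {subset visited ss <= cover H} ->
  x \in cover H -> z \in cover H ->
  walk mu phi (phi z) ss -> walk_end mu phi (phi z) ss = phi x ->
  exists c, linked_walk F z ss x c.
Proof.
elim: ss z F => [|u ss IHss] z F F_small uniq_ss ssF free_ss ssH xH zH.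
  by move=> _ /esym xz; apply: linked_walk_nil.
case/andP=> /eqP uz walk_ss end_ss.
have visited_u v : v \in [:: u; mu u] -> v \in visited (u :: ss).
  by rewrite mem_visited_cons => ->.
have visited_ss v : v \in visited ss -> v \in visited (u :: ss).
  by rewrite mem_visited_cons orbC => ->.
have uH : u \in cover H by apply/ssH/visited_u; rewrite mem_head.
have [|w [m [w' [uniq_link linkF path_link edge_link]]]] := hub_link _ zH uH uz (F := F).
  by move: F_small => /=; clear; lia.
rewrite -uz in edge_link; have mu_u : mu u != u by apply: free_ss; exact: mem_head.
pose F' := F :|: [set v in [:: w; m; w']].
have [||||||c linked_c] := IHss (mu u) F' _ _ _ _ _ xH _ walk_ss end_ss.
- apply: leq_trans (_ : #|F| + 3 + 3 * (size ss).+1 <= _); last first.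
    by move: F_small => /=; clear; lia.
  rewrite leq_add2r; apply: leq_trans (leq_card_setU _ _) _.
  by rewrite leq_add2l cardsE card_size.
- move: uniq_ss; rewrite (perm_uniq (perm_mu_cat_cons mu u ss)) cat_uniq.
  by case/and3P.
- by move=> v /visited_ss/ssF vF; rewrite in_setU vF.
- by move=> v v_ss; apply: free_ss; rewrite inE v_ss orbT.
- by move=> v /visited_ss/ssH.
- by apply/ssH/visited_u; rewrite !inE eqxx orbT.
exists ([:: w; m; w'] ++ [:: u; mu u] ++ c).
exact: linked_walk_cons edge_link uniq_ss ssF mu_u linked_c.
Qed.

End LinkingHubs.

Section Pancyclicity.
Variables (T : finType) (g r : rel T) (a e s : nat) (P H : {set {set T}}).
Hypotheses (gsym : symmetric g) (girr : irreflexive g) (rsym : symmetric r).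
Hypothesis rmatch : forall x y z, r x y -> r x z -> y = z.
Hypotheses (e0 : 0 < e) (alphaT : alpha_le g a).
Hypothesis degT : forall u, 4 * e <= #|nbr g u|.
Hypothesis sT : 32 * s.+1 * #|T| <= e * e.
Hypothesis hubs_s : 10 * #|H| + 20 * a + 30 <= s.
Hypothesis sysPH : hub_system g e s P H.
Implicit Types (l : nat) (x y : T) (D Z : {set T}) (c : seq T).
Local Notation h := (union_rel g r).
Local Notation mu := (partner r).
Local Notation phi := (pblock H).

Let a_le_s : a <= s. Proof. by move: hubs_s; clear; lia. Qed.

Lemma hub_system_se : 0 < #|T| -> 32 * s.+1 <= e.
Proof.
move=> T0; apply: (factor_le_of_mul_le_sqr T0 _ sT).
have /card_gt0P[u _] := T0; apply: leq_trans (_ : #|nbr g u| <= _); last exact: max_card.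
by apply: leq_trans (degT u); rewrite leq_pmull.
Qed.

Lemma short_cycle l Z : 3 <= l <= 12 * a + 12 -> Z \in H -> cycle_of_length g l.
Proof.
move=> /andP[l3 l_small] ZH; have [_ hubH _] := hub_system_hubs sysPH.
have [hubZ cardZ] := hubH Z ZH.
have /card_gt0P[z _] : 0 < #|Z| by move: e0 cardZ; clear; lia.
have [l24|l25] := leqP l 24; last first.
  apply: (closed_ladder_cycle gsym girr alphaT e0 a_le_s sT degT hubZ cardZ l25).
  by move: l_small hubs_s; clear; lia.
have -> : l = (l - 2).+2 by move: l3; clear; lia.
apply: (@fan_cycle _ _ gsym girr a _ z) => //; apply: leq_trans (degT z).
have : (l - 2) * a <= 22 * a by rewrite leq_mul2r; move: l24; clear; lia.
have se : 32 * s.+1 <= e by apply: hub_system_se; apply/card_gt0P; exists z.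
by move: se a_le_s; clear; lia.
Qed.

Lemma cycle_of_route D x y p c :
  path_in g D x y p -> route h D y x c -> cycle_of_length h (size (x :: p) + size c).
Proof.
move=> [path_p last_p uniq_p pD] [path_c uniq_c cD]; exists (x :: p ++ c); split.
- rewrite /cycle rcons_cat cat_path last_p path_c andbT.
  exact: sub_path (@sub_union_rel _ _ _) _ _ path_p.
- rewrite -cat_cons cat_uniq uniq_p uniq_c andbT.
  by apply/hasPn=> z /cD; apply: contra; exact: pD.
- by rewrite /= size_cat.
Qed.

Section Zones.
Variables Y1 Y2 : {set T}.
Hypotheses (disjY : [disjoint Y1 & Y2]) (Y1H : Y1 \subset cover H) (Y2H : Y2 \subset cover H).
Hypothesis crossing1 : crossing mu phi (ports_in r Y1) H.
Hypothesis crossing2 : crossing mu phi (ports_in r Y2) H.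

Lemma exists_zone_tour Z : Z \in H ->
  exists ss, [/\ walk mu phi Z ss, walk_end mu phi Z ss = Z, uniq (ss ++ map mu ss),
    {in ss ++ map mu ss, forall z, z \in cover H /\ mu z != z} &
    {subset H <= Z :: map phi ss} /\ size ss <= 2 * #|H|].
Proof.
move=> ZH; have muK := partnerK rsym rmatch.
set A := ports_in r Y1 :|: ports_in r Y2.
have closedA : mu_closed mu A.
  by move=> z; rewrite !in_setU => /orP[] /(ports_in_closed rsym rmatch)->; rewrite ?orbT.
have freeA : mu_free mu A by move=> z; rewrite in_setU => /orP[]; exact: ports_in_free.
have AH : A \subset cover H.
  by rewrite subUset !(subset_trans (ports_in_sub _ _)).
have [||ss [[walk_ss uniq_ss ssA] closed_ss spanning size_ss]] :=
  exists_spanning_tour muK ZH _ freeA _ crossing1 crossing2.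
- by apply: disjointWl (ports_in_sub _ _) (disjointWr (ports_in_sub _ _) disjY).
- by move=> z /(subsetP AH); exact: pblock_mem.
exists ss; split=> // z z_ss; suff zA : z \in A by rewrite (subsetP AH) // freeA.
by move: z_ss; rewrite mem_cat => /orP[/ssA//|/mapP[y /ssA /closedA yA ->]].
Qed.

Lemma exists_ladder_route Z : Z \in H ->
  exists x y D c, [/\ ladder_on g D x y (10 * a + 7) (12 * a + 9), #|D| = 12 * a + 9,
    route h D y x c & {in P, forall Q, has_edge_in Q c}].
Proof.
move=> ZH; have [tH hubH _] := hub_system_hubs sysPH; have [tP _] := hub_system_pieces sysPH.
have [hubZ cardZ] := hubH Z ZH.
have [reg [hub_reg reg_onto]] := exists_regions e0 tP (hub_system_hubs sysPH).
have [ss [walk_ss closed_ss uniq_ss ssH [spanning size_ss]]] := exists_zone_tour ZH.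
pose V := [set z in ss ++ map mu ss].
have cardV : #|V| <= 4 * #|H|.
  by rewrite cardsE (leq_trans (card_size _)) // size_cat size_map; move: size_ss; clear; lia.
have [|x [y [D [xZ yZ DV cardD ladD]]]] :=
    ladder gsym girr alphaT e0 a_le_s sT degT hubZ cardZ (r := (2 * a).+1) (F := V).
  by move: cardV hubs_s; clear; lia.
have in_Z z : z \in Z -> phi z = Z /\ z \in cover H.
  by move=> zZ; split; [exact: def_pblock | apply/bigcupP; exists Z].
have [[xE xH] [yE yH]] := (in_Z x xZ, in_Z y yZ).
have [||||||c [path_c uniq_c cDV edge_c edge_cx]] :=
    exists_linked_walk (x := x) (z := y) (F := D :|: V) (r := r) hub_reg _ uniq_ss _ _ _ xH yH.
- apply: leq_trans (leq_add (leq_of_leqif (leq_card_setU _ _)) (leqnn _)) _.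
  by rewrite cardD; move: cardV size_ss hubs_s; clear; lia.
- by move=> v v_ss; rewrite in_setU [v \in V]in_set v_ss orbT.
- by move=> v v_ss; have [] := ssH v; rewrite // mem_cat v_ss.
- by move=> v /ssH[].
- by rewrite yE.
- by rewrite yE xE.
exists x, y, D, c; split.
- by move=> m m_range; apply: ladD; move: m_range; clear; lia.
- by rewrite cardD; clear; lia.
- split=> // z zc; apply/negP => zD.
  have : z \in V by rewrite in_set cDV // in_setU zD.
  by rewrite (disjointFr DV zD).
- move=> Q /reg_onto[Z' /spanning + <-]; rewrite inE => /predU1P[->|/mapP[u u_ss ->]].
    by rewrite -xE.
  exact: edge_c.
Qed.

Lemma exists_spanning_ladder_route Z : Z \in H ->
  exists x y D c, [/\ ladder_on g D x y (10 * a + 7) (12 * a + 9), #|D| = 12 * a + 9,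
    route h D y x c & size c + #|D| = #|T|].
Proof.
move=> ZH; have [x [y [D [c0 [ladD cardD route0 edge0]]]]] := exists_ladder_route ZH.
have [tP famP] := hub_system_pieces sysPH; have covP := hub_system_cover sysPH.
have robP : {in P, forall Q, robust g s Q} by move=> Q /famP[].
have degP : {in P, forall Q : {set T}, {in Q, forall u, s < #|nbr g u :&: Q|}}.
  move=> Q QP u uQ; have [robQ /has_core_card eQ] := famP Q QP.
  apply: (robust_degree girr robQ _ uQ); apply: leq_trans eQ.
  have se : 32 * s.+1 <= e by apply: hub_system_se; apply/card_gt0P; exists u.
  by move: se; clear; lia.
have Das : #|D| + a + 2 <= s.+1 by rewrite cardD; move: hubs_s; clear; lia.
have hsym := union_rel_sym gsym rsym; have gh := @sub_union_rel _ g r.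
have [c1 route1 a1] := thicken_route gsym gh tP robP Das degP route0 edge0.
have [c route_c c_cover] := spanning_route gsym girr hsym gh robP Das alphaT covP route1 a1.
exists x, y, D, c; split=> //; have [_ /card_uniqP <- cD] := route_c.
rewrite -(cardsC D) addnC; congr (_ + _); apply: eq_card => z.
by rewrite in_setC; apply/idP/idP => [/cD|/c_cover].
Qed.

Lemma long_cycle l Z : Z \in H -> 12 * a + 12 < l <= #|T| -> cycle_of_length h l.
Proof.
move=> ZH /andP[l_big lT].
have [x [y [D [c0 [ladD cardD route0 size0]]]]] := exists_spanning_ladder_route ZH.
pose ok c := route h D y x c /\ l <= size c + (12 * a + 9).
have [|c [route_c lc] c_min] := @exists_minimizer _ ok size.
  by exists c0; split=> //; rewrite -cardD size0.
have cl : size c + (10 * a + 7) <= l.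
  have [c_small|c_big] := leqP (size c) (2 * a); first by move: c_small l_big; clear; lia.
  have [c' [route_c' shorter cc']] :=
    shorten_route gsym girr (@sub_union_rel _ g r) alphaT route_c c_big.
  have : ~ ok c' by move/c_min; rewrite leqNgt shorter.
  have [lc' []//|lc' _] := leqP l (size c' + (12 * a + 9)).
  by move: lc' cc'; clear; lia.
have [|p path_p size_p] := ladD (l - size c); first by move: lc cl; clear; lia.
have -> : l = size (x :: p) + size c by rewrite size_p; move: cl; clear; lia.
exact: cycle_of_route path_p route_c.
Qed.

Lemma pancyclic_union l : 3 <= l <= #|T| -> cycle_of_length h l.
Proof.
move=> /andP[l3 lT]; have largeH := hub_system_large sysPH.
have /card_gt0P[x /bigcupP[Z ZH _]] : 0 < #|cover H|.
  by move: l3 lT largeH; clear; lia.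
have [l_small|l_big] := leqP l (12 * a + 12); last by apply: (long_cycle ZH); rewrite l_big.
by apply: sub_cycle_of_length (@sub_union_rel _ g r) (short_cycle _ ZH); rewrite l3.
Qed.

End Zones.

End Pancyclicity.

(** * Random subsets *)

Section RandomSubsets.
Variables (R : realDomainType) (X : finType).
Implicit Types (p q : R) (s : seq X) (f : {set X} -> R) (x : X) (A B E S : {set X}).
Local Open Scope ring_scope.

Fixpoint expect p s f : R :=
  if s is x :: s' then p * expect p s' (fun E => f (x |: E)) + (1 - p) * expect p s' f
  else f set0.

Lemma subset_setU1_notin x A B : x \notin A -> (A \subset x |: B) = (A \subset B).
Proof.
by move=> xA; rewrite -subDset (setDidPl _) // disjoint_sym disjoints1.
Qed.

Lemma sum_subsets_expect p s f : uniq s ->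
  \sum_(E : {set X} | E \subset [set:: s])
    p ^+ #|E| * (1 - p) ^+ (size s - #|E|) * f E = expect p s f.
Proof.
elim: s f => [|x s IHs] f /=.
  move=> _; rewrite (big_pred1 set0) => [|E]; last by rewrite set_nil subset0.
  by rewrite cards0 sub0n !expr0 !mul1r.
case/andP=> xs uniq_s; rewrite -!IHs // set_cons (bigID (fun E : {set X} => x \in E)) /=.
have not_sub E : x \in E -> (E \subset [set:: s]) = false.
  by move=> xE; apply/negP => /subsetP/(_ x xE); rewrite inE (negPf xs).
congr (_ + _); rewrite big_distrr /=.
  rewrite (reindex_onto (fun E => x |: E) (fun E => E :\ x)) /=; last first.
    by move=> E /andP[_ xE]; rewrite setD1K.
  apply: eq_big => [E|E /andP[_ /eqP ExE]].
    rewrite setU11 andbT subUset sub1set setU11 /=.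
    have [xE|xE] := boolP (x \in E); last by rewrite setU1K // eqxx andbT subset_setU1_notin.
    rewrite not_sub //; apply/negP => /andP[_ /eqP ExE].
    by move: xE; rewrite -ExE !inE eqxx.
  have xE : x \notin E by rewrite -ExE !inE eqxx.
  by rewrite cardsU1 xE /= subSS exprS !mulrA.
apply: eq_big => [E|E /andP[ES xE]].
  have [xE|xE] := boolP (x \in E); last by rewrite andbT subset_setU1_notin.
  by rewrite not_sub // andbF.
rewrite subset_setU1_notin // in ES; have := subset_leq_card ES.
by rewrite cardsE (card_uniqP uniq_s) => card_E; rewrite subSn // exprS mulrCA !mulrA.
Qed.

Lemma eq_expect p s f f' :
  (forall E, E \subset [set:: s] -> f E = f' E) -> expect p s f = expect p s f'.
Proof.
elim: s f f' => [|x s IHs] f f' ff' /=; first by apply: ff'; rewrite sub0set.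
congr (_ * _ + _ * _); apply: IHs => E ES; apply: ff'; rewrite set_cons.
  exact: setUS.
exact: subset_trans ES (subsetU1 _ _).
Qed.

Lemma expect_cst p s (c : R) : expect p s (fun=> c) = c.
Proof. by elim: s => //= x s ->; rewrite -mulrDl addrC subrK mul1r. Qed.

Lemma expectD p s f f' : expect p s (fun E => f E + f' E) = expect p s f + expect p s f'.
Proof. by elim: s f f' => //= x s IHs f f'; rewrite !IHs; ring. Qed.

Lemma expectZ p s c f : expect p s (fun E => c * f E) = c * expect p s f.
Proof. by elim: s f => //= x s IHs f; rewrite !IHs; ring. Qed.

Lemma expectB p s f f' : expect p s (fun E => f E - f' E) = expect p s f - expect p s f'.
Proof. by elim: s f f' => //= x s IHs f f'; rewrite !IHs; ring. Qed.

Lemma expect_sum p s (I : Type) (r : seq I) (P : pred I) (F : I -> {set X} -> R) :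
  expect p s (fun E => \sum_(i <- r | P i) F i E) = \sum_(i <- r | P i) expect p s (F i).
Proof.
elim: s F => //= x s IHs F; rewrite (IHs (fun i E => F i (x |: E))) IHs.
by rewrite !big_distrr -big_split.
Qed.

Lemma le_expect p s f f' : 0 <= p <= 1 ->
  (forall E, E \subset [set:: s] -> f E <= f' E) -> expect p s f <= expect p s f'.
Proof.
move=> /andP[p0 p1]; elim: s f f' => [|x s IHs] f f' ff' /=; first by apply: ff'; rewrite sub0set.
apply: lerD; apply: ler_wpM2l; rewrite ?subr_ge0 //; apply: IHs => E ES; apply: ff'.
  by rewrite set_cons; exact: setUS.
by rewrite set_cons; exact: subset_trans ES (subsetU1 _ _).
Qed.

Lemma expect_monotone p q s f : 0 <= p -> p <= q -> q <= 1 ->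
  (forall A B, A \subset B -> f A <= f B) -> expect p s f <= expect q s f.
Proof.
move=> p0 pq q1; elim: s f => [|x s IHs] f f_mono //=.
have with_x : expect p s (fun E => f (x |: E)) <= expect q s (fun E => f (x |: E)).
  by apply: IHs => A B AB; apply: f_mono; exact: setUS.
have without_x := IHs f f_mono.
have adding_x : expect p s f <= expect p s (fun E => f (x |: E)).
  by apply: le_expect => [|E _]; [rewrite p0 (le_trans pq) | exact/f_mono/subsetU1].
move: with_x without_x adding_x.
set a := expect p s (fun E => _); set b := expect q s (fun E => _).
set c := expect p s f; set d := expect q s f => ab cd ca.
have : 0 <= q * (b - a) + (1 - q) * (d - c) + (q - p) * (a - c).
  by rewrite !addr_ge0 // mulr_ge0 ?subr_ge0 // (le_trans p0 pq).
by clear; lra.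
Qed.

Lemma expect_disjoint p s S : uniq s -> S \subset [set:: s] ->
  expect p s (fun E => [disjoint S & E]%:R) = (1 - p) ^+ #|S|.
Proof.
elim: s S => [|x s IHs] S /=.
  by move=> _; rewrite set_nil subset0 => /eqP->; rewrite -setI_eq0 setI0 eqxx cards0.
case/andP=> xs uniq_s; rewrite set_cons => Sxs.
have disjointU1r E : [disjoint S & x |: E] = (x \notin S) && [disjoint S & E].
  by rewrite -!setI_eq0 setIUr setU_eq0 !setI_eq0 disjoint_sym disjoints1.
rewrite (@eq_expect _ _ _ (fun E => ((x \notin S) && [disjoint S & E])%:R)) => [|E _]; last first.
  by rewrite disjointU1r.
have [xS|xS] /= := boolP (x \in S); last first.
  rewrite subset_setU1_notin // in Sxs.
  by rewrite IHs // -mulrDl addrC subrK mul1r.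
rewrite expect_cst mulr0 add0r (cardsD1 x S) xS exprS -IHs ?subDset //; congr (_ * _).
apply: eq_expect => E /subsetP Es.
have xE : x \notin E by apply: contra xs => /Es; rewrite inE.
by rewrite !(disjoint_sym _ E) !disjoints_subset setCD setUC subset_setU1_notin.
Qed.

Lemma expect_subset p s S : uniq s ->
  expect p s (fun E => (S \subset E)%:R) = if S \subset [set:: s] then p ^+ #|S| else 0.
Proof.
elim: s S => [|x s IHs] S /=.
  by rewrite set_nil subset0; case: eqP => // ->; rewrite cards0 expr0.
case/andP=> xs uniq_s; rewrite set_cons -subDset.
rewrite (@eq_expect _ _ _ (fun E => (S :\ x \subset E)%:R)) => [|E _]; last by rewrite subDset.
rewrite !IHs //; have [xS|xS] := boolP (x \in S).
  have -> : (S \subset [set:: s]) = false.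
    by apply/negP => /subsetP/(_ x xS); rewrite inE (negPf xs).
  by rewrite mulr0 addr0 (cardsD1 x S) xS exprS; case: ifP; rewrite ?mulr0.
have -> : S :\ x = S by apply/setDidPl; rewrite disjoint_sym disjoints1.
by rewrite -mulrDl addrC subrK mul1r.
Qed.

End RandomSubsets.

Section RandomGraphs.
Variables (R : realType) (n : nat) (G : {set {set 'I_n}}).
Implicit Types (p : R) (P : {set {set 'I_n}} -> bool) (E S : {set {set 'I_n}}).
Local Open Scope ring_scope.
Local Notation expect_gnp p := (expect p (enum (pairs n))).

Lemma prob_unionE p P : prob_union G p P = expect_gnp p (fun E => (P (G :|: E))%:R).
Proof. by rewrite -sum_subsets_expect ?enum_uniq // set_enum -cardE. Qed.

Lemma prob_unionC p P : prob_union G p (fun E => ~~ P E) = 1 - prob_union G p P.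
Proof.
rewrite !prob_unionE -[X in X - _](expect_cst p (enum (pairs n)) 1) -expectB.
by apply: eq_expect => E _; case: (P _); rewrite ?subrr ?subr0.
Qed.

Lemma prob_union_ge0 p P : 0 <= p <= 1 -> 0 <= prob_union G p P.
Proof.
move=> p01; rewrite prob_unionE -[X in X <= _](expect_cst p (enum (pairs n)) 0).
by apply: le_expect.
Qed.

Lemma prob_union_le1 p P : 0 <= p <= 1 -> prob_union G p P <= 1.
Proof. by move=> p01; rewrite -subr_ge0 -prob_unionC prob_union_ge0. Qed.

Lemma prob_union_monotone p q P : 0 <= p -> p <= q -> q <= 1 ->
  (forall E S, E \subset S -> P E -> P S) -> prob_union G p P <= prob_union G q P.
Proof.
move=> p0 pq q1 P_mono; rewrite !prob_unionE; apply: expect_monotone => // E S ES.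
rewrite ler_nat; case PE: (P (G :|: E)) => //.
by rewrite (P_mono _ _ _ PE) // setUS.
Qed.

Lemma expect_gnp_disjoint p S : S \subset pairs n ->
  expect_gnp p (fun E => [disjoint S & E]%:R) = (1 - p) ^+ #|S|.
Proof. by move=> SP; rewrite expect_disjoint ?enum_uniq // set_enum. Qed.

End RandomGraphs.

(** * Random edges across cuts *)

Section GraphFacts.
Variable n : nat.
Implicit Types (E G : {set {set 'I_n}}) (u v x y z : 'I_n) (A B : {set 'I_n}) (l m : nat).

Lemma adj_sym E : symmetric (adj E).
Proof. by move=> u v; rewrite /adj setUC. Qed.

Lemma adj_irr E : is_graph E -> irreflexive (adj E).
Proof. by move=> /subsetP gE u; apply/negP => /gE; rewrite inE setUid cards1. Qed.

Lemma adjU G E u v : adj (G :|: E) u v = adj G u v || adj E u v.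
Proof. by rewrite /adj in_setU. Qed.

Lemma mindeg_le E v : mindeg E <= deg E v.
Proof.
rewrite /mindeg; have : v \in index_enum 'I_n by rewrite mem_index_enum.
elim: (index_enum _) => // u r IHr; rewrite inE big_cons => /predU1P[<-|/IHr le_deg].
  exact: geq_minl.
exact: leq_trans (geq_minr _ _) le_deg.
Qed.

Lemma leq_mindeg E m : m <= n -> (forall v, m <= deg E v) -> m <= mindeg E.
Proof.
move=> mn le_deg; rewrite /mindeg; elim/big_ind: _ => // k l mk ml.
by rewrite leq_min mk.
Qed.

Lemma mindeg_le_order E : 0 < n -> mindeg E <= n.
Proof.
move=> n0; apply: leq_trans (mindeg_le E (Ordinal n0)) _.
by rewrite -[X in _ <= X]card_ord max_card.
Qed.

Lemma alpha_le_adj E m : alpha E <= m -> alpha_le (adj E) m.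
Proof.
move=> alphaE S mS; have : ~~ independent E S.
  apply: contraL mS => indepS; rewrite -leqNgt; apply: leq_trans alphaE.
  exact: (@leq_bigmax_cond _ (independent E) (fun S : {set 'I_n} => #|S|)).
rewrite negb_forall_in => /exists_inP[x xS]; rewrite negb_forall_in => /exists_inP[y yS].
by rewrite negbK => xy; exists x, y.
Qed.

Lemma has_cycle_of_length E l : 0 < l -> cycle_of_length (adj E) l -> has_cycle E l.
Proof.
move=> l0 [[|x c] [cyc_c uniq_c sz_c]]; first by rewrite -sz_c in l0.
subst l; apply/existsP; exists [ffun i : 'I_(size (x :: c)) => nth x (x :: c) i].
apply/andP; split.
  apply/injectiveP=> i j; rewrite !ffunE => /eqP; rewrite nth_uniq // => /eqP.
  exact: val_inj.
apply/forallP=> i; rewrite !ffunE; have ic : i < (size c).+1 := ltn_ord i.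
move: cyc_c => /= /(pathP x)/(_ i); rewrite size_rcons => /(_ ic).
rewrite -rcons_cons !nth_rcons [size (x :: c)]/= ic.
have [i_lt|i_ge] := ltnP i (size c); first by rewrite modn_small.
have {i_ge ic} i_last : i = size c :> nat by move: i_ge ic; clear; lia.
by rewrite i_last eqxx modnn.
Qed.

Lemma has_cycleS E G l : E \subset G -> has_cycle E l -> has_cycle G l.
Proof.
move=> EG /existsP[f /andP[f_inj /forallP f_adj]]; apply/existsP; exists f; rewrite f_inj /=.
by apply/forallP=> i; apply: (subsetP EG); exact: f_adj.
Qed.

Lemma pancyclicS E G : E \subset G -> pancyclic E -> pancyclic G.
Proof.
move=> EG /forallP pan; apply/forallP=> l; apply/implyP=> l3.
by apply: has_cycleS EG _; exact: (implyP (pan l)).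
Qed.

Definition is_matching E : Prop := forall x y z, adj E x y -> adj E x z -> y = z.

Definition edges_between A B : {set {set 'I_n}} :=
  [set [set xy.1; xy.2] | xy in setX A B].

Lemma edges_betweenP A B (e : {set 'I_n}) :
  reflect (exists x y, [/\ x \in A, y \in B & e = [set x; y]]) (e \in edges_between A B).
Proof.
apply: (iffP imsetP) => [[[x y] /setXP[/= xA yB] ->]|[x [y [xA yB ->]]]]; first by exists x, y.
by exists (x, y) => //; apply/setXP.
Qed.

Lemma edges_between_pairs A B : [disjoint A & B] -> edges_between A B \subset pairs n.
Proof.
move=> disjAB; apply/subsetP=> _ /edges_betweenP[x [y [xA yB ->]]].
by rewrite inE cards2 (disjoint_neq disjAB xA yB).
Qed.

Lemma card_edges_between A B : [disjoint A & B] -> #|edges_between A B| = #|A| * #|B|.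
Proof.
move=> disjAB; rewrite -cardsX card_in_imset // => -[x y] [x' y'].
move=> /setXP[/= xA yB] /setXP[/= x'A y'B].
have neq u v : u \in A -> v \in B -> u != v by exact: disjoint_neq.
move=> exy; have : x \in [set x'; y'] by rewrite -exy set21.
rewrite !inE (negPf (neq x y' xA y'B)) orbF => /eqP xx'.
have : y \in [set x'; y'] by rewrite -exy set22.
by rewrite !inE -xx' eq_sym (negPf (neq x y xA yB)) /= => /eqP->; rewrite xx'.
Qed.

End GraphFacts.

Section Cuts.
Variables (n : nat) (H : {set {set 'I_n}}) (Y : {set 'I_n}).
Hypotheses (tH : trivIset H) (YH : Y \subset cover H).
Implicit Types (W : {set {set 'I_n}}) (m M : nat).

Definition side W : {set 'I_n} := Y :&: cover W.

Definition cut W : {set {set 'I_n}} := edges_between (side W) (side (H :\: W)).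

Lemma pblock_sub_cover W x : W \subset H -> x \in cover W -> pblock H x \in W.
Proof. by move=> WH /bigcupP[Z ZW xZ]; rewrite (def_pblock tH (subsetP WH Z ZW) xZ). Qed.

Lemma disjoint_sides W : W \subset H -> [disjoint side W & side (H :\: W)].
Proof.
move=> WH; rewrite -setI_eq0; apply/eqP/setP=> x; rewrite in_set0; apply/negP.
case/setIP=> /setIP[_ xW] /setIP[_ xHW].
have := pblock_sub_cover (subsetDl _ _) xHW.
by rewrite in_setD (pblock_sub_cover WH xW).
Qed.

Lemma cut_pairs W : W \subset H -> cut W \subset pairs n.
Proof. by move=> /disjoint_sides; exact: edges_between_pairs. Qed.

Lemma card_side W m : W \subset H -> {in H, forall Z : {set 'I_n}, m <= #|Y :&: Z|} ->
  #|W| * m <= #|side W|.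
Proof.
move=> WH mY; rewrite card_setI_cover ?(trivIsetS WH) // -sum_nat_const.
by apply: leq_sum => Z ZW; apply: mY; exact: (subsetP WH).
Qed.

Lemma card_zone : #|Y| = \sum_(Z in H) #|Y :&: Z|.
Proof. by rewrite -card_setI_cover // (setIidPl YH). Qed.

Lemma card_sides W : W \subset H -> #|side W| + #|side (H :\: W)| = #|Y|.
Proof.
move=> WH; rewrite !card_setI_cover ?(trivIsetS _ tH) ?subsetDl // card_zone.
by rewrite [RHS](big_setID W) /= (setIidPr WH).
Qed.

Lemma card_cut_ge W m M : W \subset H -> {in H, forall Z : {set 'I_n}, m <= #|Y :&: Z|} ->
  2 * M <= m * #|Y| ->
  (#|W| * M <= #|cut W|) || (#|H :\: W| * M <= #|cut W|).
Proof.
move=> WH mY M_le; rewrite card_edges_between ?disjoint_sides //.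
have small_times_large k x y : k * m <= x -> #|Y| <= 2 * y -> k * M <= x * y.
  move=> kx Yy; apply: leq_trans (_ : k * m * y <= _); last by rewrite leq_mul2r kx orbT.
  rewrite -mulnA leq_mul2l -(leq_pmul2l (ltn0Sn 1)) (leq_trans M_le) ?orbT // mulnCA.
  by rewrite leq_mul2l Yy orbT.
have sideW := card_side WH mY; have sideHW := card_side (subsetDl H W) mY.
have sumY := card_sides WH; have [le_sides|/ltnW le_sides] := leqP #|side W| #|side (H :\: W)|.
  apply/orP; left; apply: small_times_large => //.
  by rewrite -sumY mul2n -addnn leq_add2r.
apply/orP; right; rewrite [leqRHS]mulnC; apply: small_times_large => //.
by rewrite -sumY mul2n -addnn leq_add2l.
Qed.

Lemma crossing_cut (E : {set {set 'I_n}}) : is_matching E ->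
  (forall W, W != set0 -> W \proper H -> ~~ [disjoint cut W & E]) ->
  crossing (partner (adj E)) (pblock H) (ports_in (adj E) Y) H.
Proof.
move=> matchE cutE W WH W0 WnH; have Wprop : W \proper H by rewrite properEneq WnH.
have := cutE W W0 Wprop; rewrite -setI_eq0 => /set0Pn[e /setIP[/edges_betweenP]].
move=> [x [y [xW yW ->]]] xy; have yx : adj E y x by rewrite adj_sym.
have xny : x != y := disjoint_neq (disjoint_sides WH) xW yW.
move: xW yW => /setIP[xY xW] /setIP[yY yW].
exists y; rewrite !inE (partnerE matchE yx) (partnerE matchE xy) xY yY xny eq_sym xny.
rewrite (pblock_sub_cover WH xW); split=> //.
by have := pblock_sub_cover (subsetDl _ _) yW; rewrite inE.
Qed.

End Cuts.

Section UncrossedCuts.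
Variables (R : realType) (n : nat) (H : {set {set 'I_n}}) (Y : {set 'I_n}).
Hypotheses (tH : trivIset H) (YH : Y \subset cover H).
Implicit Types (W : {set {set 'I_n}}) (p q : R).
Local Open Scope ring_scope.
Local Notation cut := (cut H Y).

Lemma sum_subset_expr (I : finType) (A : {set I}) (q : R) :
  \sum_(W : {set I} | W \subset A) q ^+ #|W| = (1 + q) ^+ #|A|.
Proof.
rewrite exprDn (partition_big (fun W : {set I} => inord #|W| : 'I_#|A|.+1) xpredT) //=.
apply: eq_bigr => k _; rewrite expr1n mul1r -cards_draws -sumr_const.
apply: eq_big => [W|W /andP[WA /eqP <-]]; last by rewrite inordK // ltnS subset_leq_card.
rewrite inE; have [WA|//] := boolP (W \subset A).
by rewrite -val_eqE /= inordK // ltnS subset_leq_card.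
Qed.

Definition uncrossed (E : {set {set 'I_n}}) : R :=
  \sum_(W : {set {set 'I_n}} | (W != set0) && (W \proper H)) [disjoint cut W & E]%:R.

Lemma uncrossed_ge0 E : 0 <= uncrossed E.
Proof. by apply: sumr_ge0 => W _; rewrite ler0n. Qed.

Lemma expect_uncrossed p (m M : nat) : 0 <= p <= 1 ->
  {in H, forall Z, m <= #|Y :&: Z|}%N -> (2 * M <= m * #|Y|)%N ->
  expect p (enum (pairs n)) uncrossed <= 2 * ((1 + (1 - p) ^+ M) ^+ #|H| - 1).
Proof.
move=> p01 mY M_le; have [p0 p1] := andP p01.
have p'0 : 0 <= 1 - p by rewrite subr_ge0.
have p'1 : 1 - p <= 1 by rewrite lerBlDr lerDl.
set q := (1 - p) ^+ M; have q0 k : 0 <= q ^+ k by rewrite !exprn_ge0.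
have sum_q : \sum_(W | (W != set0) && (W \proper H)) q ^+ #|W| <= (1 + q) ^+ #|H| - 1.
  rewrite -sum_subset_expr [in leRHS](bigD1 set0) ?sub0set //= cards0 expr0 addrC addrK.
  rewrite big_mkcond [leRHS]big_mkcond; apply: ler_sum => W _.
  by rewrite properE; case: (W \subset H); case: (W != set0); case: (~~ _) => /=.
have cut_bound W : W \proper H -> (1 - p) ^+ #|cut W| <= q ^+ #|W| + q ^+ #|H :\: W|.
  move=> WH; rewrite /q -!exprM ![(M * _)%N]mulnC.
  have /orP[le_cut|le_cut] := card_cut_ge tH YH (proper_sub WH) mY M_le.
    by apply: le_trans (ler_wiXn2l p'0 p'1 le_cut) _; rewrite lerDl exprn_ge0.
  by apply: le_trans (ler_wiXn2l p'0 p'1 le_cut) _; rewrite lerDr exprn_ge0.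
rewrite expect_sum.
apply: le_trans (_ : \sum_(W | (W != set0) && (W \proper H)) (q ^+ #|W| + q ^+ #|H :\: W|) <= _).
  apply: ler_sum => W /andP[_ WH].
  by rewrite expect_gnp_disjoint ?cut_bound // cut_pairs ?proper_sub.
rewrite big_split mulr_natl mulr2n /=; apply: lerD => //; apply: le_trans sum_q.
rewrite [leRHS](reindex_onto (fun W => H :\: W) (fun W => H :\: W)) /=; last first.
  by move=> W /andP[_ /proper_sub WH]; rewrite setDDr setDv set0U (setIidPr WH).
rewrite big_mkcond [leRHS]big_mkcond; apply: ler_sum => W _.
case: ifP => [/andP[W0 WH]|_]; last by case: ifP.
rewrite ifT // setDDr setDv set0U (setIidPr (proper_sub WH)) eqxx andbT setD_eq0.
rewrite proper_subn // properE subsetDl /=; apply: contra W0; rewrite subsetD => /andP[_ disjHW].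
by rewrite -(setIidPr (proper_sub WH)) disjoint_setI0.
Qed.

Lemma sum_indicator_ge1 (I : finType) (F F' : pred I) i :
  F i -> F' i -> 1 <= \sum_(j | F j) (F' j)%:R :> R.
Proof.
by move=> Fi F'i; rewrite (bigD1 i) //= F'i lerDl; apply: sumr_ge0 => j _; rewrite ler0n.
Qed.

Lemma uncrossed_or_crossing E : is_matching E ->
  1 <= uncrossed E \/ crossing (partner (adj E)) (pblock H) (ports_in (adj E) Y) H.
Proof.
move=> matchE; have [/exists_inP[W W_sep W_disj]|] := boolP
    [exists (W : {set {set 'I_n}} | (W != set0) && (W \proper H)), [disjoint cut W & E]].
  by left; exact: (sum_indicator_ge1 (F' := fun W => [disjoint cut W & E]) W_sep).
rewrite negb_exists_in => /forall_inP all_crossed; right.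
by apply: crossing_cut => // W W0 WH; apply: all_crossed; rewrite W0.
Qed.

End UncrossedCuts.

Section Cherries.
Variables (R : realType) (n : nat).
Implicit Types (t : 'I_n * 'I_n * 'I_n) (E : {set {set 'I_n}}) (p : R).
Local Open Scope ring_scope.

Definition cherry t : {set {set 'I_n}} := [set [set t.1.1; t.1.2]; [set t.1.1; t.2]].

Definition cherries E : R := \sum_(t : 'I_n * 'I_n * 'I_n | t.1.2 != t.2) (cherry t \subset E)%:R.

Lemma cherries_ge0 E : 0 <= cherries E.
Proof. by apply: sumr_ge0 => t _; rewrite ler0n. Qed.

Lemma cherries_or_matching E : 1 <= cherries E \/ is_matching E.
Proof.
have [/exists_inP[t t_neq tE]|] := boolP
    [exists (t : 'I_n * 'I_n * 'I_n | t.1.2 != t.2), cherry t \subset E].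
  by left; exact: (sum_indicator_ge1 _ (F := fun t => t.1.2 != t.2)
                     (F' := fun t => cherry t \subset E) t_neq).
rewrite negb_exists_in => /forall_inP no_cherry; right=> x y z xy xz.
apply/eqP; apply: contraT => yz; have := no_cherry (x, y, z) yz.
by rewrite /cherry /= subUset !sub1set; move: xy xz; rewrite /adj => -> ->.
Qed.

Lemma expect_cherries p : 0 <= p -> expect p (enum (pairs n)) cherries <= n%:R ^+ 3 * p ^+ 2.
Proof.
move=> p0; rewrite expect_sum.
apply: le_trans (_ : \sum_(t : 'I_n * 'I_n * 'I_n) p ^+ 2 <= _); last first.
  have -> : n%:R ^+ 3 * p ^+ 2 = p ^+ 2 *+ (n * n * n) by rewrite -[RHS]mulr_natl !natrM; ring.
  by rewrite sumr_const !card_prod !card_ord.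
rewrite big_mkcond; apply: ler_sum => -[[x y] z] _ /=.
case: ifP => [yz|_]; last exact: exprn_ge0.
rewrite expect_subset ?enum_uniq // set_enum; case: ifP => [|_]; last exact: exprn_ge0.
rewrite /cherry /= subUset !sub1set !inE !cards2 => /andP[xy _].
case: eqVneq => // xyxz; have : y \in [set x; z] by rewrite -xyxz set22.
by rewrite !inE (negPf yz) orbF => /eqP yx; rewrite yx eqxx in xy.
Qed.

End Cherries.

Section Zones.
Variables (T : finType) (H : {set {set T}}).
Hypothesis tH : trivIset H.
Implicit Type Z : {set T}.

Definition half Z : {set T} := [set z in take #|Z|./2 (enum Z)].

Definition first_zone : {set T} := \bigcup_(Z in H) half Z.

Definition second_zone : {set T} := cover H :\: first_zone.

Lemma half_sub Z : half Z \subset Z.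
Proof. by apply/subsetP=> z; rewrite inE => /mem_take; rewrite mem_enum. Qed.

Lemma card_half Z : #|half Z| = #|Z|./2.
Proof.
rewrite cardsE (card_uniqP (take_uniq _ (enum_uniq _))) size_takel // -cardE.
by clear; lia.
Qed.

Lemma first_zone_sub : first_zone \subset cover H.
Proof.
by apply/bigcupsP=> Z ZH; apply: subset_trans (half_sub Z) _; exact: bigcup_sup.
Qed.

Lemma disjoint_zones : [disjoint first_zone & second_zone].
Proof. by rewrite disjoint_sym disjoints_subset /second_zone setDE subsetIr. Qed.

Lemma first_zoneI Z : Z \in H -> first_zone :&: Z = half Z.
Proof.
move=> ZH; apply/setP=> z; rewrite in_setI; apply/andP/idP => [[/bigcupP[Z' Z'H zZ'] zZ]|zZ].
  by rewrite -(def_pblock tH ZH zZ) (def_pblock tH Z'H (subsetP (half_sub Z') z zZ')).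
by rewrite (subsetP (half_sub Z)) //; split=> //; apply/bigcupP; exists Z.
Qed.

Lemma card_zonesI Z : Z \in H -> 1 < #|Z| ->
  #|Z| <= 3 * #|first_zone :&: Z| /\ #|Z| <= 3 * #|second_zone :&: Z|.
Proof.
move=> ZH Z2; have cardZ := card_half Z; rewrite -(first_zoneI ZH) in cardZ.
have -> : second_zone :&: Z = Z :\: first_zone.
  by rewrite /second_zone setIDAC setIC (setIidPl _) //; exact: bigcup_sup.
by have := cardsID first_zone Z; rewrite setIC cardZ; move: Z2; clear; lia.
Qed.

End Zones.

Lemma exists_hub_parameter (n a e : nat) : 0 < n -> e <= n -> 30 * 1024 * (n * n) <= e * e * e ->
  60 * 128 * (n * a) <= e * e ->
  exists s, 32 * s.+1 * n <= e * e /\ forall h, h * e <= 8 * n -> 10 * h + 20 * a + 30 <= s.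
Proof.
move=> n0 en e_cubed e_sqr.
have e_large : 30 * 1024 * n <= e * e.
  by rewrite -(leq_pmul2r n0) -mulnA (leq_trans e_cubed) // leq_mul2l en orbT.
pose s := (e * e) %/ (64 * n).
have s_le : 64 * n * s <= e * e by rewrite mulnC leq_divM.
have s_ge : e * e <= 128 * (n * s).
  have : e * e < s.+1 * (64 * n) by rewrite ltn_ceil // muln_gt0.
  by move: s_le e_large; clear; lia.
clearbody s; exists s; split=> [|h h_le]; first by move: s_le e_large; clear; lia.
have e0 : 0 < e by move: e_large n0; clear; case: e => //; lia.
have n128 : 0 < 128 * n by rewrite muln_gt0.
have h_small : 30 * h <= s.
  rewrite -(@leq_pmul2r (128 * n * e)) ?muln_gt0 ?n0 ?e0 //.
  have : e * e * e <= 128 * (n * s) * e by rewrite leq_mul2r s_ge orbT.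
  have : 30 * 128 * n * (h * e) <= 30 * 128 * n * (8 * n) by rewrite leq_mul2l h_le orbT.
  by move: e_cubed; clear; lia.
have a_small : 60 * a <= s by rewrite -(leq_pmul2r n128); move: s_ge e_sqr; clear; lia.
have s_large : 90 <= s by rewrite -(leq_pmul2r n128); move: s_ge e_large; clear; lia.
by move: h_small a_small s_large; clear; lia.
Qed.

Definition cut_size (n e : nat) : nat := (e %/ 24 * (n %/ 6)) %/ 2.

Lemma cut_size_ge (n e : nat) : 48 <= e -> 12 <= n -> e * n <= 2304 * cut_size n e.
Proof.
move=> e48 n12; rewrite /cut_size; set m := e %/ 24; set k := n %/ 6.
have em : e <= 48 * m by rewrite /m; move: e48; clear; lia.
have nk : n <= 12 * k by rewrite /k; move: n12; clear; lia.
have m2 : 2 <= m by rewrite /m; move: e48; clear; lia.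
have k1 : 1 <= k by rewrite /k; move: n12; clear; lia.
have mk2 : 2 <= m * k := leq_mul m2 k1.
by have := leq_mul em nk; move: mk2; rewrite mulnACA; move: (m * k) => mk; clear; lia.
Qed.

Lemma cut_size_le (n e : nat) (H : {set {set 'I_n}}) (Y : {set 'I_n}) :
  trivIset H -> Y \subset cover H -> n <= 2 * #|cover H| ->
  {in H, forall Z : {set 'I_n}, #|Z| <= 3 * #|Y :&: Z|} -> 2 * cut_size n e <= e %/ 24 * #|Y|.
Proof.
move=> tH YH largeH Y_third; rewrite mulnC (leq_trans (leq_divM _ _)) // leq_mul2l.
apply/orP; right; have : #|cover H| <= 3 * #|Y|.
  rewrite (card_zone tH YH) -(eqP tH) big_distrr /=.
  by apply: leq_sum => Z; exact: Y_third.
by move: largeH; clear; lia.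
Qed.

Section FailureBound.
Variables (R : realType) (n : nat) (G : {set {set 'I_n}}) (a e : nat).
Hypotheses (gG : is_graph G) (n0 : 0 < n) (e0 : 0 < e).
Hypotheses (mindegG : 4 * e <= mindeg G) (alphaG : alpha G <= a).
Implicit Types (p : R) (E P H : {set {set 'I_n}}) (Y : {set 'I_n}) (h M s : nat).

Let degG u : 4 * e <= #|nbr (adj G) u|. Proof. exact: leq_trans mindegG (mindeg_le G u). Qed.

Lemma card_hub_family s P H : hub_family (adj G) e s P H -> #|H| * e <= 8 * n.
Proof.
move=> [tH hubH _]; apply: leq_trans (_ : 8 * #|cover H| <= _); last first.
  by rewrite leq_mul2l -[X in _ <= X]card_ord max_card orbT.
by rewrite -(eqP tH) big_distrr /= -sum_nat_const; apply: leq_sum => Z /hubH[].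
Qed.

Lemma pancyclic_of_crossing s P H E :
  32 * s.+1 * n <= e * e -> 10 * #|H| + 20 * a + 30 <= s ->
  hub_system (adj G) e s P H -> is_matching E ->
  crossing (partner (adj E)) (pblock H) (ports_in (adj E) (first_zone H)) H ->
  crossing (partner (adj E)) (pblock H) (ports_in (adj E) (second_zone H)) H ->
  pancyclic (G :|: E).
Proof.
move=> sT hubs_s sysPH matchE cross1 cross2; apply/forallP=> l; apply/implyP=> l3.
apply: has_cycle_of_length; first exact: leq_trans l3.
have sT' : 32 * s.+1 * #|'I_n| <= e * e by rewrite card_ord.
have sub : subrel (union_rel (adj G) (adj E)) (adj (G :|: E)) by move=> u v; rewrite adjU.
apply: sub_cycle_of_length sub (pancyclic_union (adj_sym G) (adj_irr gG) (adj_sym E) matchE e0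
  (alpha_le_adj alphaG) degG sT' hubs_s sysPH (disjoint_zones H) (first_zone_sub H)
  (subsetDl _ _) cross1 cross2 _).
by rewrite l3 card_ord -ltnS ltn_ord.
Qed.

Local Open Scope ring_scope.

Lemma prob_not_pancyclic_le s P H p : 0 <= p <= 1 -> (24 <= e)%N ->
  (32 * s.+1 * n <= e * e)%N -> (10 * #|H| + 20 * a + 30 <= s)%N ->
  hub_system (adj G) e s P H ->
  1 - prob_union G p (@pancyclic n) <=
    n%:R ^+ 3 * p ^+ 2 + 4 * ((1 + (1 - p) ^+ cut_size n e) ^+ #|H| - 1).
Proof.
move=> p01 e24 sT hubs_s sysPH; have [p0 _] := andP p01.
have [tH hubH _] := hub_system_hubs sysPH; have largeH := hub_system_large sysPH.
rewrite card_ord in largeH.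
have thirds (Z : {set 'I_n}) : Z \in H ->
    (#|Z| <= 3 * #|first_zone H :&: Z|)%N /\ (#|Z| <= 3 * #|second_zone H :&: Z|)%N.
  move=> ZH; have cardZ : (e <= 8 * #|Z|)%N by have [] := hubH Z ZH.
  have Z1 : (1 < #|Z|)%N by move: e24 cardZ; clear; lia.
  exact: card_zonesI.
pose failures E : R :=
  cherries R E + (uncrossed R H (first_zone H) E + uncrossed R H (second_zone H) E).
rewrite -prob_unionC prob_unionE; apply: le_trans (_ : expect p (enum (pairs n)) failures <= _).
  apply: le_expect => // E _; have := cherries_ge0 R E.
  have := uncrossed_ge0 R H (first_zone H) E; have := uncrossed_ge0 R H (second_zone H) E.
  rewrite /failures; case pan: (pancyclic _) => /=; first by move=> *; rewrite !addr_ge0.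
  have [|matchE] := cherries_or_matching R E; first by lra.
  have [|cross1] := uncrossed_or_crossing R (first_zone H) tH matchE; first by lra.
  have [|cross2] := uncrossed_or_crossing R (second_zone H) tH matchE; first by lra.
  by rewrite (pancyclic_of_crossing sT hubs_s sysPH matchE cross1 cross2) in pan.
have bound Y : Y \subset cover H -> {in H, forall Z : {set 'I_n}, #|Z| <= 3 * #|Y :&: Z|}%N ->
    expect p (enum (pairs n)) (uncrossed R H Y) <= 2 * ((1 + (1 - p) ^+ cut_size n e) ^+ #|H| - 1).
  move=> YH Y_third; apply: (expect_uncrossed tH YH p01 (m := e %/ 24)%N).
    move=> Z ZH; have cardZ : (e <= 8 * #|Z|)%N by have [] := hubH Z ZH.
    by have := Y_third Z ZH; move: cardZ; clear; lia.
  exact: cut_size_le tH YH largeH Y_third.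
rewrite !expectD; apply: lerD; first exact: expect_cherries.
have -> (x : R) : 4 * x = 2 * x + 2 * x by ring.
by apply: lerD; apply: bound; rewrite ?first_zone_sub ?subsetDl // => Z /thirds[].
Qed.

Lemma pancyclic_failure p : 0 <= p <= 1 ->
  (30 * 1024 * (n * n) <= e * e * e)%N -> (60 * 128 * (n * a) <= e * e)%N ->
  exists h M : nat, [/\ (h * e <= 8 * n)%N, (e * n <= 2304 * M)%N &
    1 - prob_union G p (@pancyclic n) <=
      n%:R ^+ 3 * p ^+ 2 + 4 * ((1 + (1 - p) ^+ M) ^+ h - 1)].
Proof.
move=> p01 e_cubed e_sqr.
have en : (e <= n)%N by have := mindeg_le_order G n0; move: mindegG; clear; lia.
have e_large : (30 * 1024 <= e)%N.
  apply: (factor_le_of_mul_le_sqr n0 en); rewrite -(leq_pmul2r n0) -mulnA (leq_trans e_cubed) //.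
  by rewrite leq_mul2l en orbT.
have [s [sT s_ge]] := exists_hub_parameter n0 en e_cubed e_sqr.
have [|P [H sysPH]] := exists_hub_system (adj_sym G) (adj_irr gG) e0 _ degG (s := s).
  by rewrite card_ord.
have hubs_n := card_hub_family (hub_system_hubs sysPH).
exists #|H|, (cut_size n e); split=> //.
  by apply: cut_size_ge; move: e_large en; clear; lia.
apply: (prob_not_pancyclic_le p01 _ sT (s_ge _ hubs_n) sysPH).
by move: e_large; clear; lia.
Qed.

End FailureBound.

(** * Upper bound on the threshold *)

Section ExponentialBounds.
Variable R : realType.
Implicit Types (x p q K A delta : R) (n : nat).
Local Open Scope ring_scope.
Local Open Scope classical_set_scope.

Lemma expR_sub1_le x : 0 <= x <= 2^-1 -> expR x - 1 <= 2 * x.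
Proof.
move=> /andP[x0 x_half]; have exp0 := expR_gt0 x; have := expR_ge1Dx (- x).
rewrite expRN => /(ler_wpM2l (ltW exp0)); rewrite mulfV ?lt0r_neq0 // => exp_le.
by nra.
Qed.

Lemma expRN_le_inv x : 0 < x -> expR (- x) <= x^-1.
Proof.
move=> x0; rewrite expRN lef_pV2 ?posrE ?expR_gt0 //.
by apply: le_trans (expR_ge1Dx x); rewrite lerDr.
Qed.

Lemma exprn_1D_le_expR q n : 0 <= q -> (1 + q) ^+ n <= expR (n%:R * q).
Proof.
move=> q0; rewrite expRM_natl; apply: lerXn2r (expR_ge1Dx q).
  by rewrite nnegrE addr_ge0.
by rewrite nnegrE expR_ge0.
Qed.

Lemma exprn_1B_le_expR p n : p <= 1 -> (1 - p) ^+ n <= expR (- (p * n%:R)).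
Proof.
move=> p1; rewrite -mulNr expRM_natr; apply: lerXn2r (expR_ge1Dx _).
  by rewrite nnegrE subr_ge0.
by rewrite nnegrE expR_ge0.
Qed.

Lemma exprn_1B_ge_expR p n : 0 <= p <= 2^-1 -> expR (- (2 * p * n%:R)) <= (1 - p) ^+ n.
Proof.
move=> /andP[p0 p_half]; have p1 : 0 <= 1 - p by lra.
rewrite -mulNr expRM_natr; apply: lerXn2r; rewrite ?nnegrE ?expR_ge0 //.
rewrite expRN -[_^-1]mul1r ler_pdivrMr ?expR_gt0 //.
apply: le_trans (ler_wpM2l p1 (expR_ge1Dx (2 * p))).
by nra.
Qed.

Lemma ln_nat_near (B : R) : \forall n \near \oo, B <= ln n%:R.
Proof.
near=> n; rewrite -[B]expRK ler_ln ?posrE ?expR_gt0 //; last first.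
  by apply: lt_le_trans (expR_gt0 B) _; near: n; exact: nbhs_infty_ger.
by near: n; exact: nbhs_infty_ger.
Unshelve. all: by end_near. Qed.

(* Either [delta] exceeds [exp (- A / K)], or the logarithm already exceeds [A / K]. *)
Lemma mul_ge_of_ln_le K A delta x : 0 < K -> 0 <= A -> 0 < delta ->
  K * ln delta^-1 <= x * delta -> A * expR (A / K) <= x -> A <= x * delta.
Proof.
move=> K0 A0 delta0 ln_le exp_le; have [A_le|/ltW A_ge] := leP A (K * ln delta^-1).
  exact: le_trans ln_le.
have delta_ge : expR (- (A / K)) <= delta.
  rewrite expRN -[leRHS]invrK lef_pV2 ?posrE ?expR_gt0 ?invr_gt0 //.
  by rewrite -[leLHS]lnK ?posrE ?invr_gt0 // ler_expR ler_pdivlMr // mulrC.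
have AE0 : 0 <= A * expR (A / K) by rewrite mulr_ge0 ?expR_ge0.
have := ler_pM AE0 (expR_ge0 _) exp_le delta_ge.
by rewrite -mulrA -expRD subrr expR0 mulr1.
Qed.

End ExponentialBounds.

Section DenseRegime.
Variable R : realType.
Implicit Types (n : nat) (c delta p y : R).
Local Open Scope ring_scope.
Local Open Scope classical_set_scope.

Lemma density_bounds n c delta : (0 < n)%N -> 0 < c ->
  c * (n%:R `^ (- (1 / 3)) : R) <= delta ->
  [/\ 0 < delta, c ^+ 3 <= delta ^+ 3 * n%:R &
      c ^+ 2 * expR (ln n%:R / 3) <= delta ^+ 2 * n%:R].
Proof.
move=> n0 c0; have nR : 0 < n%:R :> R by rewrite ltr0n.
rewrite /powR (negPf (lt0r_neq0 nR)).
set L := ln n%:R; have nE : n%:R = expR L :> R by rewrite lnK.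
set w := expR _ => cw_le; have w0 : 0 < w := expR_gt0 _.
have w3 : w ^+ 3 * n%:R = 1.
  by rewrite nE -expRM_natl -expRD -[RHS]expR0; congr expR; field.
have w2 : w ^+ 2 * n%:R = expR (L / 3).
  by rewrite nE -expRM_natl -expRD; congr expR; field.
have cw0 : 0 < c * w by rewrite mulr_gt0.
have delta0 : 0 < delta := lt_le_trans cw0 cw_le.
have pow_le k : (c * w) ^+ k * n%:R <= delta ^+ k * n%:R.
  by rewrite ler_wpM2r // lerXn2r // nnegrE ltW.
split=> //; first by have := pow_le 3%N; rewrite exprMn -mulrA w3 mulr1.
by have := pow_le 2%N; rewrite exprMn -mulrA w2.
Qed.

Lemma ln_inv_density_le n delta : (0 < n)%N -> 0 < delta -> 1 <= delta ^+ 3 * n%:R ->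
  ln delta^-1 <= ln n%:R / 3.
Proof.
move=> n0 delta0 /ln_ge0; have nR : 0 < n%:R :> R by rewrite ltr0n.
rewrite lnM ?posrE ?exprn_gt0 // lnXn // lnV ?posrE // -mulr_natr.
by lra.
Qed.

Lemma exists_core_degree n (G : {set {set 'I_n}}) delta : (0 < n)%N -> 0 < delta ->
  256 ^+ 3 <= delta ^+ 3 * n%:R -> delta * n%:R <= (mindeg G)%:R ->
  (alpha G)%:R <= (1000 * 1000)^-1 * delta ^+ 2 * n%:R ->
  exists e : nat, [/\ (0 < e)%N, (4 * e <= mindeg G)%N,
    (30 * 1024 * (n * n) <= e * e * e)%N, (60 * 128 * (n * alpha G) <= e * e)%N &
    delta * n%:R <= 8 * e%:R].
Proof.
move=> n0 delta0 delta_cubed mindeg_ge alpha_le_sqr; set D := mindeg G in mindeg_ge *.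
have nR : 0 < n%:R :> R by rewrite ltr0n.
have dn0 : 0 < delta * n%:R by rewrite mulr_gt0.
have delta1 : delta <= 1.
  rewrite -(ler_pM2r nR) mul1r; apply: le_trans mindeg_ge _.
  by rewrite ler_nat mindeg_le_order.
have dn_large : 256 ^+ 3 <= delta * n%:R.
  apply: le_trans delta_cubed _; rewrite ler_wpM2r ?(ltW nR) // exprS.
  by rewrite ler_piMr ?exprn_ile1 // ltW.
have D6 : (6 <= D)%N by rewrite -(ler_nat R); move: dn_large mindeg_ge; lra.
have dn8 : delta * n%:R <= 8 * (D %/ 4)%:R.
  by apply: le_trans mindeg_ge _; rewrite -natrM ler_nat; move: D6; clear; lia.
have e0 : 0 < (D %/ 4)%:R :> R by move: dn_large dn8; lra.
have pow_le k : (delta * n%:R) ^+ k <= (8 * (D %/ 4)%:R) ^+ k.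
  by rewrite lerXn2r // nnegrE ltW // mulr_gt0.
exists (D %/ 4)%N; split=> //; first by rewrite -(ltr0n R).
- by rewrite mulnC leq_divM.
- rewrite -(ler_nat R) !natrM; have := pow_le 3%N; set e : R := (D %/ 4)%:R.
  have -> : (delta * n%:R) ^+ 3 = delta ^+ 3 * n%:R * n%:R ^+ 2 by ring.
  have : 256 ^+ 3 * n%:R ^+ 2 <= delta ^+ 3 * n%:R * n%:R ^+ 2.
    by rewrite ler_wpM2r ?exprn_ge0 ?(ltW nR).
  have -> : (8 * e) ^+ 3 = 512 * (e * e * e) by ring.
  have : 0 <= n%:R * n%:R :> R by rewrite mulr_ge0 ?(ltW nR).
  by rewrite [n%:R ^+ 2]expr2; lra.
- rewrite -(ler_nat R) !natrM; have := pow_le 2%N; set e : R := (D %/ 4)%:R.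
  have := ler_wpM2l (ltW nR) alpha_le_sqr.
  have -> : n%:R * ((1000 * 1000)^-1 * delta ^+ 2 * n%:R) = (1000 * 1000)^-1 * (delta * n%:R) ^+ 2.
    by field.
  have -> : (8 * e) ^+ 2 = 64 * (e * e) by ring.
  have : 0 <= (delta * n%:R) ^+ 2 by rewrite exprn_ge0 // ltW.
  by lra.
Qed.

Lemma cherry_term_le n delta y : (1 < n)%N -> 0 < delta ->
  expR (ln n%:R / 3) <= delta ^+ 2 * n%:R -> 0 <= y <= ln n%:R ^+ 2 ->
  n%:R ^+ 3 * (y / (delta * n%:R ^+ 2)) ^+ 2 <= 243 * 120 / ln n%:R.
Proof.
move=> n1 delta0 exp_le /andP[y0 y_le]; set L := ln n%:R in exp_le y_le *.
have nR : 0 < n%:R :> R by rewrite ltr0n ltnW.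
have L0 : 0 < L by rewrite ln_gt0 // ltr1n.
have X0 : 0 < delta ^+ 2 * n%:R by rewrite mulr_gt0 // exprn_gt0.
have -> : n%:R ^+ 3 * (y / (delta * n%:R ^+ 2)) ^+ 2 = y ^+ 2 / (delta ^+ 2 * n%:R).
  by field; rewrite !lt0r_neq0.
rewrite ler_pdivrMr //; apply: le_trans (_ : (L ^+ 2) ^+ 2 <= _).
  by rewrite lerXn2r // nnegrE exprn_ge0 // ltW.
have L3 : 0 <= L / 3 by rewrite divr_ge0 // ltW.
have taylor : (L / 3) ^+ 5 / 120 <= delta ^+ 2 * n%:R.
  by apply: le_trans exp_le; apply: le_trans (expR_ge1Dxn 4 L3); rewrite lerDr ler01.
have -> : (L ^+ 2) ^+ 2 = 243 * 120 / L * ((L / 3) ^+ 5 / 120) by field; rewrite lt0r_neq0.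
by rewrite ler_wpM2l ?divr_ge0 ?mulr_ge0 ?ler0n ?(ltW L0).
Qed.

Lemma cut_term_le n (h e M : nat) delta p y : let K := 256 * 256 in
  0 < delta -> (0 < n)%N -> 0 <= p <= 1 -> p * (delta * n%:R ^+ 2) = y ->
  128 * K <= y -> K * ln delta^-1 <= y ->
  delta * n%:R <= 8 * e%:R -> (h * e <= 8 * n)%N -> (e * n <= 2304 * M)%N ->
  4 * ((1 + (1 - p) ^+ M) ^+ h - 1) <= 512 * K / y.
Proof.
move=> K delta0 n0 p01 pE y_large ln_le dn8; rewrite -(ler_nat R) -[(e * n <= _)%N](ler_nat R).
rewrite !natrM => he_le en_le; have [p0 p1] := andP p01.
have nR : 0 < n%:R :> R by rewrite ltr0n.
have K0 : 0 < K by rewrite mulr_gt0 ?ltr0n.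
have y0 : 0 < y by apply: lt_le_trans y_large; rewrite mulr_gt0 ?ltr0n.
set q := (1 - p) ^+ M; have q0 : 0 <= q by rewrite exprn_ge0 // subr_ge0.
have h_le : h%:R <= 64 / delta.
  rewrite ler_pdivlMr // -(ler_pM2r nR).
  by have := ler_wpM2l (ler0n R h) dn8; move: he_le; lra.
have pM_ge : 2 * (y / K) <= p * M%:R.
  have dnM : delta * n%:R ^+ 2 <= 8 * 2304 * M%:R.
    have : delta * n%:R * n%:R <= 8 * e%:R * n%:R by rewrite ler_wpM2r // ltW.
    by move: en_le; rewrite expr2; lra.
  have := ler_wpM2l p0 dnM; rewrite pE mulrA ler_pdivrMr // /K => y_le.
  have : 0 <= p * M%:R by rewrite mulr_ge0.
  by lra.
have hq_le : h%:R * q <= 64 * (K / y).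
  apply: le_trans (_ : 64 / delta * expR (- (p * M%:R)) <= _).
    by rewrite ler_pM // exprn_1B_le_expR.
  rewrite -mulrA ler_wpM2l // -[delta^-1]lnK ?posrE ?invr_gt0 // -expRD.
  apply: le_trans (_ : expR (- (y / K)) <= _); last first.
    by rewrite -[leRHS]invf_div expRN_le_inv // divr_gt0.
  rewrite ler_expR; have : ln delta^-1 <= y / K by rewrite ler_pdivlMr // mulrC.
  by move: pM_ge; lra.
have hq0 : 0 <= h%:R * q by rewrite mulr_ge0.
have hq_half : h%:R * q <= 2^-1.
  by apply: le_trans hq_le _; rewrite mulrA ler_pdivrMr //; move: y_large; lra.
have := expR_sub1_le (x := h%:R * q); rewrite hq0 hq_half => /(_ isT).
have := exprn_1D_le_expR h q0; rewrite -[512 * K / y]mulrA.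
by move: hq_le; lra.
Qed.

Definition dense_regime n (G : {set {set 'I_n}}) delta p : Prop :=
  [/\ 256 * (n%:R `^ (- (1 / 3)) : R) <= delta,
      delta * n%:R <= (mindeg G)%:R,
      ((alpha G)%:R : R) <= (1000 * 1000)^-1 * delta ^+ 2 * n%:R &
      256 * 256 * ln delta^-1 / (delta * n%:R ^+ 2) <= p].

(* The random edges are thinned down to density [y / (delta n^2)] with [y <= (ln n)^2], which
   makes two adjacent random edges unlikely. *)
Lemma pancyclic_bound n (G : {set {set 'I_n}}) delta p y : let K := 256 * 256 in
  (1 < n)%N -> is_graph G -> p <= 1 -> dense_regime G delta p ->
  128 * K <= y -> K * ln delta^-1 <= y -> y <= p * (delta * n%:R ^+ 2) -> y <= ln n%:R ^+ 2 ->
  1 - prob_union G p (@pancyclic n) <= 243 * 120 / ln n%:R + 512 * K / y.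
Proof.
move=> K n1 gG p1 [delta_ge mindeg_ge alpha_le_sqr _] y_large ln_le y_p y_ln.
have n0 := ltnW n1; have nR : 0 < n%:R :> R by rewrite ltr0n.
have [delta0 delta_cubed delta_sqr] := density_bounds n0 (ltr0n R 256) delta_ge.
have X0 : 0 < delta * n%:R ^+ 2 by rewrite mulr_gt0 // exprn_gt0.
have y0 : 0 <= y by apply: le_trans y_large; rewrite !mulr_ge0 ?ler0n.
have [e [e0 e_mindeg e_cubed e_sqr dn8]] :=
  exists_core_degree n0 delta0 delta_cubed mindeg_ge alpha_le_sqr.
pose p' := y / (delta * n%:R ^+ 2).
have p'p : p' <= p by rewrite ler_pdivrMr.
have p'01 : 0 <= p' <= 1 by rewrite divr_ge0 ?(le_trans p'p) // ltW.
have [h [M [he_le en_le failure]]] :=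
  pancyclic_failure gG n0 e0 e_mindeg (leqnn _) p'01 e_cubed e_sqr.
apply: le_trans (_ : 1 - prob_union G p' (@pancyclic n) <= _).
  rewrite lerD2l lerN2; have [p'0 _] := andP p'01.
  by apply: prob_union_monotone => // E S ES; exact: pancyclicS.
apply: le_trans failure _; apply: lerD.
  apply: cherry_term_le => //; last by rewrite y0.
  apply: le_trans delta_sqr; rewrite ler_peMl ?expR_ge0 //.
  by rewrite exprn_ege1 // ler1n.
apply: (cut_term_le delta0 n0 p'01 _ y_large ln_le dn8 he_le en_le).
by rewrite divfK // lt0r_neq0.
Qed.

Lemma exists_thinned_density n (G : {set {set 'I_n}}) delta p A : let K := 256 * 256 in
  (1 < n)%N -> dense_regime G delta p -> 0 <= A -> A <= ln n%:R -> K <= ln n%:R ->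
  A * expR (A / K) <= p * n%:R ^+ 2 ->
  exists y, [/\ A <= y, K * ln delta^-1 <= y, y <= p * (delta * n%:R ^+ 2) & y <= ln n%:R ^+ 2].
Proof.
move=> K n1 [delta_ge _ _ p_ge] A0 lnA lnK pn_ge.
have n0 := ltnW n1; have nR : 0 < n%:R :> R by rewrite ltr0n.
have K0 : 0 < K by rewrite mulr_gt0 ?ltr0n.
have K1 : 1 <= K by rewrite /K -natrM ler1n.
have ln1 : 1 <= ln n%:R :> R := le_trans K1 lnK.
have ln0 : 0 < ln n%:R :> R := lt_le_trans ltr01 ln1.
have [delta0 delta_cubed _] := density_bounds n0 (ltr0n R 256) delta_ge.
have delta1 : 1 <= delta ^+ 3 * n%:R by apply: le_trans delta_cubed; rewrite exprn_ege1 ?ler1n.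
have ln_delta : K * ln delta^-1 <= ln n%:R ^+ 2.
  apply: le_trans (ler_wpM2l (ltW K0) (ln_inv_density_le n0 delta0 delta1)) _.
  rewrite expr2; apply: ler_pM => //; first exact: ltW.
    by rewrite divr_ge0 // ltW.
  by rewrite ler_pdivrMr // ler_peMr ?ler1n // ltW.
have A_sqr : A <= ln n%:R ^+ 2.
  by apply: le_trans lnA _; rewrite expr2 ler_peMl // ltW.
rewrite ler_pdivrMr ?mulr_gt0 ?exprn_gt0 // in p_ge.
have A_p : A <= p * (delta * n%:R ^+ 2).
  rewrite [delta * _]mulrC mulrA; apply: mul_ge_of_ln_le K0 A0 delta0 _ pn_ge.
  by rewrite -mulrA [_ * delta]mulrC.
exists (Num.min (p * (delta * n%:R ^+ 2)) (ln n%:R ^+ 2)).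
by split; rewrite ?le_min ?ge_min ?lexx ?orbT ?A_p ?p_ge.
Qed.

Lemma pancyclic_aas (delta p : nat -> R) (G : forall n : nat, {set {set 'I_n}}) :
  (forall n, is_graph (G n)) -> (forall n, 0 <= p n <= 1) ->
  (\forall n \near \oo, dense_regime (G n) (delta n) (p n)) ->
  (fun n => p n * n%:R ^+ 2) @ \oo --> +oo ->
  (fun n => prob_union (G n) (p n) (@pancyclic n)) @ \oo --> (1 : R).
Proof.
move=> gG p01 hyp pn2_infty; apply/cvgrPdist_le => eps eps0.
pose K : R := 256 * 256; have K0 : 0 < K by rewrite mulr_gt0 ?ltr0n.
pose A : R := Num.max (128 * K) (1024 * K / eps).
have A_ge : 128 * K <= A by rewrite le_max lexx.
have A_eps : 1024 * K / eps <= A by rewrite le_max lexx orbT.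
have A0 : 0 < A by apply: lt_le_trans A_ge; rewrite mulr_gt0 ?ltr0n.
near=> n.
have dense_n : dense_regime (G n) (delta n) (p n) by near: n.
have n1 : (1 < n)%N by near: n; exact: nbhs_infty_gt.
have [lnA lnK ln_eps] : [/\ A <= ln n%:R, K <= ln n%:R & 2 * (243 * 120) / eps <= ln n%:R].
  by split; near: n; exact: ln_nat_near.
have pn_ge : A * expR (A / K) <= p n * n%:R ^+ 2 by near: n; exact: cvgry_ge.
have [y [Ay ln_y y_p y_ln]] := exists_thinned_density n1 dense_n (ltW A0) lnA lnK pn_ge.
have := prob_union_le1 (G n) (@pancyclic n) (p01 n); rewrite -subr_ge0 => /ger0_norm->.
have [_ p1] := andP (p01 n).
apply: le_trans (pancyclic_bound n1 (gG n) p1 dense_n (le_trans A_ge Ay) ln_y y_p y_ln) _.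
have y0 : 0 < y := lt_le_trans A0 Ay.
have ln0 : 0 < ln n%:R :> R := lt_le_trans A0 lnA.
have cherry_small : 243 * 120 / ln n%:R <= eps / 2.
  rewrite (ler_pdivrMr _ _ ln0); rewrite (ler_pdivrMr _ _ eps0) in ln_eps.
  by move: ln_eps; lra.
have cut_small : 512 * K / y <= eps / 2.
  rewrite (ler_pdivrMr _ _ y0); have := le_trans A_eps Ay.
  by rewrite (ler_pdivrMr _ _ eps0); lra.
by rewrite [leRHS]splitr; exact: lerD.
Unshelve. all: by end_near. Qed.

End DenseRegime.

(** * Disjoint cliques *)

Section ClosedVertexSets.
Variable n : nat.
Implicit Types (E : {set {set 'I_n}}) (C : {set 'I_n}) (i x y : 'I_n).

Lemma iter_ordS i m : iter m (@ordS n) i = (i + m) %% n :> nat.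
Proof.
elim: m => [|m IHm]; first by rewrite addn0 modn_small.
by rewrite iterS /= IHm addnS -addn1 modnDml addn1.
Qed.

Lemma not_hamiltonian_of_closed E C : C != set0 -> C != [set: 'I_n] ->
  (forall x y, adj E x y -> x \in C -> y \in C) -> ~~ hamiltonian E.
Proof.
move=> /set0Pn[x xC]; rewrite -subTset => /subsetPn[y _ yC] closedC.
apply/negP=> /andP[_ /existsP[f /andP[/injectiveP f_inj /forallP f_adj]]].
have f_surj z : exists i, f i = z by have [f' _ fK] := injF_bij f_inj; exists (f' z).
have [[i fi] [j fj]] := (f_surj x, f_surj y).
have orbit_in m : f (iter m (@ordS n) i) \in C.
  by elim: m => [|m IHm]; [rewrite /= fi | exact: closedC (f_adj _) IHm].
have := orbit_in (j + (n - i)); rewrite (_ : iter _ _ i = j) ?fj ?(negPf yC) //.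
apply: val_inj; rewrite /= iter_ordS; have ltin := ltn_ord i.
have -> : i + (j + (n - i)) = j + n by move: ltin; clear; lia.
by rewrite modnDr modn_small.
Qed.

Definition boundary C : {set {set 'I_n}} := edges_between C (~: C).

Lemma disjoint_setC C : [disjoint C & ~: C].
Proof. by rewrite disjoints_subset setCK. Qed.

Lemma boundary_pairs C : boundary C \subset pairs n.
Proof. exact/edges_between_pairs/disjoint_setC. Qed.

Lemma card_boundary C : #|boundary C| <= #|C| * n.
Proof.
rewrite card_edges_between ?disjoint_setC // leq_mul2l.
by rewrite -[X in _ <= X]card_ord max_card orbT.
Qed.

Lemma card_boundaryI C C' : [disjoint C & C'] ->
  #|boundary C :&: boundary C'| <= #|C| * #|C'|.
Proof.
move=> disjC; rewrite -card_edges_between //; apply/subset_leq_card/subsetP=> e.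
case/setIP=> /edges_betweenP[x [y [xC _ ->]]] /edges_betweenP[x' [y' [x'C' _ exy]]].
apply/edges_betweenP; exists x, y; split=> //.
have : x' \in [set x; y] by rewrite exy set21.
rewrite !inE => /orP[] /eqP x'E; last by rewrite -x'E.
by rewrite x'E (disjointFr disjC xC) in x'C'.
Qed.

End ClosedVertexSets.

Section ClassGraphs.
Variables (n k : nat).
Implicit Types (u v : 'I_n) (i j : nat) (E : {set {set 'I_n}}).

Definition class j : {set 'I_n} := [set u : 'I_n | u %% k == j].

Definition class_graph : {set {set 'I_n}} :=
  [set e in pairs n | [forall u in e, forall v in e, u %% k == v %% k]].

Lemma class_graph_is_graph : is_graph class_graph.
Proof. by apply/subsetP=> e; rewrite inE => /andP[]. Qed.

Lemma adj_class_graph u v : adj class_graph u v = (u != v) && (u %% k == v %% k).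
Proof.
rewrite /adj !inE cards2; case: (u != v) => //=.
apply/forall_inP/idP => [same|/eqP uv x].
  by have /forall_inP/(_ v) := same u (set21 _ _); apply; rewrite set22.
by rewrite !inE => /orP[] /eqP->; apply/forall_inP=> y; rewrite !inE => /orP[] /eqP->; rewrite ?uv.
Qed.

Lemma deg_class_graph u : deg class_graph u = #|class (u %% k)|.-1.
Proof.
rewrite (cardsD1 u (class _)) inE eqxx; apply: eq_card => v.
by rewrite !inE adj_class_graph (eq_sym v) (eq_sym (v %% k)).
Qed.

Lemma disjoint_classes i j : i != j -> [disjoint class i & class j].
Proof.
move=> ij; rewrite -setI_eq0; apply/eqP/setP=> u; rewrite !inE; apply/negP.
by case/andP=> /eqP-> /eqP ji; rewrite ji eqxx in ij.
Qed.

Hypothesis k0 : 0 < k.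

Lemma card_class_le j : #|class j| <= (n %/ k).+1.
Proof.
pose f u : 'I_(n %/ k).+1 := inord (u %/ k).
rewrite -[X in _ <= X]card_ord -(@card_in_imset _ _ f) ?max_card // => u v.
rewrite !inE => /eqP uj /eqP vj /(congr1 val) /=.
have quot_lt (w : 'I_n) : w %/ k < (n %/ k).+1 by rewrite ltnS leq_div2r //; exact: ltnW.
rewrite !inordK // => uv.
by apply: val_inj => /=; rewrite (divn_eq u k) (divn_eq v k) uv uj vj.
Qed.

Lemma card_class_ge j : j < k -> n %/ k <= #|class j|.
Proof.
move=> jk; have lt_n (i : 'I_(n %/ k)) : i * k + j < n.
  have : i.+1 * k <= n %/ k * k by rewrite leq_mul2r ltn_ord orbT.
  by have := leq_divM n k; move: jk; rewrite mulSn; clear; lia.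
pose f (i : 'I_(n %/ k)) : 'I_n := Ordinal (lt_n i).
have f_inj : injective f.
  by move=> i i' /(congr1 val) /= /eqP; rewrite eqn_add2r eqn_pmul2r // => /eqP/val_inj.
rewrite -[X in X <= _]card_ord -(card_imset _ f_inj); apply/subset_leq_card/subsetP=> u.
by case/imsetP=> i _ ->; rewrite inE /= modnMDl modn_small.
Qed.

Lemma mindeg_class_graph_ge : (n %/ k).-1 <= mindeg class_graph.
Proof.
apply: leq_mindeg => [|v]; first exact: leq_trans (leq_pred _) (leq_div _ _).
by rewrite deg_class_graph -!subn1 leq_sub2r // card_class_ge // ltn_pmod.
Qed.

Lemma alpha_class_graph_le : alpha class_graph <= k.
Proof.
apply/bigmax_leqP=> S /forall_inP indepS; pose f u : 'I_k := Ordinal (ltn_pmod u k0).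
rewrite -[X in _ <= X]card_ord -(@card_in_imset _ _ f) ?max_card // => u v uS vS.
move=> /(congr1 val) /= uv; apply: contraTeq isT => nuv.
by have /forall_inP/(_ v vS) := indepS u uS; rewrite adj_class_graph nuv uv eqxx.
Qed.

Lemma not_hamiltonian_isolated_class E j : j < k -> 1 < k -> k <= n ->
  [disjoint boundary (class j) & E] -> ~~ hamiltonian (class_graph :|: E).
Proof.
move=> jk k1 kn isolated.
have class_neq0 i : i < k -> class i != set0.
  move=> ik; have i_n := leq_trans ik kn.
  by apply/set0Pn; exists (Ordinal i_n); rewrite inE /= modn_small.
have [i [ik ij]] : exists i, i < k /\ i != j.
  by exists (j == 0); split; [case: (j == 0) => //; exact: ltnW | case: j {jk isolated}].
apply: (@not_hamiltonian_of_closed _ _ (class j)); first exact: class_neq0.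
  apply: contraNneq (class_neq0 i ik) => jT.
  by have /disjoint_setI0 := disjoint_classes ij; rewrite jT setIT => ->.
move=> x y; rewrite adjU => /orP[|xy xj].
  by rewrite adj_class_graph !inE => /andP[_ /eqP->].
apply: contraT => yj; have : [set x; y] \in boundary (class j).
  by apply/edges_betweenP; exists x, y; rewrite in_setC.
by move/(disjointFr isolated); move: xy; rewrite /adj => ->.
Qed.

End ClassGraphs.

Section SecondMoment.
Variables (R : realType) (n k : nat) (S : 'I_k -> {set {set 'I_n}}) (p : R).
Hypotheses (p01 : (0 <= p <= 1)%R) (S_pairs : forall j, S j \subset pairs n).
Implicit Types (i j : 'I_k) (E : {set {set 'I_n}}) (b : {set {set 'I_n}} -> bool) (c : R).
Local Open Scope ring_scope.
Local Notation expect_gnp := (expect p (enum (pairs n))).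

Definition avoided E : R := \sum_j [disjoint S j & E]%:R.

Definition mean_avoided : R := \sum_j (1 - p) ^+ #|S j|.

Lemma expect_avoided : expect_gnp avoided = mean_avoided.
Proof. by rewrite expect_sum; apply: eq_bigr => j _; exact: expect_gnp_disjoint. Qed.

Lemma expect_avoided_sqr :
  expect_gnp (fun E => avoided E ^+ 2) = \sum_i \sum_j (1 - p) ^+ #|S i :|: S j|.
Proof.
rewrite (@eq_expect _ _ _ _ _ (fun E => \sum_i \sum_j [disjoint S i :|: S j & E]%:R)).
  rewrite expect_sum; apply: eq_bigr => i _; rewrite expect_sum; apply: eq_bigr => j _.
  by apply: expect_gnp_disjoint; rewrite subUset !S_pairs.
move=> E _; rewrite expr2 big_distrlr; apply: eq_bigr => i _; apply: eq_bigr => j _ /=.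
by rewrite -natrM mulnb -!setI_eq0 setIUl setU_eq0.
Qed.

Lemma expect_avoided_sqr_le c : 0 <= c ->
  (forall i j, i != j ->
     (1 - p) ^+ #|S i :|: S j| <= (1 + c) * ((1 - p) ^+ #|S i| * (1 - p) ^+ #|S j|)) ->
  expect_gnp (fun E => avoided E ^+ 2) <= mean_avoided + (1 + c) * mean_avoided ^+ 2.
Proof.
move=> c0 correlation; have [_ p1] := andP p01.
have p'0 m : 0 <= (1 - p) ^+ m by rewrite exprn_ge0 // subr_ge0.
rewrite expect_avoided_sqr expr2 [X in (1 + c) * X]big_distrlr big_distrr -big_split /=.
apply: ler_sum => i _; rewrite big_distrr (bigD1 i) //= setUid lerD2l.
rewrite [leRHS](bigD1 i) //= ler_wpDl ?mulr_ge0 ?addr_ge0 //.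
by apply: ler_sum => j ji; apply: correlation; rewrite eq_sym.
Qed.

Lemma expect_avoiding_none_le c b : 0 <= c -> 0 < mean_avoided ->
  (forall i j, i != j ->
     (1 - p) ^+ #|S i :|: S j| <= (1 + c) * ((1 - p) ^+ #|S i| * (1 - p) ^+ #|S j|)) ->
  (forall E, b E -> avoided E = 0) ->
  expect_gnp (fun E => (b E)%:R) <= mean_avoided^-1 + c.
Proof.
move=> c0 mean0 correlation b_none; set m := mean_avoided in mean0 *.
have variance : expect_gnp (fun E => (avoided E - m) ^+ 2) =
    expect_gnp (fun E => avoided E ^+ 2) - m ^+ 2.
  rewrite (@eq_expect _ _ _ _ _ (fun E => avoided E ^+ 2 + ((- (2 * m)) * avoided E + m ^+ 2))).
    by rewrite !expectD expectZ expect_cst expect_avoided -/m; ring.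
  by move=> E _; ring.
have chebyshev : m ^+ 2 * expect_gnp (fun E => (b E)%:R) <=
    expect_gnp (fun E => (avoided E - m) ^+ 2).
  rewrite -expectZ; apply: le_expect => // E _.
  have [/b_none->|_] := boolP (b E); last by rewrite mulr0 sqr_ge0.
  by rewrite mulr1 sub0r sqrrN.
rewrite variance in chebyshev; have := expect_avoided_sqr_le c0 correlation; rewrite -/m => sqr_le.
have m2 : 0 < m ^+ 2 by rewrite exprn_gt0.
rewrite -(ler_pM2l m2); apply: le_trans chebyshev _.
have -> : m ^+ 2 * (m^-1 + c) = m + c * m ^+ 2 by field; rewrite lt0r_neq0.
by move: sqr_le; lra.
Qed.

End SecondMoment.

Section ClassGraphProbability.
Variable R : realType.
Implicit Types (n k b m : nat) (p : R).
Local Open Scope ring_scope.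

Lemma one_sub_muln_le_exprn p m : 0 <= p <= 1 -> 1 - p * m%:R <= (1 - p) ^+ m.
Proof.
move=> /andP[p0 p1]; elim: m => [|m IHm]; first by rewrite mulr0 subr0 expr0.
have p'0 : 0 <= 1 - p by rewrite subr_ge0.
have pm0 : 0 <= p * m%:R by rewrite mulr_ge0.
by rewrite exprS -natr1; have := ler_wpM2l p'0 IHm; nra.
Qed.

Lemma ge1_mul_of_ge_1B (c x : R) : 0 <= c <= 2^-1 -> 1 - c <= x -> 1 <= (1 + 2 * c) * x.
Proof. by case/andP=> c0 c_half cx; nra. Qed.

Lemma prob_hamiltonian_class_graph_le n k p : 0 <= p <= 1 -> (1 < k)%N -> (k <= n)%N ->
  prob_union (class_graph n k) p (@hamiltonian n) <= 1 - (1 - p) ^+ #|boundary (class n k 0)|.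
Proof.
move=> p01 k1 kn; have k0 := ltnW k1.
rewrite -(expect_gnp_disjoint p (boundary_pairs _)) prob_unionE.
rewrite -[X in X - _](expect_cst p (enum (pairs n)) 1) -expectB.
apply: le_expect => // E _; have [isolated|_] := boolP [disjoint _ & _].
  by rewrite (negPf (not_hamiltonian_isolated_class k0 k0 k1 kn isolated)) subrr.
by rewrite subr0; case: (hamiltonian _).
Qed.

Lemma boundary_correlation n k b p i j : 0 <= p <= 1 -> p * (b * b)%:R <= 2^-1 ->
  (forall j, #|class n k j| <= b)%N -> i != j ->
  (1 - p) ^+ #|boundary (class n k i) :|: boundary (class n k j)| <=
    (1 + 2 * (p * (b * b)%:R)) *
      ((1 - p) ^+ #|boundary (class n k i)| * (1 - p) ^+ #|boundary (class n k j)|).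
Proof.
move=> p01 pb_half class_b ij; have [p0 p1] := andP p01.
have p'0 : 0 <= 1 - p by rewrite subr_ge0.
have p'1 : 1 - p <= 1 by rewrite lerBlDr lerDl.
set c := p * (b * b)%:R in pb_half *; have c0 : 0 <= c by rewrite mulr_ge0.
rewrite -exprD -cardsUI exprD; set u := (1 - p) ^+ #|_ :|: _|.
have u0 : 0 <= u by exact: exprn_ge0.
set I := boundary _ :&: boundary _.
have Ib : (#|I| <= b * b)%N.
  by apply: leq_trans (card_boundaryI (disjoint_classes _ _ ij)) _; exact: leq_mul.
have I_ge : 1 - c <= (1 - p) ^+ #|I|.
  by apply: le_trans (one_sub_muln_le_exprn _ p01) _; exact: ler_wiXn2l.
by rewrite mulrCA; apply: ler_peMr => //; apply: ge1_mul_of_ge_1B I_ge; rewrite c0.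
Qed.

Lemma prob_hamiltonian_second_moment n k b p :
  0 <= p <= 1 -> (1 < k)%N -> (k <= n)%N -> (0 < b)%N ->
  (forall j, #|class n k j| <= b)%N -> p * (b * b)%:R <= 2^-1 ->
  prob_union (class_graph n k) p (@hamiltonian n) <=
    (k%:R * expR (- (2 * p * (b * n)%:R)))^-1 + 2 * (p * (b * b)%:R).
Proof.
move=> p01 k1 kn b0 class_b pb_half; have k0 := ltnW k1; have [p0 p1] := andP p01.
pose S (j : 'I_k) := boundary (class n k j).
have p_half : 0 <= p <= 2^-1.
  rewrite p0; apply: le_trans pb_half; rewrite -[leLHS]mulr1 ler_wpM2l // ler1n muln_gt0.
  by rewrite b0.
have mean_ge : k%:R * expR (- (2 * p * (b * n)%:R)) <= mean_avoided S p.
  rewrite -[k in k%:R]card_ord mulr_natl -sumr_const; apply: ler_sum => j _.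
  apply: le_trans (exprn_1B_ge_expR _ p_half) _.
  rewrite ler_wiXn2l ?subr_ge0 ?lerBlDr ?lerDl //.
  by apply: leq_trans (card_boundary _) _; rewrite leq_mul2r class_b orbT.
have bound0 : 0 < k%:R * expR (- (2 * p * (b * n)%:R)) by rewrite mulr_gt0 ?expR_gt0 ?ltr0n.
have mean0 : 0 < mean_avoided S p := lt_le_trans bound0 mean_ge.
rewrite prob_unionE; apply: le_trans (expect_avoiding_none_le (S := S) (c := 2 * (p * (b * b)%:R))
  p01 (fun j => boundary_pairs _) _ mean0 _ _) _.
- by rewrite !mulr_ge0.
- by move=> i j ij; apply: boundary_correlation.
- move=> E ham; apply: big1 => j _; have [isolated|//] := boolP [disjoint _ & _].
  by have := not_hamiltonian_isolated_class k0 (ltn_ord j) k1 kn isolated; rewrite ham.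
by rewrite lerD2r lef_pV2 ?posrE.
Qed.

End ClassGraphProbability.

Section TwoCliques.
Variable R : realType.
Implicit Type n : nat.

Lemma mindeg_two_cliques n : 2 <= n -> mindeg (class_graph n 2) = n./2 - 1.
Proof.
move=> n2; rewrite -divn2; apply/eqP; rewrite eqn_leq subn1 mindeg_class_graph_ge // andbT.
have [j j2 small] : exists2 j, j < 2 & #|class n 2 j| <= n %/ 2.
  have sum_classes : #|class n 2 0| + #|class n 2 1| = n.
    have -> : class n 2 1 = ~: class n 2 0 by apply/setP=> u; rewrite !inE !modn2; case: (odd u).
    by rewrite cardsC card_ord.
  have [small|large] := leqP #|class n 2 0| (n %/ 2); first by exists 0.
  by exists 1 => //; move: large sum_classes; clear; lia.
have /card_gt0P[u] : 0 < #|class n 2 j|.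
  by apply: leq_trans (card_class_ge n (ltn0Sn 1) j2); rewrite divn_gt0.
rewrite inE => /eqP uj; apply: leq_trans (mindeg_le _ u) _.
by rewrite deg_class_graph uj -!subn1 leq_sub2r.
Qed.

Lemma alpha_two_cliques n : 2 <= n -> alpha (class_graph n 2) = 2.
Proof.
move=> n2; apply/eqP; rewrite eqn_leq alpha_class_graph_le //=.
pose x : 'I_n := Ordinal (ltnW n2); pose y : 'I_n := Ordinal n2.
have card_xy : #|[set x; y]| = 2 by rewrite cards2.
rewrite -[X in X <= _]card_xy.
apply: (@leq_bigmax_cond _ (independent (class_graph n 2)) (fun S : {set 'I_n} => #|S|)).
apply/forall_inP=> u; rewrite !inE => /orP[] /eqP->; apply/forall_inP=> v;
  by rewrite !inE => /orP[] /eqP->; rewrite adj_class_graph ?eqxx ?andbF.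
Qed.

Local Open Scope ring_scope.
Local Open Scope classical_set_scope.

Lemma hamiltonian_two_cliques (p : nat -> R) : (forall n, 0 <= p n <= 1) ->
  (fun n => prob_union (class_graph n 2) (p n) (@hamiltonian n)) @ \oo --> (1 : R) ->
  (fun n => p n * n%:R ^+ 2) @ \oo --> +oo.
Proof.
move=> p01 /cvgrPdist_lt prob_cvg; apply/cvgryPge => A.
have near1 := prob_cvg (expR (- (2 * A))) (expR_gt0 _).
near=> n.
have n2 : (2 <= n)%N by near: n; exact: nbhs_infty_ge.
have An : 2 * A <= n%:R by near: n; exact: nbhs_infty_ger.
have prob_near1 : `|1 - prob_union (class_graph n 2) (p n) (@hamiltonian n)| < expR (- (2 * A)).
  by near: n.
rewrite leNgt; apply/negP => pA; have [p0 _] := andP (p01 n).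
have n1 : 1 <= n%:R :> R by rewrite ler1n ltnW.
have n_sqr : n%:R <= n%:R ^+ 2 :> R by rewrite expr2 ler_peMl // (le_trans ler01).
have p_half : 0 <= p n <= 2^-1.
  rewrite p0 -(ler_pM2r (lt_le_trans ltr01 (le_trans n1 n_sqr))).
  by apply: le_trans (ltW pA) _; move: An n_sqr; lra.
have boundary_le : (#|boundary (class n 2 0)|%:R : R) <= n%:R ^+ 2.
  rewrite expr2 -natrM ler_nat; apply: leq_trans (card_boundary _) _.
  by rewrite leq_mul2r -[X in (_ <= X)%N]card_ord max_card orbT.
have isolated_ge : expR (- (2 * A)) <= (1 - p n) ^+ #|boundary (class n 2 0)|.
  apply: le_trans (exprn_1B_ge_expR _ p_half); rewrite ler_expR lerN2 -mulrA ler_pM2l //.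
  by apply: le_trans (ltW pA); rewrite ler_wpM2l.
have := prob_hamiltonian_class_graph_le (p01 n) (isT : (1 < 2)%N) n2.
rewrite lerBrDr addrC -lerBrDr => /(le_trans isolated_ge) fail_ge.
by have := le_lt_trans fail_ge (le_lt_trans (ler_norm _) prob_near1); rewrite ltxx.
Unshelve. all: by end_near. Qed.

End TwoCliques.

Section SmallCliques.
Variables (R : realType) (n : nat) (d : R).
Local Open Scope ring_scope.
Local Notation x := (d * n%:R).

Definition clique_order (y : R) : nat := (Num.truncn y).+2.

Definition clique_count : nat := (n %/ clique_order x)%N.

Definition clique_regime : Prop := [/\ 0 < d, 20 <= x & 20 <= d^-1].

Hypothesis regime : clique_regime.
Local Notation q := (clique_order x).
Local Notation k := clique_count.

Let d0 : 0 < d. Proof. by case: regime. Qed.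
Let x20 : 20 <= x. Proof. by case: regime. Qed.
Let x0 : 0 < x. Proof. exact: lt_le_trans x20. Qed.
Let nE : n%:R = x * d^-1. Proof. by rewrite mulrAC divff ?mul1r // lt0r_neq0. Qed.

Lemma clique_order_gt : x + 1 < q%:R.
Proof.
by have /andP[_ ?] := truncn_itv (ltW x0); rewrite /clique_order -natr1 ltrD2r.
Qed.

Lemma clique_order_le : q%:R <= x * (11 / 10).
Proof.
have /andP[trunc_le _] := truncn_itv (ltW x0).
by rewrite /clique_order -addn2 natrD; move: x20 trunc_le; lra.
Qed.

Lemma clique_count_le : k%:R <= d^-1.
Proof.
rewrite -(ler_pM2l x0) -nE; apply: le_trans (_ : k%:R * q%:R <= _).
  by rewrite mulrC ler_wpM2l // ltW // (le_lt_trans _ clique_order_gt) // lerDl ler01.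
by rewrite -natrM ler_nat leq_divM.
Qed.

Lemma inv_density_le_clique_count : d^-1 <= k%:R * (12 / 10).
Proof.
have [_ _ t20] := regime.
have n_lt : n%:R < (k%:R + 1) * q%:R :> R by rewrite natr1 -natrM ltr_nat ltn_ceil.
have := lt_le_trans n_lt (ler_wpM2l (addr_ge0 (ler0n R k) ler01) clique_order_le).
by rewrite [ltLHS]nE mulrCA ltr_pM2l //; move: t20; lra.
Qed.

Lemma clique_count_gt1 : (1 < k)%N.
Proof.
have [_ _ t20] := regime; have := inv_density_le_clique_count.
by rewrite -(ltr_nat R); move: t20; lra.
Qed.

Let k0 : (0 < k)%N. Proof. exact: ltnW clique_count_gt1. Qed.

Lemma clique_order_le_quotient : (q <= n %/ k)%N.
Proof. by rewrite leq_divRL // mulnC leq_divM. Qed.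

Lemma quotient_clique_count_le : ((n %/ k).+1)%:R <= 3 * x.
Proof.
have xk : x * d^-1 <= x * (k%:R * (12 / 10)).
  by rewrite ler_wpM2l ?inv_density_le_clique_count // ltW.
have : (n %/ k)%:R * k%:R <= x * (k%:R * (12 / 10)).
  by apply: le_trans xk; rewrite -nE -natrM ler_nat leq_divM.
rewrite mulrCA mulrC ler_pM2l ?ltr0n // => quot_le.
by rewrite -natr1; move: x20 quot_le; lra.
Qed.

Lemma density_le_mindeg_cliques : x <= (mindeg (class_graph n k))%:R.
Proof.
apply: le_trans (_ : (n %/ k).-1%:R <= _); last by rewrite ler_nat mindeg_class_graph_ge.
apply: le_trans (_ : q.-1%:R <= _); last first.
  by rewrite ler_nat -!subn1 leq_sub2r ?clique_order_le_quotient.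
by have := clique_order_gt; rewrite /clique_order -[ltRHS]natr1 ltrD2r => /ltW.
Qed.

Lemma alpha_cliques_le (c : R) : 0 < c -> c ^+ 3 <= d ^+ 3 * n%:R ->
  (alpha (class_graph n k))%:R <= c ^- 3 * d ^+ 2 * n%:R.
Proof.
move=> c0 cubed; apply: le_trans (_ : k%:R <= _); first by rewrite ler_nat alpha_class_graph_le.
apply: le_trans clique_count_le _; have c3 : 0 < c ^+ 3 by rewrite exprn_gt0.
rewrite -mulrA mulrC ler_pdivlMr // ler_pdivrMl //; apply: le_trans cubed _.
by rewrite exprS -mulrA.
Qed.

(* With [t = d^(-1/2)], an isolated clique appears about [k / t >= t / 3] times on average. *)
Lemma prob_hamiltonian_cliques_le (p : R) : 0 <= p <= 1 ->
  p <= 12^-1 * ln d^-1 / (d * n%:R ^+ 2) -> 3 <= Num.sqrt d^-1 ->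
  prob_union (class_graph n k) p (@hamiltonian n) <= 6 / Num.sqrt d^-1.
Proof.
move=> p01 p_le; set t := Num.sqrt d^-1 => t3; have [p0 _] := andP p01.
have t0 : 0 < t by apply: lt_le_trans t3.
have t_sqr : t ^+ 2 = d^-1 by rewrite sqr_sqrtr // invr_ge0 ltW.
have nR : 0 < n%:R :> R by have := x0; rewrite pmulr_rgt0.
have ln_t : ln d^-1 = 2 * ln t by rewrite -t_sqr lnXn // mulr_natl.
have ln_le : ln t <= t by exact/ltW/ln_sublinear.
set b := (n %/ k).+1; have b_le : b%:R <= 3 * x := quotient_clique_count_le.
have pX : p * (x * n%:R) <= ln t / 6.
  move: p_le; rewrite ler_pdivlMr ?mulr_gt0 ?exprn_gt0 // ln_t expr2 [d * _]mulrA.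
  by move=> /le_trans; apply; lra.
have pb_sqr : p * (b * b)%:R <= 3 / 2 / t.
  apply: le_trans (_ : p * (3 * x * (3 * x)) <= _); first by rewrite ler_wpM2l // natrM ler_pM.
  have -> : p * (3 * x * (3 * x)) = 9 * d * (p * (x * n%:R)) by ring.
  apply: le_trans (_ : 9 * d * (t / 6) <= _).
    by rewrite ler_wpM2l ?mulr_ge0 ?(ltW d0) //; apply: le_trans pX _; rewrite ler_wpM2r.
  rewrite -[d]invrK -t_sqr le_eqVlt; apply/orP; left; apply/eqP; field; exact: lt0r_neq0.
have pbn : 2 * p * (b * n)%:R <= ln t.
  apply: le_trans (_ : 2 * p * (3 * x * n%:R) <= _).
    by rewrite ler_wpM2l ?mulr_ge0 // natrM ler_wpM2r.
  by have := pX; lra.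
have pb_half : p * (b * b)%:R <= 2^-1.
  by apply: le_trans pb_sqr _; rewrite ler_pdivrMr //; move: t3; lra.
have kn : (k <= n)%N by exact: leq_div.
have card_le j : (#|class n k j| <= b)%N by exact: card_class_le.
apply: le_trans
  (prob_hamiltonian_second_moment p01 clique_count_gt1 kn (ltn0Sn _) card_le pb_half) _.
have mean_ge : (k%:R * expR (- (2 * p * (b * n)%:R)))^-1 <= 3 / t.
  rewrite -[leRHS]invf_div lef_pV2 ?posrE ?divr_gt0 ?mulr_gt0 ?expR_gt0 ?ltr0n //.
  apply: le_trans (_ : k%:R * expR (- ln t) <= _); last by rewrite ler_wpM2l // ler_expR lerN2.
  rewrite expRN lnK // ler_pdivlMr //; have := inv_density_le_clique_count.
  by have := sqr_ge0 t; rewrite -t_sqr; lra.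
apply: le_trans (lerD mean_ge (ler_wpM2l _ pb_sqr)) _ => //.
by rewrite le_eqVlt; apply/orP; left; apply/eqP; field; exact: lt0r_neq0.
Qed.

End SmallCliques.

Section LowerBound.
Variable R : realType.
Local Open Scope ring_scope.
Local Open Scope classical_set_scope.
Implicit Types (delta p : nat -> R) (c : R).

Lemma clique_regime_near delta c : 0 < c ->
  (\forall n \near \oo, c * (n%:R `^ (- (1 / 3)) : R) <= delta n) -> delta @ \oo --> (0 : R) ->
  \forall n \near \oo, clique_regime n (delta n) /\ c ^+ 3 <= delta n ^+ 3 * n%:R.
Proof.
move=> c0 delta_ge delta_cvg; near=> n.
have n0 : (0 < n)%N by near: n; exact: nbhs_infty_gt.
have cn : c * (n%:R `^ (- (1 / 3)) : R) <= delta n by near: n.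
have [d0 cubed sqr] := density_bounds n0 c0 cn.
have d1 : delta n <= 20^-1 by near: n; apply: (cvgr_le _ delta_cvg); rewrite invr_gt0.
split=> //; split=> //; last by rewrite -[20]invrK lef_pV2 ?posrE // invr_gt0.
have ln_ge : 60 / c ^+ 2 <= ln n%:R by near: n; exact: ln_nat_near.
have c2 : 0 < c ^+ 2 by rewrite exprn_gt0.
apply: le_trans (_ : delta n ^+ 2 * n%:R <= _); last first.
  by rewrite ler_wpM2r // expr2 ler_piMl ?(ltW d0) //; move: d1; lra.
apply: le_trans sqr; apply: le_trans (_ : c ^+ 2 * (ln n%:R / 3) <= _).
  by move: ln_ge; rewrite ler_pdivrMr //; lra.
rewrite ler_wpM2l ?(ltW c2) //; apply: le_trans (expR_ge1Dx _).
by rewrite lerDr ler01.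
Unshelve. all: by end_near. Qed.

Lemma not_hamiltonian_cliques delta :
  (exists c : R, 0 < c /\ \forall n \near \oo, c * (n%:R `^ (- (1 / 3)) : R) <= delta n) ->
  delta @ \oo --> (0 : R) ->
  exists H : forall n : nat, {set {set 'I_n}},
    (forall n, is_graph (H n)) /\
    (\forall n \near \oo, delta n * n%:R <= (mindeg (H n))%:R) /\
    (exists C : R, 0 < C /\
       \forall n \near \oo, ((alpha (H n))%:R : R) <= C * delta n ^+ 2 * n%:R) /\
    (forall p : nat -> R,
       (forall n, 0 <= p n <= 1) ->
       (\forall n \near \oo, p n <= 12^-1 * ln (delta n)^-1 / (delta n * n%:R ^+ 2)) ->
       (fun n => prob_union (H n) (p n) (fun E => ~~ hamiltonian E)) @ \oo --> (1 : R)).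
Proof.
move=> [c [c0 delta_ge]] delta_cvg; have regime_near := clique_regime_near c0 delta_ge delta_cvg.
exists (fun n => class_graph n (clique_count n (delta n))); split.
  by move=> n; exact: class_graph_is_graph.
split; first by apply: filterS regime_near => n [regime _]; exact: density_le_mindeg_cliques.
split.
  exists (c ^- 3); split; first by rewrite invr_gt0 exprn_gt0.
  by apply: filterS regime_near => n [regime cubed]; exact: alpha_cliques_le.
move=> p p01 p_le; apply/cvgrPdist_le => eps eps0.
pose B : R := Num.max 3 (6 / eps); have B0 : 0 < B by rewrite lt_max ltr0n.
near=> n.
have [regime _] : clique_regime n (delta n) /\ c ^+ 3 <= delta n ^+ 3 * n%:R by near: n.
have pn_le : p n <= 12^-1 * ln (delta n)^-1 / (delta n * n%:R ^+ 2) by near: n.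
have delta_B : delta n <= B ^- 2.
  by near: n; apply: (cvgr_le _ delta_cvg); rewrite invr_gt0 exprn_gt0.
have [delta0 _ _] := regime.
have B_le : B <= Num.sqrt (delta n)^-1.
  rewrite -[leLHS]gtr0_norm // -sqrtr_sqr ler_sqrt ?invr_ge0 ?(ltW delta0) //.
  by rewrite -[B ^+ 2]invrK lef_pV2 ?posrE ?invr_gt0 ?exprn_gt0.
have [t3 t_eps] : 3 <= Num.sqrt (delta n)^-1 /\ 6 / eps <= Num.sqrt (delta n)^-1.
  by split; apply: le_trans B_le; rewrite le_max lexx ?orbT.
rewrite prob_unionC opprB addrCA subrr addr0 ger0_norm ?prob_union_ge0 //.
apply: le_trans (prob_hamiltonian_cliques_le regime (p01 n) pn_le t3) _.
by rewrite ler_pdivrMr ?(lt_le_trans _ t3) // mulrC -ler_pdivrMr.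
Unshelve. all: by end_near. Qed.

End LowerBound.

Local Open Scope ring_scope.
Local Open Scope classical_set_scope.

Theorem theorem1p2 (R : realType) :
  exists c1 c2 c3 c4 : R, [/\ 0 < c1, 0 < c2, 0 < c3, 0 < c4 &
  [/\
  (* (a) *)
  (forall (delta p : nat -> R) (G : forall n : nat, {set {set 'I_n}}),
     (forall n, is_graph (G n)) ->
     (forall n, 0 <= p n <= 1) ->
     (\forall n \near \oo,
        [/\ c1 * (n%:R `^ (- (1 / 3)) : R) <= delta n,
            delta n * n%:R <= (mindeg (G n))%:R,
            ((alpha (G n))%:R : R) <= c2 * delta n ^+ 2 * n%:R &
            c3 * ln (delta n)^-1 / (delta n * n%:R ^+ 2) <= p n]) ->
     (fun n => p n * n%:R ^+ 2) @ \oo --> +oo ->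
     (fun n => prob_union (G n) (p n) (@pancyclic n)) @ \oo --> (1 : R)),
  (* (b) *)
  (exists H : forall n : nat, {set {set 'I_n}},
     (forall n, is_graph (H n)) /\
     (forall n, (2 <= n)%N -> mindeg (H n) = (n./2 - 1)%N /\ alpha (H n) = 2%N) /\
     (forall p : nat -> R,
        (forall n, 0 <= p n <= 1) ->
        (fun n => prob_union (H n) (p n) (@hamiltonian n)) @ \oo --> (1 : R) ->
        (fun n => p n * n%:R ^+ 2) @ \oo --> +oo)) &
  (* (c) *)
  (forall delta : nat -> R,
     (exists c : R, 0 < c /\ \forall n \near \oo, c * (n%:R `^ (- (1 / 3)) : R) <= delta n) ->
     delta @ \oo --> (0 : R) ->
     exists H : forall n : nat, {set {set 'I_n}},
       (forall n, is_graph (H n)) /\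
       (\forall n \near \oo, delta n * n%:R <= (mindeg (H n))%:R) /\
       (exists C : R, 0 < C /\
          \forall n \near \oo, ((alpha (H n))%:R : R) <= C * delta n ^+ 2 * n%:R) /\
       (forall p : nat -> R,
          (forall n, 0 <= p n <= 1) ->
          (\forall n \near \oo, p n <= c4 * ln (delta n)^-1 / (delta n * n%:R ^+ 2)) ->
          (fun n => prob_union (H n) (p n) (fun E => ~~ hamiltonian E)) @ \oo --> (1 : R)))
  ]].
Proof.
exists 256, ((1000 * 1000)^-1), (256 * 256), (12^-1).
split; [by rewrite ltr0n | by rewrite invr_gt0 mulr_gt0 ?ltr0n | by rewrite mulr_gt0 ?ltr0n |
  by rewrite invr_gt0 ltr0n |].
split; [exact: pancyclic_aas | | exact: not_hamiltonian_cliques].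
exists (fun n => class_graph n 2); split; first by move=> n; exact: class_graph_is_graph.
split; last exact: hamiltonian_two_cliques.
by move=> n n2; rewrite mindeg_two_cliques // alpha_two_cliques.
Qed.
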